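(* Fix $a\in\mathbb R$. There are choices of $r=r(\varepsilon')>0$, $\tau=\tau(\varepsilon')>0$ and $N=N(\varepsilon',\delta)\in\mathbb N$, defined for all $\varepsilon'>0$ and $\delta>0$, with $$r=O(\varepsilon'),\qquad \tau=O(\log(1/\varepsilon')),\qquad N=O\left(\frac{\log(1/\delta)}{\varepsilon'^4}\right)$$ (as $\varepsilon',\delta\to0$, with implied constants depending only on $a$ and the problem data $A,B,C,Q,R,\mathcal D$), such that for every $\varepsilon'>0$, every $\delta>0$ and every $K\in S(a)$, the estimate $\hat\nabla f(K)$ formed with these parameters satisfies $$\|\hat\nabla f(K)-\nabla f(K)\|_F\le\varepsilon'$$ with probability greater than $1-\delta$.
   Context: Setting. $A\in\mathbb R^{n\times n}$, $B\in\mathbb R^{n\times m}$, $C\in\mathbb R^{p\times n}$ with $B\ne0$, $C\neq 0$; $Q\in\mathbb R^{p\times p}$, $R\in\mathbb R^{m\times m}$ are (symmetric) positive definite; $\mathcal D$ is a probability distribution on $\mathbb R^n$ with $\Sigma:=E_{x(0)\sim\mathcal D}[x(0)x(0)^\top]\succ0$ and $\|x(0)\|\le P$ almost surely for a constant $P>0$; the pair $(A,C)$ is observable. For $K\in\mathbb R^{m\times p}$ put $A_K:=A-BKC$ and $S:=\{K\in\mathbb R^{m\times p}: A_K\text{ is Hurwitz}\}$ (all eigenvalues have negative real part). $\Omega\subset\mathbb R^{m\times p}$ is a closed convex set (the set of structured gains), and it is assumed that there is some $K_0\in\Omega\cap S$. For $K\in S$, $$f(K):=E_{x(0)\sim\mathcal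 D}\left[\int_0^\infty x(0)^\top e^{A_K^\top t}C^\top(Q+K^\top RK)Ce^{A_Kt}x(0)\,dt\right],$$ and $S(a):=\{K\in S: f(K)\le a\}$. $\|\cdot\|_F$ is the Frobenius norm. Gradient estimate. For parameters $N\in\mathbb N$, $r>0$, $\tau>0$ and $K\in\mathbb R^{m\times p}$, sample $U_1,\dots,U_N$ independently from the uniform distribution on $\{U\in\mathbb R^{m\times p}:\|U\|_F=\sqrt{mp}\}$ and, independently of these, $x_1(0),\dots,x_N(0)$ independently from $\mathcal D$. With $K_i':=K+rU_i$, let $x_i(t)=e^{A_{K_i'}t}x_i(0)$, $y_i(t)=Cx_i(t)$, $u_i(t)=-K_i'y_i(t)$, $c_i=\int_0^\tau [y_i(t)^\top Qy_i(t)+u_i(t)^\top Ru_i(t)]\,dt$, and $$\hat\nabla f(K):=\frac1{rN}\sum_{i=1}^Nc_iU_i .$$ *)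

(* Defs.v *)
(* MathComp / MathComp-Analysis. *)
From HB Require Import structures.
From mathcomp Require Import all_boot all_order all_algebra.
From mathcomp Require Import all_classical all_reals all_analysis.
From mathcomp Require Import complex.

Set Implicit Arguments.
Unset Strict Implicit.
Unset Printing Implicit Defensive.

Import Order.TTheory GRing.Theory Num.Theory.
Import numFieldNormedType.Exports.

Local Open Scope classical_set_scope.
Local Open Scope ring_scope.

(* The Borel sigma-algebra: the topology of 'M[R]_(m, n) comes from the max
   norm, which is equivalent to the Frobenius norm. *)
Notation borel_mx R m n := (g_sigma_algebraType (@open 'M[R]_(m, n))).

Section matrices.
Variable R : realType.

(* The library norm `|M| on matrices is the max norm. On columns, frobenius
   is the Euclidean norm. *)
Definition frobenius m n (M : 'M[R]_(m, n)) : R :=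
  Num.sqrt (\sum_i \sum_j M i j ^+ 2).

Definition posdefmx n (M : 'M[R]_n) : Prop :=
  M^T = M /\ forall x : 'cV[R]_n, x != 0 -> 0 < (x^T *m M *m x) 0 0.

Definition expmx n (M : 'M[R]_n) : 'M[R]_n :=
  limn (series (fun k : nat => k`!%:R^-1 *: M ^+ k)).

Definition hurwitz n (M : 'M[R]_n) : Prop :=
  forall z : R[i], eigenvalue (map_mx (real_complex R) M) z -> complex.Re z < 0.

(* The initial state of x' = A x is determined by the output C x on [0, +oo[ *)
Definition observable n p (A : 'M[R]_n) (C : 'M[R]_(p, n)) : Prop :=
  forall x y : 'cV[R]_n,
    (forall t : R, 0 <= t ->
       C *m expmx (t *: A) *m x = C *m expmx (t *: A) *m y) ->
    x = y.

End matrices.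

Section probability.
Variable R : realType.

Definition second_moment n (D : probability (borel_mx R n 1) R) : 'M[R]_n :=
  \matrix_(i, j) fine ('E_D[fun x : 'cV[R]_n => (x *m x^T) i j])%E.

(* The uniform distribution on the Frobenius sphere of radius rho, i.e. the
   normalized surface measure: the unique Borel probability carried by this
   sphere and invariant under the orthogonal group of R^(m x p). All linear
   isometries are allowed, not only those of the form M |-> O1 M O2. *)
Definition uniform_on_sphere m p (rho : R)
    (nu : set (borel_mx R m p) -> \bar R) : Prop :=
  nu [set M : 'M[R]_(m, p) | frobenius M = rho] = 1%E /\
  forall Phi : {linear 'M[R]_(m, p) -> 'M[R]_(m, p)},
    (forall M, frobenius (Phi M) = frobenius M) ->
    forall S : set (borel_mx R m p), measurable S -> nu (Phi @^-1` S) = nu S.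

Definition mutually_independent d (T : measurableType d)
    (P : probability T R) (I : finType) (F : I -> set_system T) : Prop :=
  forall (J : {set I}) (E : I -> set T),
    (forall i, i \in J -> F i (E i)) ->
    P (\bigcap_(i in [set` J]) E i) = (\prod_(i in J) P (E i))%E.

(* The 2N variables U_1, ..., U_N, x_1(0), ..., x_N(0) are jointly independent. *)
Definition is_sample d (T : measurableType d) (P : probability T R)
    n m p (D : probability (borel_mx R n 1) R) (N : nat)
    (U : 'I_N -> {RV P >-> borel_mx R m p})
    (X : 'I_N -> {RV P >-> borel_mx R n 1}) : Prop :=
  [/\ forall i, uniform_on_sphere (Num.sqrt (m * p)%:R) (distribution P (U i)),
      forall i (S : set (borel_mx R n 1)), measurable S ->
        distribution P (X i) S = D S &
      mutually_independent P (fun k : 'I_N + 'I_N =>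
        match k with
        | inl i => g_sigma_algebra_preimage (U i)
        | inr i => g_sigma_algebra_preimage (X i)
        end)].

End probability.

Section output_feedback.
Variables (R : realType) (n m p : nat).
Variables (A : 'M[R]_n) (B : 'M[R]_(n, m)) (C : 'M[R]_(p, n)).
(* W is the input weight usually written R. *)
Variables (Q : 'M[R]_p) (W : 'M[R]_m).
Variable D : probability (borel_mx R n 1) R.

Local Notation mu := (@lebesgue_measure R).

Definition closed_loop (K : 'M[R]_(m, p)) : 'M[R]_n := A - B *m K *m C.

Definition stabilizing : set 'M[R]_(m, p) :=
  [set K | hurwitz (closed_loop K)].

Definition running_cost (K : 'M[R]_(m, p)) (x : 'cV[R]_n) (t : R) : R :=
  (x^T *m expmx (t *: (closed_loop K)^T) *m C^T *m (Q + K^T *m W *m K) *m C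
     *m expmx (t *: closed_loop K) *m x) 0 0.

Definition ecost (K : 'M[R]_(m, p)) : \bar R :=
  (\int[D]_x \int[mu]_(t in `[0%R, +oo[) (running_cost K x t)%:E)%E.

(* ecost is finite on the stabilizing gains when D has bounded support; these
   gains form an open set, so the values of cost elsewhere do not affect its
   gradient there. *)
Definition cost (K : 'M[R]_(m, p)) : R := fine (ecost K).

Definition sublevel (a : R) : set 'M[R]_(m, p) :=
  [set K | stabilizing K /\ (ecost K <= a%:E)%E].

Definition grad_cost (K : 'M[R]_(m, p)) : 'M[R]_(m, p) :=
  \matrix_(i, j) 'D_(delta_mx i j) cost K.

Definition state (K : 'M[R]_(m, p)) (x0 : 'cV[R]_n) (t : R) : 'cV[R]_n :=
  expmx (t *: closed_loop K) *m x0.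

Definition output (K : 'M[R]_(m, p)) (x0 : 'cV[R]_n) (t : R) : 'cV[R]_p :=
  C *m state K x0 t.

Definition input (K : 'M[R]_(m, p)) (x0 : 'cV[R]_n) (t : R) : 'cV[R]_m :=
  - (K *m output K x0 t).

Definition truncated_cost (tau : R) (K : 'M[R]_(m, p)) (x0 : 'cV[R]_n) : R :=
  \int[mu]_(t in `[0, tau])
    (((output K x0 t)^T *m Q *m output K x0 t) 0 0
     + ((input K x0 t)^T *m W *m input K x0 t) 0 0).

Definition grad_estimate (N : nat) (r tau : R) (K : 'M[R]_(m, p))
    (U : 'I_N -> 'M[R]_(m, p)) (x0 : 'I_N -> 'cV[R]_n) : 'M[R]_(m, p) :=
  (r * N%:R)^-1 *:
    \sum_(i < N) truncated_cost tau (K + r *: U i) (x0 i) *: U i.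

End output_feedback.

(* Main.v *)
Require Import Defs.
From HB Require Import structures.
From mathcomp Require Import all_boot all_order all_algebra.
From mathcomp Require Import all_classical all_reals all_analysis.
From mathcomp Require Import measurable_realfun ring lra.

Set Implicit Arguments.
Unset Strict Implicit.
Unset Printing Implicit Defensive.

Import Order.TTheory GRing.Theory Num.Theory.
Import numFieldNormedType.Exports.

Local Open Scope classical_set_scope.
Local Open Scope ring_scope.


(** The estimator is an average of the terms c_i U_i / r, where c_i is the cost
    over [0, tau] observed with the gain K + r U_i. Averaging over the initial
    state replaces c_i by the mean truncated cost at K + r U_i, which is the cost
    f(K + r U_i) up to an error exponentially small in tau, and f(K + r U_i) is
    f(K) + r <grad f(K), U_i> up to an error of order r^2. As U_i has mean 0 and its
    entries are uncorrelated with variance 1, the mean of (f(K) + r <G, U_i>) U_i / r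
    is G for every matrix G; so the bias of the estimator is
    O(r + exp (- k tau) / r), and r of order eps and tau of order ln (1 / eps) make
    it at most eps / 2. The terms c_i U_i are bounded and independent, so
    the average of N of them is within a multiple of r eps of its mean except with
    probability of order exp (- N r^2 eps^2 / const), and N of order ln (1 / delta) / eps^4 suffices.

    What is needed is that all the constants are uniform over the sublevel set
    (cost_regularity). This is not a statement about the stability of a single
    closed loop: if f(K) <= a then, as Q, W and Sigma are definite, the energies of
    the output and of the input along all solutions are bounded by a multiple of a
    (output_energy_bound). The energy of the input bounds K C, because it dominates
    the input at time 0 divided by the size of the closed loop (gain_bound).
    Observability is uniform over bounded gains, by compactness
    (uniform_observability), so the energy of the output bounds the sum of the
    squares of exp (l A_K) over the integers l; since each of these matrices bounds
    the later ones, exp (N A_K) has norm at most 1 / 4 for one N that serves for all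
    K (uniform_decay). This contraction is stable under small perturbations of K,
    so that for all nearby gains the matrix of the cost-to-go is the solution of a
    Lyapunov equation with an a priori estimate (lyap_estimate), from which come the
    first-order expansion of f with a quadratic remainder (cost_first_order) and the
    exponentially small truncation error.

    The moments of the uniform distribution on the sphere follow from its
    invariance under the reflections that change the sign of one entry or exchange
    two entries (sphere_mean, sphere_covariance, sphere_variance). The deviation
    inequality is a Chernoff bound (chernoff_bound); it rests on the product formula
    for the mean of functions of independent pairs (expectation_prod), and is
    applied to each entry of the estimator separately
    (grad_estimate_concentration). *)

(** * The entrywise l1 norm *)

Section entrywise_norm.
Variable R : realType.

(** The sum of the absolute values of the entries. Unlike the library norm (the
    maximum) it is submultiplicative, and it does not see transposition. *)
Definition nrm1 m n (M : 'M[R]_(m, n)) : R := \sum_i \sum_j `|M i j|.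

Lemma nrm1_ge0 m n (M : 'M[R]_(m, n)) : 0 <= nrm1 M.
Proof. by apply: sumr_ge0 => i _; apply: sumr_ge0. Qed.

Lemma ler_entry_nrm1 m n (M : 'M[R]_(m, n)) i j : `|M i j| <= nrm1 M.
Proof.
rewrite /nrm1 (bigD1 i)//= (bigD1 j)//= -addrA lerDl addr_ge0//.
  exact: sumr_ge0.
by apply: sumr_ge0 => k _; exact: sumr_ge0.
Qed.

Lemma nrm1_0 m n : nrm1 (0 : 'M[R]_(m, n)) = 0.
Proof. by rewrite /nrm1 big1// => i _; rewrite big1// => j _; rewrite mxE normr0. Qed.

Lemma nrm1D m n (M N : 'M[R]_(m, n)) : nrm1 (M + N) <= nrm1 M + nrm1 N.
Proof.
rewrite /nrm1 -big_split; apply: ler_sum => i _ /=.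
by rewrite -big_split; apply: ler_sum => j _ /=; rewrite mxE ler_normD.
Qed.

Lemma nrm1N m n (M : 'M[R]_(m, n)) : nrm1 (- M) = nrm1 M.
Proof.
by apply: eq_bigr => i _; apply: eq_bigr => j _; rewrite mxE normrN.
Qed.

Lemma nrm1B m n (M N : 'M[R]_(m, n)) : nrm1 (M - N) <= nrm1 M + nrm1 N.
Proof. by rewrite (le_trans (nrm1D _ _))// nrm1N. Qed.

Lemma nrm1Z m n (a : R) (M : 'M[R]_(m, n)) : nrm1 (a *: M) = `|a| * nrm1 M.
Proof.
rewrite /nrm1 mulr_sumr; apply: eq_bigr => i _; rewrite mulr_sumr.
by apply: eq_bigr => j _; rewrite mxE normrM.
Qed.

Lemma nrm1_tr m n (M : 'M[R]_(m, n)) : nrm1 M^T = nrm1 M.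
Proof.
rewrite /nrm1 exchange_big; apply: eq_bigr => i _.
by apply: eq_bigr => j _; rewrite mxE.
Qed.

Lemma nrm1M m n p (M : 'M[R]_(m, n)) (N : 'M[R]_(n, p)) :
  nrm1 (M *m N) <= nrm1 M * nrm1 N.
Proof.
rewrite /nrm1 mulr_suml; apply: ler_sum => i _.
apply: (@le_trans _ _ (\sum_k \sum_j (`|M i k| * `|N k j|))).
  rewrite exchange_big; apply: ler_sum => j _.
  rewrite mxE (le_trans (ler_norm_sum _ _ _))//.
  by apply: ler_sum => k _; rewrite normrM.
rewrite mulr_suml; apply: ler_sum => k _.
rewrite -mulr_sumr ler_wpM2l// (bigD1 k)//= lerDl.
by apply: sumr_ge0 => l _; exact: sumr_ge0.
Qed.

Lemma nrm1_le_const m n (M : 'M[R]_(m, n)) c :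
  (forall i j, `|M i j| <= c) -> nrm1 M <= (m * n)%:R * c.
Proof.
move=> Mc; apply: (@le_trans _ _ (\sum_(i < m) \sum_(j < n) c)).
  by apply: ler_sum => i _; exact: ler_sum.
under eq_bigr do rewrite sumr_const card_ord.
by rewrite sumr_const card_ord -mulrnA mulr_natl mulnC.
Qed.

Lemma nrm1_eq0 m n (M : 'M[R]_(m, n)) : nrm1 M <= 0 -> M = 0.
Proof.
move=> M0; apply/matrixP => i j; rewrite mxE; apply/eqP.
by rewrite -normr_le0 (le_trans (ler_entry_nrm1 M i j)).
Qed.

Lemma ler_entry_exp n (M : 'M[R]_n) k i j : `|(M ^+ k) i j| <= nrm1 M ^+ k.
Proof.
elim: k i j => [i j|k IH i j].
  by rewrite !expr0 mxE; case: (i == j); rewrite ?normr1 ?normr0.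
rewrite !exprS mxE (le_trans (ler_norm_sum _ _ _))//.
apply: (@le_trans _ _ (\sum_l `|M i l| * nrm1 M ^+ k)).
  by apply: ler_sum => l _; rewrite normrM ler_wpM2l.
rewrite -mulr_suml ler_wpM2r ?exprn_ge0 ?nrm1_ge0//.
rewrite /nrm1 [leRHS](bigD1 i)//= lerDl.
by apply: sumr_ge0 => l _; exact: sumr_ge0.
Qed.

Lemma ler_bilin n q (x : 'cV[R]_n) (M : 'M[R]_(n, q)) (y : 'cV[R]_q) :
  `|(x^T *m M *m y) 0 0| <= nrm1 x * nrm1 M * nrm1 y.
Proof.
rewrite (le_trans (ler_entry_nrm1 _ _ _))// (le_trans (nrm1M _ _))//.
by rewrite ler_wpM2r ?nrm1_ge0// (le_trans (nrm1M _ _))// nrm1_tr.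
Qed.

Lemma bilinE n (x : 'cV[R]_n) (M : 'M[R]_n) :
  (x^T *m M *m x) 0 0 = \sum_i \sum_j M i j * (x i 0 * x j 0).
Proof.
rewrite mxE exchange_big; apply: eq_bigr => j _ /=.
rewrite mxE mulr_suml; apply: eq_bigr => i _; rewrite mxE.
by ring.
Qed.

End entrywise_norm.

(** * Differentiation of matrix functions, entry by entry *)

Section matrix_derivative.
Variable R : realType.

(** F has the derivative dF at the real t. *)
Definition is_mderive m n (F : R -> 'M[R]_(m, n)) (t : R) (dF : 'M[R]_(m, n)) :=
  forall i j, is_derive t (1 : R) (fun s => F s i j : R) (dF i j).

Lemma is_mderive_cst m n (M : 'M[R]_(m, n)) t : is_mderive (fun=> M) t 0.
Proof. by move=> i j; rewrite mxE; exact: is_derive_cst. Qed.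

Lemma is_mderiveM m n p (F : R -> 'M[R]_(m, n)) (G : R -> 'M[R]_(n, p)) t dF dG :
  is_mderive F t dF -> is_mderive G t dG ->
  is_mderive (fun s => F s *m G s) t (dF *m G t + F t *m dG).
Proof.
move=> hF hG i j.
have -> : (fun s => (F s *m G s) i j) =
    \sum_(k < n) ((fun s => F s i k) * (fun s => G s k j)).
  by apply/funext => s; rewrite mxE fct_sumE.
apply: is_derive_eq.
  by apply: is_derive_sum => k; exact: (is_deriveM (hF i k) (hG k j)).
rewrite !mxE -big_split; apply: eq_bigr => k _ /=.
by rewrite addrC /GRing.scale/= [G t k j * _]mulrC.
Qed.

Lemma is_mderive_eq m n (F : R -> 'M[R]_(m, n)) t dF dF' :
  is_mderive F t dF -> dF = dF' -> is_mderive F t dF'.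
Proof. by move=> ? <-. Qed.

Lemma is_mderiveMl m n p (M : 'M[R]_(m, n)) (G : R -> 'M[R]_(n, p)) t dG :
  is_mderive G t dG -> is_mderive (fun s => M *m G s) t (M *m dG).
Proof.
move=> hG; apply: is_mderive_eq; first exact: is_mderiveM (is_mderive_cst M t) hG.
by rewrite mul0mx add0r.
Qed.

Lemma is_mderiveMr m n p (M : 'M[R]_(n, p)) (G : R -> 'M[R]_(m, n)) t dG :
  is_mderive G t dG -> is_mderive (fun s => G s *m M) t (dG *m M).
Proof.
move=> hG; apply: is_mderive_eq; first exact: is_mderiveM hG (is_mderive_cst M t).
by rewrite mulmx0 addr0.
Qed.

Lemma is_derive_continuous (f : R -> R) (t df : R) :
  is_derive t (1 : R) f df -> {for t, continuous f}.
Proof.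
by move=> h; apply: differentiable_continuous; apply/derivable1_diffP; case: h.
Qed.

Lemma mean_value_le (f df : R -> R) (a b c : R) : a <= b ->
  (forall t, a <= t <= b -> is_derive t (1 : R) f (df t)) ->
  (forall t, a <= t <= b -> `|df t| <= c) ->
  `|f b - f a| <= c * (b - a).
Proof.
move=> ab hd hc.
have hd' t : t \in `]a, b[ -> is_derive t (1 : R) f (df t).
  by rewrite in_itv/= => /andP[/ltW ? /ltW ?]; apply: hd; apply/andP.
have fc : {within `[a, b], continuous f}.
  apply: continuous_in_subspaceT => t; rewrite inE/= in_itv/= => tab.
  exact: is_derive_continuous (hd _ tab).
have [t tab ->] := MVT_segment ab hd' fc.
rewrite normrM (ger0_norm (_ : 0 <= b - a)) ?subr_ge0//.
by rewrite ler_wpM2r ?subr_ge0// hc//; move: tab; rewrite in_itv.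
Qed.

Lemma matrix_mean_value_le m n (F dF : R -> 'M[R]_(m, n)) (a b c : R) : a <= b ->
  (forall t, a <= t <= b -> is_mderive F t (dF t)) ->
  (forall t, a <= t <= b -> nrm1 (dF t) <= c) ->
  nrm1 (F b - F a) <= (m * n)%:R * (c * (b - a)).
Proof.
move=> ab hd hc; apply: nrm1_le_const => i j; rewrite !mxE.
apply: (@mean_value_le (fun t => F t i j) (fun t => dF t i j) a b c ab) => t tab.
  exact: hd.
exact: le_trans (ler_entry_nrm1 _ _ _) (hc t tab).
Qed.

Lemma is_mderive0_cst m n (F : R -> 'M[R]_(m, n)) :
  (forall t, is_mderive F t 0) -> forall s t, F s = F t.
Proof.
move=> h s t; apply/matrixP => i j.
apply: (@is_derive_0_is_cst R (fun u => F u i j)) => u.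
by have := h u i j; rewrite mxE.
Qed.

End matrix_derivative.

(** * The matrix exponential *)

Section matrix_exponential.
Variable R : realType.
Implicit Types (n : nat) (t s : R).

Lemma cvg_entrywise m n (T : Type) (F : set_system T) {FF : Filter F}
    (f : T -> 'M[R]_(m, n)) (M : 'M[R]_(m, n)) :
  (forall i j, (fun k => f k i j) @ F --> M i j) -> f @ F --> M.
Proof.
move=> h; apply/cvgrPdist_le => e e0.
near=> k.
rewrite [leLHS]/Num.Def.normr/= mx_normrE (bigmax_le _ (ltW e0))//= => -[i j] _.
rewrite !mxE/=; move: (i) (j).
near: k; apply: filter_forall => i'; apply: filter_forall => j'.
exact: ((cvgrPdist_le _ _).1 (h i' j')).
Unshelve. all: by end_near. Qed.

(** The coefficients of the power series of the entries of t |-> expmx (t *: M). *)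
Definition expmx_coeff n (M : 'M[R]_n) i j : R^nat :=
  fun k => k`!%:R^-1 * (M ^+ k) i j.

Lemma ler_expmx_coeff n (M : 'M[R]_n) i j t k :
  `|expmx_coeff M i j k * t ^+ k| <= exp_coeff (`|t| * nrm1 M) k.
Proof.
rewrite /expmx_coeff /exp_coeff /= exprMn.
have -> : `|t| ^+ k * nrm1 M ^+ k / k`!%:R = k`!%:R^-1 * nrm1 M ^+ k * `|t| ^+ k.
  by rewrite mulrC mulrA mulrAC.
rewrite !normrM normfV normr_nat normrX ler_wpM2r ?exprn_ge0//.
by rewrite ler_wpM2l ?invr_ge0// ler_entry_exp.
Qed.

Lemma is_cvg_expmx_coeff n (M : 'M[R]_n) i j t :
  cvgn (pseries (expmx_coeff M i j) t).
Proof.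
apply: normed_cvg.
apply: (@series_le_cvg _ _ (exp_coeff (`|t| * nrm1 M))).
- by move=> k /=.
- by move=> k; apply: exp_coeff_ge0; rewrite mulr_ge0// nrm1_ge0.
- by move=> k; exact: ler_expmx_coeff.
- exact: is_cvg_series_exp_coeff.
Qed.

Lemma expmx_partial_sum n (M : 'M[R]_n) t i j k :
  (series (fun k : nat => k`!%:R^-1 *: (t *: M) ^+ k) k) i j =
  pseries (expmx_coeff M i j) t k.
Proof.
rewrite /series /pseries /= summxE /series /=; apply: eq_bigr => l _.
rewrite mxE /expmx_coeff -mulrA; congr (_ * _).
elim: l i j => [|l IH] i j; first by rewrite !expr0 mulr1.
rewrite !exprS !mxE mulr_suml; apply: eq_bigr => q _.
by rewrite IH mxE; ring.
Qed.

Lemma cvg_expmx n (M : 'M[R]_n) t :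
  series (fun k : nat => k`!%:R^-1 *: (t *: M) ^+ k) @ \oo -->
    (\matrix_(i, j) limn (pseries (expmx_coeff M i j) t)).
Proof.
apply: cvg_entrywise => i j; rewrite mxE.
under eq_fun do rewrite expmx_partial_sum.
exact: is_cvg_expmx_coeff.
Qed.

Lemma expmxE n (M : 'M[R]_n) t i j :
  expmx (t *: M) i j = limn (pseries (expmx_coeff M i j) t).
Proof.
rewrite /expmx (cvg_lim _ (@cvg_expmx n M t)) ?mxE//; exact: norm_hausdorff.
Qed.

Lemma expmx_coeff_diffs n (M : 'M[R]_n) i j :
  pseries_diffs (expmx_coeff M i j) =
  (fun k => k`!%:R^-1 * (M *m M ^+ k) i j).
Proof.
apply/funext => k; rewrite /pseries_diffs /expmx_coeff factS natrM invfM.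
by rewrite -mulrA mulVKf ?pnatr_eq0// exprS.
Qed.

Lemma cvg_mul_expmx n (P M : 'M[R]_n) t i j :
  pseries (fun k => k`!%:R^-1 * (P *m M ^+ k) i j) t @ \oo -->
    (P *m expmx (t *: M)) i j.
Proof.
have -> : pseries (fun k => k`!%:R^-1 * (P *m M ^+ k) i j) t =
    \sum_(c < n) (fun k => P i c * pseries (expmx_coeff M c j) t k).
  apply/funext => k; rewrite fct_sumE /pseries /series /=.
  under [RHS]eq_bigr do rewrite mulr_sumr.
  rewrite exchange_big; apply: eq_bigr => l _ /=.
  rewrite /expmx_coeff mxE mulr_sumr mulr_suml; apply: eq_bigr => c _.
  by ring.
have -> : (P *m expmx (t *: M)) i j =
    \sum_(c < n) P i c * limn (pseries (expmx_coeff M c j) t).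
  by rewrite mxE; apply: eq_bigr => c _; rewrite expmxE.
apply: (@big_ind2 _ _ (fun (u : R^nat) (l : R) => u @ \oo --> l)).
- exact: cvg_cst.
- by move=> u l v k ul vk; exact: cvgD.
- by move=> c _; apply: cvgMr; exact: is_cvg_expmx_coeff.
Qed.

Lemma is_mderive_expmx n (M : 'M[R]_n) t :
  is_mderive (fun s => expmx (s *: M)) t (M *m expmx (t *: M)).
Proof.
move=> i j.
have cl (P : 'M[R]_n) s a b :
    cvgn (pseries (fun k => k`!%:R^-1 * (P *m M ^+ k) a b) s).
  by apply/cvg_ex; eexists; exact: cvg_mul_expmx.
under [X in is_derive _ _ X]funext do rewrite expmxE.
have := @pseries_snd_diffs R (expmx_coeff M i j) (`|t| + 1) t.
rewrite expmx_coeff_diffs (cvg_lim _ (@cvg_mul_expmx n M M t i j))//; apply.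
- exact: is_cvg_expmx_coeff.
- exact: cl.
- have -> : pseries_diffs (fun k => k`!%:R^-1 * (M *m M ^+ k) i j) =
    (fun k => k`!%:R^-1 * ((M *m M) *m M ^+ k) i j).
    apply/funext => k; rewrite /pseries_diffs factS natrM invfM.
    by rewrite -mulrA mulVKf ?pnatr_eq0// exprS -mulmxA.
  exact: cl.
- by rewrite [ltRHS]ger0_norm ?ltrDl// addr_ge0.
Qed.

Lemma expmx0 n (M : 'M[R]_n) : expmx (0 *: M) = 1%:M.
Proof.
apply/matrixP => i j; rewrite expmxE.
have h : pseries (expmx_coeff M i j) 0 @ \oo --> (1%:M : 'M[R]_n) i j.
  apply/cvgrPdist_le => e e0; near=> k.
  rewrite /pseries /series /=.
  have k0 : (0 < k)%N by near: k; exists 1%N.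
  rewrite -(prednK k0).
  rewrite big_nat_recl//= big1 => [|l _]; last by rewrite exprS !mul0r mulr0.
  by rewrite /expmx_coeff !expr0 fact0 invr1 mulr1 mul1r addr0 subrr normr0 ltW.
by rewrite (cvg_lim _ h).
Unshelve. all: by end_near. Qed.

Lemma ler_entry_expmx n (M : 'M[R]_n) t i j :
  `|expmx (t *: M) i j| <= expR (`|t| * nrm1 M).
Proof.
rewrite expmxE /expR.
have cn : cvgn (series (exp_coeff (`|t| * nrm1 M))) by exact: is_cvg_series_exp_coeff.
have cv : cvgn [normed series (fun k => expmx_coeff M i j k * t ^+ k)].
    apply: (@series_le_cvg _ (fun k => `|expmx_coeff M i j k * t ^+ k|)) cn => [//|k|k];
    last exact: ler_expmx_coeff.
  by apply: exp_coeff_ge0; rewrite mulr_ge0// nrm1_ge0.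
apply: le_trans (lim_series_norm cv) _.
by apply: lim_series_le => // k; exact: ler_expmx_coeff.
Qed.

Lemma nrm1_expmx n (M : 'M[R]_n) t b :
  `|t| * nrm1 M <= b -> nrm1 (expmx (t *: M)) <= (n * n)%:R * expR b.
Proof.
move=> tb; apply: nrm1_le_const => i j.
by rewrite (le_trans (ler_entry_expmx _ _ _ _))// ler_expR.
Qed.

Lemma expmx_tr n (M : 'M[R]_n) t : expmx (t *: M^T) = (expmx (t *: M))^T.
Proof.
apply/matrixP => i j; rewrite mxE !expmxE; congr (limn (pseries _ _)).
apply/funext => k; rewrite /expmx_coeff; congr (_ * _).
suff -> : M^T ^+ k = (M ^+ k)^T by rewrite mxE.
elim: k {t i j} => [|k IH]; first by rewrite !expr0 trmx1.
by rewrite exprS IH exprSr trmx_mul.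
Qed.

Lemma expmx_comm n (M : 'M[R]_n) t :
  M *m expmx (t *: M) = expmx (t *: M) *m M.
Proof.
rewrite -[RHS]trmxK trmx_mul -expmx_tr; apply/matrixP => i j; rewrite [RHS]mxE.
rewrite -(cvg_lim _ (@cvg_mul_expmx n M M t i j))//.
rewrite -(cvg_lim _ (@cvg_mul_expmx n M^T M^T t j i))//.
congr (limn (pseries _ _)).
apply/funext => k; congr (_ * _).
suff -> : M^T ^+ k = (M ^+ k)^T.
  rewrite -trmx_mul [RHS]mxE; have -> // : M *m M ^+ k = M ^+ k *m M.
  by rewrite -[LHS]exprS exprSr.
elim: k {t i j} => [|k IH]; first by rewrite !expr0 trmx1.
by rewrite exprS IH exprSr trmx_mul.
Qed.

Lemma is_mderive_expmx_rev n (M : 'M[R]_n) a t :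
  is_mderive (fun s => expmx ((a - s) *: M)) t (- (expmx ((a - t) *: M) *m M)).
Proof.
move=> i j; rewrite mxE.
have h1 : is_derive t (1 : R) (fun s : R => a - s : R) (- 1).
  have -> : (fun s : R => a - s) = cst a - id by apply/funext.
  by apply: is_derive_eq; rewrite sub0r.
have := @is_derive1_comp R _ (fun s : R => a - s) t _ _ (is_mderive_expmx M (a - t) i j) h1.
by rewrite mulrN1 expmx_comm.
Qed.

(** The function s |-> expmx ((t - s) *: M) *m expmx (s *: N), which
    interpolates between expmx (t *: M) and expmx (t *: N). *)
Lemma is_mderive_duhamel n (M N : 'M[R]_n) t s :
  is_mderive (fun s => expmx ((t - s) *: M) *m expmx (s *: N)) s
    (expmx ((t - s) *: M) *m (N - M) *m expmx (s *: N)).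
Proof.
apply: is_mderive_eq.
  apply: is_mderiveM; first exact: is_mderive_expmx_rev.
  exact: is_mderive_expmx.
by rewrite mulNmx mulmxBr mulmxBl addrC !mulmxA.
Qed.

Lemma expmxD n (M : 'M[R]_n) s t :
  expmx ((s + t) *: M) = expmx (s *: M) *m expmx (t *: M).
Proof.
have h u : is_mderive
    (fun u => expmx ((s + t - u) *: M) *m expmx (u *: M)) u 0.
  apply: is_mderive_eq; first exact: is_mderive_duhamel.
  by rewrite subrr mulmx0 mul0mx.
have := is_mderive0_cst h 0 t.
by rewrite subr0 expmx0 mulmx1 addrK.
Qed.

Lemma expmx_mulrn n (M : 'M[R]_n) t k :
  expmx ((k%:R * t) *: M) = expmx (t *: M) ^+ k.
Proof.
elim: k => [|k IH]; first by rewrite mul0r expmx0 expr0.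
by rewrite -natr1 mulrDl mul1r addrC expmxD IH exprS.
Qed.

Lemma nrm1_expmxB n (M N : 'M[R]_n) t b : 0 <= t ->
  nrm1 M <= b -> nrm1 N <= b ->
  nrm1 (expmx (t *: N) - expmx (t *: M)) <=
    (n * n)%:R ^+ 3 * expR (t * b) ^+ 2 * t * nrm1 (N - M).
Proof.
move=> t0 Mb Nb.
pose F s := expmx ((t - s) *: M) *m expmx (s *: N).
have -> : expmx (t *: N) - expmx (t *: M) = F t - F 0.
  by rewrite /F subrr subr0 !expmx0 mul1mx mulmx1.
set e := expR (t * b); set q : R := (n * n)%:R.
have le s (P : 'M[R]_n) : 0 <= s <= t -> nrm1 P <= b -> nrm1 (expmx (s *: P)) <= q * e.
  move=> /andP[s0 st] Pb; rewrite /q /e; apply: nrm1_expmx.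
  by rewrite ger0_norm// ler_pM// nrm1_ge0.
have := @matrix_mean_value_le R n n F _ 0 t (q * e * nrm1 (N - M) * (q * e)) t0
  (fun s _ => is_mderive_duhamel M N t s).
rewrite subr0 => h; apply: le_trans (h _) _ => [s /andP[s0 st]|].
  rewrite (le_trans (nrm1M _ _))// ler_pM ?nrm1_ge0//; last first.
    by rewrite le// s0.
  rewrite (le_trans (nrm1M _ _))// ler_wpM2r ?nrm1_ge0// le// subr_ge0 st/=.
  by rewrite gerBl.
by rewrite le_eqVlt; apply/orP; left; apply/eqP; rewrite /q; ring.
Qed.

End matrix_exponential.

(** * Integrals of continuous functions over segments *)

Section segment_integral.
Variable R : realType.
Local Notation mu := (@lebesgue_measure R).

Lemma continuous_segment_integrable (f : R -> R) a b :
  continuous f -> mu.-integrable `[a, b] (EFin \o f).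
Proof.
move=> cf; apply: continuous_compact_integrable; first exact: segment_compact.
exact: continuous_subspaceT.
Qed.

Lemma segment_integral_derive (F f : R -> R) (a b : R) : a <= b ->
  continuous f ->
  (forall t, a <= t <= b -> is_derive t (1 : R) F (f t)) ->
  \int[mu]_(t in `[a, b]) f t = F b - F a.
Proof.
rewrite le_eqVlt => /predU1P[<- _ _|ab cf hF].
  by rewrite set_itv1 Rintegral_set1 subrr.
have cF t : a <= t <= b -> {for t, continuous F}.
  by move=> tab; exact: is_derive_continuous (hF t tab).
have dF : derivable_oo_LRcontinuous F a b.
  split.
  + move=> t; rewrite in_itv/= => /andP[/ltW at_ /ltW tb].
    by have [] := hF t; rewrite ?at_.
  + by apply: cvg_at_right_filter; apply: cF; rewrite lexx ltW.
  + by apply: cvg_at_left_filter; apply: cF; rewrite lexx ltW.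
have F'f : {in `]a, b[, derive1 F =1 f}.
  move=> t; rewrite in_itv/= => /andP[/ltW at_ /ltW tb].
  by rewrite derive1E; have [|_ ->] := hF t; rewrite ?at_.
by rewrite /Rintegral (continuous_FTC2 ab (continuous_subspaceT cf) dF F'f).
Qed.

Lemma ler_segment_integral (f g : R -> R) a b : continuous f -> continuous g ->
  (forall t, a <= t <= b -> f t <= g t) ->
  \int[mu]_(t in `[a, b]) f t <= \int[mu]_(t in `[a, b]) g t.
Proof.
move=> cf cg fg; apply: le_Rintegral => //; exact: continuous_segment_integrable.
Qed.

Lemma segment_integral_cst a b c : a <= b ->
  \int[mu]_(t in `[a, b]) (c : R) = c * (b - a).
Proof.
move=> ab; rewrite Rintegral_cst//= lebesgue_measure_itv/= lte_fin.
case: ltP => //= ba; have -> : a = b by apply/le_anti; rewrite ab.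
by rewrite subrr.
Qed.

Lemma continuous_sum_fun (T : topologicalType) (I : Type) (r : seq I)
    (P : pred I) (f : I -> T -> R) :
  (forall i, continuous (f i)) -> continuous (fun t => \sum_(i <- r | P i) f i t).
Proof.
move=> cf; elim: r => [|i r IH].
  have -> : (fun t => \sum_(i <- [::] | P i) f i t) = cst 0.
    by apply/funext => t; rewrite big_nil.
  exact: cst_continuous.
have -> : (fun t => \sum_(j <- i :: r | P j) f j t) =
    if P i then (fun t => f i t + \sum_(j <- r | P j) f j t)
    else (fun t => \sum_(j <- r | P j) f j t).
  by apply/funext => t; rewrite big_cons; case: (P i).
by case: (P i) => // t; apply: cvgD; [exact: cf|exact: IH].
Qed.

Lemma continuous_mul_fun (T : topologicalType) (f g : T -> R) :
  continuous f -> continuous g -> continuous (fun t => f t * g t).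
Proof. by move=> cf cg t; apply: cvgM; [exact: cf|exact: cg]. Qed.

Lemma segment_integral_sum (I : Type) (r : seq I) (f : I -> R -> R) a b :
  (forall i, continuous (f i)) ->
  \int[mu]_(t in `[a, b]) (\sum_(i <- r) f i t) =
  \sum_(i <- r) \int[mu]_(t in `[a, b]) f i t.
Proof.
move=> cf; elim: r => [|i r IH].
  rewrite big_nil; under eq_Rintegral do rewrite big_nil.
  by rewrite /Rintegral integral0.
rewrite big_cons -IH -RintegralD//.
- by apply: eq_Rintegral => t _; rewrite big_cons.
- exact: continuous_segment_integrable.
- by apply: continuous_segment_integrable; exact: continuous_sum_fun.
Qed.

Lemma segment_integralZ c (f : R -> R) a b : continuous f ->
  \int[mu]_(t in `[a, b]) (f t * c) = (\int[mu]_(t in `[a, b]) f t) * c.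
Proof. by move=> cf; rewrite RintegralZr//; exact: continuous_segment_integrable. Qed.

Lemma continuous_primitive (f : R -> R) (a b : R) : a <= b -> continuous f ->
  exists F : R -> R, forall t, a <= t <= b -> is_derive t (1 : R) F (f t).
Proof.
move=> ab cf; exists (fun x => \int[mu]_(t in `[a - 1, x]) f t) => t /andP[at_ tb].
have tb1 : t < b + 1 by rewrite (le_lt_trans tb)// ltrDl.
have a1t : a - 1 < t by rewrite (lt_le_trans _ at_)// ltrBlDr ltrDl.
have [d1 d2] := @continuous_FTC1_closed R f (a - 1) t (b + 1) tb1
  (continuous_segment_integrable _ _ cf) a1t (cf t).
by split; [exact: d1|rewrite -derive1E d2].
Qed.

Lemma segment_integral_shift (f : R -> R) a b c : a <= b -> continuous f ->
  \int[mu]_(t in `[a, b]) f (t + c) = \int[mu]_(t in `[a + c, b + c]) f t.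
Proof.
move=> ab cf; have ab' : a + c <= b + c by rewrite lerD2r.
have [F hF] := continuous_primitive ab' cf.
rewrite (segment_integral_derive ab' cf hF).
have cf' : continuous (fun t => f (t + c)).
  move=> t; apply: continuous_comp; last exact: cf.
  by apply: cvgD; [exact: cvg_id|exact: cvg_cst].
have hF' t : a <= t <= b -> is_derive t (1 : R) (fun t => F (t + c)) (f (t + c)).
  move=> tab.
  have h1 : is_derive t (1 : R) (fun s : R => s + c : R) 1.
    have -> : (fun s : R => s + c) = id + cst c by apply/funext.
    by apply: is_derive_eq; rewrite addr0.
  have h2 : is_derive (t + c) (1 : R) F (f (t + c)) by apply: hF; rewrite !lerD2r.
  by have := @is_derive1_comp R F (fun s : R => s + c) t _ _ h2 h1; rewrite mulr1.
by rewrite (segment_integral_derive ab cf' hF').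
Qed.

Lemma segment_integral_split (f : R -> R) a b c : a <= b <= c -> continuous f ->
  \int[mu]_(t in `[a, c]) f t =
  \int[mu]_(t in `[a, b]) f t + \int[mu]_(t in `[b, c]) f t.
Proof.
move=> /andP[ab bc] cf; have [F hF] := continuous_primitive (le_trans ab bc) cf.
have h1 t : a <= t <= b -> is_derive t (1 : R) F (f t).
  by move=> /andP[at_ tb]; apply: hF; rewrite at_ (le_trans tb).
have h2 t : b <= t <= c -> is_derive t (1 : R) F (f t).
  by move=> /andP[bt tc]; apply: hF; rewrite tc (le_trans ab).
rewrite (segment_integral_derive (le_trans ab bc) cf hF).
rewrite (segment_integral_derive ab cf h1) (segment_integral_derive bc cf h2).
by ring.
Qed.

End segment_integral.

(** * Quadratic forms along a linear flow *)

Section flow_form.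
Variable R : realType.
Local Notation mu := (@lebesgue_measure R).

(** The matrix of the quadratic form x |-> x(t)^T Z x(t), where x(t) is the
    solution of x' = A x starting from x. *)
Definition flow_form n (A Z : 'M[R]_n) (t : R) : 'M[R]_n :=
  (expmx (t *: A))^T *m Z *m expmx (t *: A).

(** The left-hand side A^T X + X A of the Lyapunov equation. *)
Definition lyap_op n (A X : 'M[R]_n) : 'M[R]_n := A^T *m X + X *m A.

Lemma nrm1_lyap_op n (A X : 'M[R]_n) : nrm1 (lyap_op A X) <= 2 * nrm1 A * nrm1 X.
Proof.
rewrite /lyap_op (le_trans (nrm1D _ _))// -mulrA mulr_natl mulr2n.
by rewrite lerD// ?(le_trans (nrm1M _ _))// ?nrm1_tr// mulrC.
Qed.

(** The Frobenius pairing of two matrices. *)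
Definition frob_pair m n (S M : 'M[R]_(m, n)) : R := \sum_i \sum_j M i j * S i j.

Lemma frob_pairZl m n a (S M : 'M[R]_(m, n)) :
  frob_pair (a *: S) M = a * frob_pair S M.
Proof.
rewrite /frob_pair mulr_sumr; apply: eq_bigr => i _.
by rewrite mulr_sumr; apply: eq_bigr => j _; rewrite mxE; ring.
Qed.

Lemma frob_pairZr m n a (S M : 'M[R]_(m, n)) :
  frob_pair S (a *: M) = a * frob_pair S M.
Proof.
rewrite /frob_pair mulr_sumr; apply: eq_bigr => i _.
by rewrite mulr_sumr; apply: eq_bigr => j _; rewrite mxE; ring.
Qed.

Lemma frob_pairDr m n (S M N : 'M[R]_(m, n)) :
  frob_pair S (M + N) = frob_pair S M + frob_pair S N.
Proof.
rewrite /frob_pair -big_split; apply: eq_bigr => i _ /=.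
by rewrite -big_split; apply: eq_bigr => j _ /=; rewrite mxE; ring.
Qed.

Lemma frob_pairBr m n (S M N : 'M[R]_(m, n)) :
  frob_pair S (M - N) = frob_pair S M - frob_pair S N.
Proof. by rewrite -scaleN1r frob_pairDr frob_pairZr mulN1r. Qed.

Lemma ler_frob_pair m n (S M : 'M[R]_(m, n)) :
  `|frob_pair S M| <= nrm1 S * nrm1 M.
Proof.
rewrite /frob_pair /nrm1 mulr_suml (le_trans (ler_norm_sum _ _ _))//.
apply: ler_sum => i _; rewrite mulr_suml (le_trans (ler_norm_sum _ _ _))//.
apply: ler_sum => j _; rewrite normrM mulrC ler_wpM2l//.
exact: ler_entry_nrm1.
Qed.

Lemma quad_frob_pair n (x : 'cV[R]_n) (M : 'M[R]_n) :
  (x^T *m M *m x) 0 0 = frob_pair (x *m x^T) M.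
Proof.
rewrite bilinE; apply: eq_bigr => i _; apply: eq_bigr => j _.
by rewrite mxE big_ord1 mxE.
Qed.

Lemma is_derive_frob_pair m n (S : 'M[R]_(m, n)) (F : R -> 'M[R]_(m, n)) t dF :
  is_mderive F t dF ->
  is_derive t (1 : R) (fun s => frob_pair S (F s)) (frob_pair S dF).
Proof.
move=> hF.
have -> : (fun s => frob_pair S (F s)) =
    \sum_i \sum_j ((fun s => F s i j : R) * cst (S i j)).
  apply/funext => s; rewrite fct_sumE; apply: eq_bigr => i _.
  by rewrite fct_sumE.
apply: is_derive_sum => i; apply: is_derive_sum => j.
apply: is_derive_eq.
  exact: (is_deriveM (hF i j) (is_derive_cst (S i j) t (1 : R))).
by rewrite scaler0 add0r /GRing.scale/= mulrC.
Qed.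

Lemma flow_form0 n (A Z : 'M[R]_n) : flow_form A Z 0 = Z.
Proof. by rewrite /flow_form expmx0 trmx1 mul1mx mulmx1. Qed.

Lemma is_mderive_flow_form n (A Z : 'M[R]_n) t :
  is_mderive (flow_form A Z) t (flow_form A (lyap_op A Z) t).
Proof.
have dT : is_mderive (fun s => (expmx (s *: A))^T) t ((expmx (t *: A))^T *m A^T).
  move=> i j; under [X in is_derive _ _ X]funext do rewrite mxE.
  by rewrite -trmx_mul mxE; exact: is_mderive_expmx.
apply: is_mderive_eq.
  apply: is_mderiveM (is_mderive_expmx A t).
  exact: is_mderiveMr dT.
by rewrite /flow_form /lyap_op mulmxDr mulmxDl !mulmxA.
Qed.

Lemma lyap_op_flow_form n (A Z : 'M[R]_n) t :
  flow_form A (lyap_op A Z) t = lyap_op A (flow_form A Z t).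
Proof.
have c := expmx_comm A t; have cT := congr1 trmx c; rewrite !trmx_mul in cT.
rewrite /flow_form /lyap_op; set E := expmx (t *: A) in c cT *.
rewrite mulmxDr mulmxDl; congr (_ + _); first by rewrite !mulmxA cT.
by rewrite -!mulmxA c.
Qed.

Lemma continuous_flow_form n (A Z : 'M[R]_n) i j :
  continuous (fun t => flow_form A Z t i j).
Proof. by move=> t; exact: is_derive_continuous (is_mderive_flow_form A Z t i j). Qed.

Lemma continuous_frob_pair_flow n (S F Z : 'M[R]_n) :
  continuous (fun t => frob_pair S (flow_form F Z t)).
Proof.
apply: continuous_sum_fun => i; apply: continuous_sum_fun => j.
by apply: continuous_mul_fun; [exact: continuous_flow_form|exact: cst_continuous].
Qed.

Lemma nrm1_conj q r s u (E : 'M[R]_(q, r)) (F : 'M[R]_(s, u)) (Z : 'M[R]_(q, s))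
    e f z : nrm1 E <= e -> nrm1 F <= f ->
  nrm1 Z <= z -> nrm1 (E^T *m Z *m F) <= e * z * f.
Proof.
move=> Ee Ff Zz; rewrite (le_trans (nrm1M _ _))// ler_pM ?nrm1_ge0//.
by rewrite (le_trans (nrm1M _ _))// ler_pM ?nrm1_ge0// nrm1_tr.
Qed.

(** On a bounded time interval and for bounded data, flow_form is Lipschitz in
    both matrices. *)
Lemma flow_form_lipschitz n (tau b z : R) : 0 <= tau -> exists2 L, 0 <= L &
  forall (A A' Z Z' : 'M[R]_n) t, 0 <= t <= tau ->
    nrm1 A <= b -> nrm1 A' <= b -> nrm1 Z <= z -> nrm1 Z' <= z ->
  nrm1 (flow_form A' Z' t - flow_form A Z t) <=
    L * (nrm1 (A' - A) + nrm1 (Z' - Z)).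
Proof.
move=> tau0; set q : R := (n * n)%:R.
have q0 : 0 <= q by [].
pose e := q * expR (tau * `|b|).
pose l := q ^+ 3 * expR (tau * `|b|) ^+ 2 * tau.
have e0 : 0 <= e by rewrite mulr_ge0// expR_ge0.
have l0 : 0 <= l by rewrite !mulr_ge0// ?exprn_ge0// expR_ge0.
have zz0 := normr_ge0 z.
exists (2 * (l * `|z| * e) + e * e).
  by rewrite addr_ge0// ?mulr_ge0//.
move=> A A' Z Z' t /andP[t0 tt] Ab A'b Zz Z'z.
have Ab1 := le_trans Ab (ler_norm b); have A'b1 := le_trans A'b (ler_norm b).
have Zz1 := le_trans Zz (ler_norm z); have Z'z1 := le_trans Z'z (ler_norm z).
have he (P : 'M[R]_n) : nrm1 P <= `|b| -> nrm1 (expmx (t *: P)) <= e.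
  by move=> Pb; apply: nrm1_expmx; rewrite ger0_norm// ler_pM// nrm1_ge0.
have hd : nrm1 (expmx (t *: A') - expmx (t *: A)) <= l * nrm1 (A' - A).
  apply: le_trans (nrm1_expmxB t0 Ab1 A'b1) _; rewrite ler_wpM2r ?nrm1_ge0//.
  rewrite /l ler_pM// ?mulr_ge0 ?exprn_ge0 ?expR_ge0// ler_wpM2l ?exprn_ge0//.
  by rewrite lerXn2r ?nnegrE ?expR_ge0// ler_expR ler_wpM2r.
set E := expmx (t *: A); set E' := expmx (t *: A').
have -> : flow_form A' Z' t - flow_form A Z t =
    (E' - E)^T *m Z' *m E' + (E^T *m (Z' - Z) *m E' + E^T *m Z *m (E' - E)).
  have -> : (E' - E)^T = E'^T - E^T by rewrite linearB.
  rewrite /flow_form -/E -/E'; move: E E' (E^T) (E'^T) => E E' F F'.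
  by rewrite !(mulmxBl, mulmxBr) !addrA !subrK.
set dA := nrm1 (A' - A); set dZ := nrm1 (Z' - Z).
have h1 : nrm1 ((E' - E)^T *m Z' *m E') <= (l * dA) * `|z| * e.
  by apply: nrm1_conj => //; exact: he.
have h2 : nrm1 (E^T *m (Z' - Z) *m E') <= e * dZ * e.
  by apply: nrm1_conj => //; exact: he.
have h3 : nrm1 (E^T *m Z *m (E' - E)) <= e * `|z| * (l * dA).
  by apply: nrm1_conj => //; exact: he.
apply: le_trans (nrm1D _ _) _.
apply: le_trans (lerD h1 (le_trans (nrm1D _ _) (lerD h2 h3))) _.
have dA0 : 0 <= dA by exact: nrm1_ge0.
have dZ0 : 0 <= dZ by exact: nrm1_ge0.
rewrite -subr_ge0.
have -> : (2 * (l * `|z| * e) + e * e) * (dA + dZ) -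
    (l * dA * `|z| * e + (e * dZ * e + e * `|z| * (l * dA))) =
    2 * (l * `|z| * e) * dZ + e * e * dA by ring.
by rewrite addr_ge0 ?mulr_ge0.
Qed.

(** The integral over [0, tau] of flow_form. *)
Definition gramian n (A Z : 'M[R]_n) (tau : R) : 'M[R]_n :=
  \matrix_(i, j) \int[mu]_(t in `[0, tau]) flow_form A Z t i j.

Lemma frob_pair_gramian n (S A Z : 'M[R]_n) tau :
  frob_pair S (gramian A Z tau) =
  \int[mu]_(t in `[0, tau]) frob_pair S (flow_form A Z t).
Proof.
have c1 i j : continuous (fun t => flow_form A Z t i j * S i j).
  by move=> t; apply: cvgM; [exact: continuous_flow_form|exact: cvg_cst].
rewrite /frob_pair segment_integral_sum.
  apply: eq_bigr => i _; rewrite segment_integral_sum//.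
  apply: eq_bigr => j _; rewrite mxE segment_integralZ//.
  exact: continuous_flow_form.
by move=> i; exact: continuous_sum_fun.
Qed.

Lemma gramian_lipschitz n (tau b z : R) : 0 <= tau -> exists2 L, 0 <= L &
  forall (A A' Z Z' : 'M[R]_n),
    nrm1 A <= b -> nrm1 A' <= b -> nrm1 Z <= z -> nrm1 Z' <= z ->
  nrm1 (gramian A' Z' tau - gramian A Z tau) <=
    L * (nrm1 (A' - A) + nrm1 (Z' - Z)).
Proof.
move=> tau0; have [L L0 hL] := @flow_form_lipschitz n tau b z tau0.
exists ((n * n)%:R * (L * tau)); first by rewrite !mulr_ge0.
move=> A A' Z Z' Ab A'b Zz Z'z.
rewrite -mulrA; apply: nrm1_le_const => i j; rewrite !mxE.
have ci (B Y : 'M[R]_n) := continuous_segment_integrable 0 tau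
  (@continuous_flow_form n B Y i j).
rewrite -RintegralB//.
have cB : continuous (fun t => flow_form A' Z' t i j - flow_form A Z t i j).
  by move=> t; apply: cvgB; exact: continuous_flow_form.
rewrite (le_trans (le_normr_Rintegral _ (continuous_segment_integrable _ _ cB)))//.
set c := L * _ * _.
have -> : c = L * (nrm1 (A' - A) + nrm1 (Z' - Z)) * (tau - 0).
  by rewrite /c subr0; ring.
rewrite -segment_integral_cst//; apply: ler_segment_integral.
- by move=> t; apply: cvg_norm; exact: cB.
- by move=> t; exact: cvg_cst.
- move=> t tt; apply: le_trans (hL _ _ _ _ t tt Ab A'b Zz Z'z).
  by have := ler_entry_nrm1 (flow_form A' Z' t - flow_form A Z t) i j; rewrite !mxE.
Qed.

End flow_form.

(** * Uniform lower bounds by compactness *)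

Section compactness.
Variable R : realType.
Local Notation mu := (@lebesgue_measure R).

(** The square of the Frobenius norm. *)
Definition fro2 m n (M : 'M[R]_(m, n)) : R := \sum_i \sum_j M i j ^+ 2.

Lemma fro2_ge0 m n (M : 'M[R]_(m, n)) : 0 <= fro2 M.
Proof. by apply: sumr_ge0 => i _; apply: sumr_ge0 => j _; exact: sqr_ge0. Qed.

Lemma ler_entry_fro2 m n (M : 'M[R]_(m, n)) i j : M i j ^+ 2 <= fro2 M.
Proof.
rewrite /fro2 (bigD1 i)//= (bigD1 j)//= -addrA lerDl addr_ge0//.
  by apply: sumr_ge0 => k _; exact: sqr_ge0.
by apply: sumr_ge0 => k _; apply: sumr_ge0 => l _; exact: sqr_ge0.
Qed.

Lemma fro2_eq0 m n (M : 'M[R]_(m, n)) : fro2 M = 0 -> M = 0.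
Proof.
move=> M0; apply/matrixP => i j; rewrite mxE; apply/eqP.
rewrite -sqrf_eq0 eq_le sqr_ge0 andbT.
by have := ler_entry_fro2 M i j; rewrite M0.
Qed.

Lemma fro2Z m n a (M : 'M[R]_(m, n)) : fro2 (a *: M) = a ^+ 2 * fro2 M.
Proof.
rewrite /fro2 mulr_sumr; apply: eq_bigr => i _; rewrite mulr_sumr.
by apply: eq_bigr => j _; rewrite mxE exprMn.
Qed.

Lemma fro2_0 m n : fro2 (0 : 'M[R]_(m, n)) = 0.
Proof. by have := fro2Z 0 (0 : 'M[R]_(m, n)); rewrite scaler0 expr0n mul0r. Qed.

Lemma nrm1_sqr_le m n (M : 'M[R]_(m, n)) :
  nrm1 M ^+ 2 <= (m * n)%:R ^+ 2 * fro2 M.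
Proof.
have h : nrm1 M <= (m * n)%:R * Num.sqrt (fro2 M).
  apply: nrm1_le_const => i j.
  by rewrite -sqrtr_sqr ler_sqrt ?fro2_ge0// ler_entry_fro2.
rewrite -[fro2 M]sqr_sqrtr ?fro2_ge0// -exprMn lerXn2r// nnegrE ?nrm1_ge0//.
Qed.

(** The Frobenius pairing of Gram matrices. *)
Lemma fro2_mulE m n p (F : 'M[R]_(m, n)) (X : 'M[R]_(n, p)) :
  fro2 (F *m X) = frob_pair (X *m X^T) (F^T *m F).
Proof.
have trE q r (M : 'M[R]_(q, r)) : fro2 M = \tr (M^T *m M).
  rewrite /fro2 exchange_big; apply: eq_bigr => j _ /=.
  by rewrite mxE; apply: eq_bigr => i _; rewrite mxE expr2.
have pairE q (S M : 'M[R]_q) : frob_pair S M = \tr (M *m S^T).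
  by apply: eq_bigr => i _; rewrite mxE; apply: eq_bigr => j _; rewrite mxE.
rewrite trE pairE (trmx_mul X) trmxK trmx_mul.
by rewrite -(mulmxA X^T) [LHS]mxtrace_mulC !mulmxA.
Qed.

Lemma compact_box_mx m n (c : R) :
  compact [set M : 'M[R]_(m, n) | forall i j, `|M i j| <= c].
Proof.
have bc : compact [set v : 'rV[R]_(m * n) | forall i, `[- c, c]%classic (v ord0 i)].
  by apply: (@rV_compact R _ (fun=> `[- c, c]%classic)) => _; exact: segment_compact.
have cf : continuous (@vec_mx R m n).
  move=> v; apply: (@cvg_entrywise R m n _ (nbhs v) (nbhs_filter v)) => i j; rewrite mxE.
  under eq_fun do rewrite mxE.
  exact: coord_continuous.
rewrite (_ : mkset _ =
    @vec_mx R m n @` [set v : 'rV[R]_(m * n) | forall i, `[- c, c]%classic (v ord0 i)]).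
  by apply: continuous_compact => //; exact: continuous_subspaceT.
apply/seteqP; split => [M Mc|_ [v vc <-] i j].
  exists (mxvec M); last exact: mxvecK.
  by case/mxvec_indexP => i j; rewrite /= in_itv/= mxvecE -ler_norml; exact: Mc.
by rewrite mxE ler_norml; have := vc (mxvec_index i j); rewrite /= in_itv.
Qed.

Lemma continuous_entry m n i j : continuous (fun M : 'M[R]_(m, n) => M i j).
Proof. exact: coord_continuous. Qed.

Lemma continuous_fro2 m n : continuous (@fro2 m n).
Proof.
apply: continuous_sum_fun => i; apply: continuous_sum_fun => j.
under eq_fun do rewrite expr2.
by apply: continuous_mul_fun; exact: continuous_entry.
Qed.

Lemma closed_fro2 m n (c : R) : closed [set M : 'M[R]_(m, n) | fro2 M = c].
Proof.
apply: (@preimage_closed _ _ (@fro2 m n) [set x | x = c]); last exact: closed_eq.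
by move=> x _; exact: continuous_fro2.
Qed.

(** A continuous family, over a compact set, of positive functions that are
    homogeneous of degree 2 is bounded below by a multiple of fro2. *)
Lemma homogeneous_lower_bound (U : topologicalType) (P : set U) m n
    (f : U * 'M[R]_(m, n) -> R) :
  compact P -> continuous f ->
  (forall u a X, f (u, a *: X) = a ^+ 2 * f (u, X)) ->
  (forall u X, P u -> X != 0 -> 0 < f (u, X)) ->
  exists2 c, 0 < c & forall u X, P u -> c * fro2 X <= f (u, X).
Proof.
move=> cP cf fh fp.
have f0 u : f (u, 0) = 0.
  by have := fh u 0 0; rewrite scaler0 expr0n mul0r.
set S := [set X : 'M[R]_(m, n) | fro2 X = 1].
have cS : compact S.
  apply: subclosed_compact (compact_box_mx (c := 1)) _; first exact: closed_fro2.
  move=> X /= X1 i j; rewrite -(@ler_pXn2r _ 2)// ?nnegrE// expr1n real_normK ?num_real//.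
  by rewrite -X1 ler_entry_fro2.
have [[z [Pz Sz]]|A0] := pselect (exists z : U * 'M[R]_(m, n), P z.1 /\ S z.2); last first.
  exists 1 => // u X Pu; rewrite mul1r.
  have [->|X0] := eqVneq X 0; first by rewrite fro2_0 f0.
  exfalso; apply: A0; exists (u, (Num.sqrt (fro2 X))^-1 *: X); split => //=.
  rewrite /S/= fro2Z exprVn sqr_sqrtr ?fro2_ge0// mulVf//.
  by apply/eqP => /fro2_eq0/eqP; rewrite (negPf X0).
have cPS : compact (P `*` S) by exact: compact_setX.
have PS0 : (P `*` S) !=set0 by exists z.
have [[u0 X0] /set_mem[/= Pu0 SX0] fmin] :=
  compact_EVT_min PS0 cPS (continuous_subspaceT cf).
have X0n0 : X0 != 0.
  by apply/eqP => X00; move: SX0; rewrite /S/= X00 fro2_0 => /eqP; rewrite eq_sym oner_eq0.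
exists (f (u0, X0)); first exact: fp.
move=> u X Pu; have [->|Xn0] := eqVneq X 0; first by rewrite fro2_0 mulr0 f0.
have fX0 : fro2 X != 0 by apply/eqP => /fro2_eq0/eqP; rewrite (negPf Xn0).
have fX1 : 0 < fro2 X by rewrite lt_neqAle eq_sym fX0 fro2_ge0.
have := fmin (u, (Num.sqrt (fro2 X))^-1 *: X).
rewrite fh exprVn sqr_sqrtr ?fro2_ge0// ler_pdivlMl// mulrC; apply.
by apply/mem_set; split => //=; rewrite /S/= fro2Z exprVn sqr_sqrtr ?fro2_ge0// mulVf.
Qed.

Lemma posdef_lower_bound n (M : 'M[R]_n) : posdefmx M ->
  exists2 c, 0 < c & forall x : 'cV[R]_n, c * fro2 x <= (x^T *m M *m x) 0 0.
Proof.
move=> [_ Mp].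
have cf : continuous (fun z : R * 'cV[R]_n => (z.2^T *m M *m z.2) 0 0).
  under eq_fun do rewrite bilinE.
  apply: continuous_sum_fun => i; apply: continuous_sum_fun => j.
  have ce k : continuous (fun z : R * 'cV[R]_n => z.2 k 0).
    move=> z; apply: (@continuous_comp _ _ _ snd (fun v : 'cV[R]_n => v k 0)).
      exact: cvg_snd.
    exact: continuous_entry.
  apply: continuous_mul_fun; first exact: cst_continuous.
  exact: continuous_mul_fun.
have [|||c c0 hc] := @homogeneous_lower_bound R [set 0] n 1 _ _ cf.
- exact: compact_set1.
- move=> u a X; rewrite !bilinE mulr_sumr; apply: eq_bigr => i _.
  by rewrite mulr_sumr; apply: eq_bigr => j _; rewrite !mxE; ring.
- by move=> u X _ X0; exact: Mp.
by exists c => // x; exact: (hc 0).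
Qed.

(** A nonnegative continuous function with zero integral vanishes inside. *)
Lemma segment_integral_eq0 (q : R -> R) : continuous q -> (forall t, 0 <= q t) ->
  \int[mu]_(t in `[0, 1]) q t <= 0 -> forall t, 0 < t < 1 -> q t = 0.
Proof.
move=> cq q0 iq t /andP[t0 t1].
have [F hF] := continuous_primitive ler01 cq.
have Fcst s : 0 <= s <= 1 -> F s = F 0.
  move=> /andP[s0 s1].
  have ge0 (a b : R) : 0 <= \int[mu]_(t in `[a, b]) q t by apply: Rintegral_ge0.
  have h1 : \int[mu]_(t in `[0, s]) q t = F s - F 0.
    apply: segment_integral_derive => // u /andP[u0 us]; apply: hF.
    by rewrite u0 (le_trans us).
  have h2 : \int[mu]_(t in `[s, 1]) q t = F 1 - F s.
    apply: segment_integral_derive => // u /andP[u0 us]; apply: hF.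
    by rewrite us (le_trans s0).
  have h3 : \int[mu]_(t in `[0, 1]) q t = F 1 - F 0.
    exact: segment_integral_derive.
  have := ge0 0 s; have := ge0 s 1; move: iq; rewrite h1 h2 h3 => *; lra.
have : is_derive t (1 : R) F (q t) by apply: hF; rewrite !ltW.
have : is_derive t (1 : R) F 0.
  apply: (@near_eq_is_derive R R R (cst (F 0)) F).
  near=> s; rewrite /cst Fcst//; apply/andP; split.
    by near: s; apply: lt_le_nbhsr.
  by near: s; apply: lt_le_nbhsl.
by move=> [_ <-] [_ <-].
Unshelve. all: by end_near. Qed.

Lemma derive_vanish (F : R -> R) (d t : R) : 0 < t < 1 ->
  (forall s, 0 < s < 1 -> F s = 0) -> is_derive t (1 : R) F d -> d = 0.
Proof.
move=> /andP[t0 t1] F0.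
have : is_derive t (1 : R) F 0.
  apply: (@near_eq_is_derive R R R (cst 0) F).
  near=> s; rewrite /cst F0//; apply/andP; split.
    by near: s; apply: lt_nbhsr.
  by near: s; apply: lt_nbhsl.
by move=> [_ <-] [_ <-].
Unshelve. all: by end_near. Qed.

Lemma expmxN n (M : 'M[R]_n) t : expmx ((- t) *: M) *m expmx (t *: M) = 1%:M.
Proof. by rewrite -expmxD addNr expmx0. Qed.

(** If the output C x(t) of the linear system x' = A x vanishes for 0 < t < 1
    then, by differentiation, so does every C A^k x(t). Here Y is x(1/2). *)
Lemma output_vanish_powers n p q (A : 'M[R]_n) (C : 'M[R]_(p, n))
    (X : 'M[R]_(n, q)) :
  (forall t, 0 < t < 1 -> C *m expmx (t *: A) *m X = 0) ->
  exists2 Y : 'M[R]_(n, q), (forall k, C *m A ^+ k *m Y = 0) & (Y = 0 -> X = 0).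
Proof.
move=> h; have hk k t : 0 < t < 1 -> C *m A ^+ k *m expmx (t *: A) *m X = 0.
  elim: k t => [|k IH] t t01.
    by have := h t t01; rewrite expr0 mulmx1.
  apply/matrixP => i j; rewrite [RHS]mxE.
  have hd : is_mderive (fun s => C *m A ^+ k *m expmx (s *: A) *m X) t
      (C *m A ^+ k.+1 *m expmx (t *: A) *m X).
    apply: is_mderive_eq.
      exact: (is_mderiveMr X (is_mderiveMl (C *m A ^+ k) (is_mderive_expmx A t))).
    by rewrite exprSr !mulmxA.
  by apply: (derive_vanish t01 _ (hd i j)) => s /IH ->; rewrite mxE.
exists (expmx (2^-1 *: A) *m X) => [k|Y0].
  by rewrite mulmxA; apply: hk; apply/andP; split; lra.
by rewrite -[X]mul1mx -(expmxN A 2^-1) -mulmxA Y0 mulmx0.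
Qed.

Lemma observable_powers n p (A : 'M[R]_n) (C : 'M[R]_(p, n)) q (Y : 'M[R]_(n, q)) :
  observable A C -> (forall k, C *m A ^+ k *m Y = 0) -> Y = 0.
Proof.
move=> obs h; apply/matrixP => i j; rewrite mxE.
suff c0 : col j Y = 0 by have := congr1 (fun M : 'cV[R]_n => M i 0) c0; rewrite !mxE.
apply: obs => t t0.
rewrite mulmx0; apply/matrixP => a b; rewrite [RHS]mxE.
pose S k := series (fun k : nat => k`!%:R^-1 *: (t *: A) ^+ k) k.
have S0 k : (C *m S k *m col j Y) a b = 0.
  rewrite /S /series /= mulmx_sumr mulmx_suml big1 ?mxE// => l _.
  have -> : (t *: A) ^+ l = t ^+ l *: A ^+ l.
    elim: l => [|l IH]; first by rewrite !expr0 scale1r.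
    by rewrite !exprS IH -[LHS]scalemxAl -[X in t *: X]scalemxAr scalerA.
  have hc : C *m A ^+ l *m col j Y = 0 by rewrite colE mulmxA h mul0mx.
  by rewrite -!scalemxAr -!scalemxAl hc !scaler0.
pose f (M : 'M[R]_n) := (C *m M *m col j Y) a b.
have cf : continuous f.
  rewrite /f; under eq_fun do rewrite mxE.
  apply: continuous_sum_fun => c; apply: continuous_mul_fun; last exact: cst_continuous.
  under eq_fun do rewrite mxE.
  apply: continuous_sum_fun => e; apply: continuous_mul_fun; first exact: cst_continuous.
  exact: continuous_entry.
have h1 : f \o S @ \oo --> f (expmx (t *: A)).
  apply: continuous_cvg; first exact: cf.
  have := @cvg_expmx R n A t; suff -> : expmx (t *: A) =
    \matrix_(i, j) limn (pseries (expmx_coeff A i j) t) by [].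
  by apply/matrixP => c e; rewrite mxE expmxE.
have h2 : f \o S = cst 0 by apply/funext => k; rewrite /f /= S0.
rewrite h2 in h1.
exact: (cvg_unique _ h1 (cvg_cst _)).
Qed.

Lemma continuous_nrm1 m n : continuous (@nrm1 R m n).
Proof.
apply: continuous_sum_fun => i; apply: continuous_sum_fun => j M.
apply: (@continuous_comp _ _ _ (fun M : 'M[R]_(m, n) => M i j) Num.norm).
  exact: continuous_entry.
exact: norm_continuous.
Qed.

(** Within distance 1 of every K, the distance from F K' to F K is at most a
    constant times the distance from K' to K. *)
Definition locally_lipschitz m n p q (F : 'M[R]_(m, n) -> 'M[R]_(p, q)) :=
  forall K, exists2 L, 0 <= L & forall K', nrm1 (K' - K) <= 1 ->
    nrm1 (F K' - F K) <= L * nrm1 (K' - K).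

Lemma locally_lipschitz_continuous m n p q (F : 'M[R]_(m, n) -> 'M[R]_(p, q)) i j :
  locally_lipschitz F -> continuous (fun K => F K i j).
Proof.
move=> lF K; have [L L0 hL] := lF K.
apply: ((@cvgrPdist_le _ _ _ (nbhs K) (nbhs_filter K) (fun K => F K i j) _).2).
move=> e e0.
have cN : continuous (fun K' : 'M[R]_(m, n) => nrm1 (K' - K)).
  move=> K'; apply: (@continuous_comp _ _ _
    (fun K' : 'M[R]_(m, n) => K' - K) (@nrm1 R m n)).
    by apply: continuousB; [exact: cvg_id|exact: cst_continuous].
  exact: continuous_nrm1.
have L1 : 0 < L + 1 by rewrite ltr_wpDl.
have d0 : 0 < Num.min 1 (e / (L + 1)) by rewrite lt_min ltr01 divr_gt0.
have := (@cvgrPdist_lt _ _ _ (nbhs K) (nbhs_filter K) _ _).1 (cN K) _ d0.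
apply: (@filterS _ (nbhs K) (nbhs_filter K)) => K'.
rewrite subrr nrm1_0 sub0r normrN ger0_norm ?nrm1_ge0//.
rewrite lt_min => /andP[/ltW d1 /ltW d2].
rewrite distrC; have := ler_entry_nrm1 (F K' - F K) i j; rewrite !mxE.
move=> /le_trans; apply; apply: le_trans (hL K' d1) _.
apply: le_trans (ler_wpM2r (nrm1_ge0 _) (_ : L <= L + 1)) _; first by rewrite lerDl.
by rewrite mulrC -ler_pdivlMr.
Qed.

Lemma locally_lipschitz_closed_loop n m p (A : 'M[R]_n) (B : 'M[R]_(n, m))
    (C : 'M[R]_(p, n)) : locally_lipschitz (closed_loop A B C).
Proof.
move=> K; exists (nrm1 B * nrm1 C); first by rewrite mulr_ge0 ?nrm1_ge0.
move=> K' _; have -> : closed_loop A B C K' - closed_loop A B C K =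
    - (B *m (K' - K) *m C).
  by rewrite /closed_loop mulmxBr mulmxBl opprB [LHS]addrC opprB addrA subrK.
rewrite nrm1N (le_trans (nrm1M _ _))// mulrAC ler_wpM2r ?nrm1_ge0//.
exact: nrm1M.
Qed.

Lemma locally_lipschitz_cst m n p q (M : 'M[R]_(p, q)) :
  locally_lipschitz (fun _ : 'M[R]_(m, n) => M).
Proof. by move=> K; exists 0 => // K' _; rewrite subrr nrm1_0 mul0r. Qed.

Lemma locally_lipschitz_gramian m p n (F Z : 'M[R]_(m, p) -> 'M[R]_n) tau :
  0 <= tau -> locally_lipschitz F -> locally_lipschitz Z ->
  locally_lipschitz (fun K => gramian (F K) (Z K) tau).
Proof.
move=> tau0 lF lZ K; have [LF LF0 hF] := lF K; have [LZ LZ0 hZ] := lZ K.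
have [L L0 hL] := @gramian_lipschitz R n tau (nrm1 (F K) + LF) (nrm1 (Z K) + LZ) tau0.
exists (L * (LF + LZ)); first by rewrite mulr_ge0// addr_ge0.
have bd (G : 'M[R]_(m, p) -> 'M[R]_n) LG K' : 0 <= LG -> nrm1 (K' - K) <= 1 ->
    nrm1 (G K' - G K) <= LG * nrm1 (K' - K) -> nrm1 (G K') <= nrm1 (G K) + LG.
  move=> LG0 d h; rewrite -[G K'](subrK (G K)) addrC.
  rewrite (le_trans (nrm1D _ _))// lerD2l (le_trans h)//.
  by rewrite -[leRHS]mulr1 ler_wpM2l.
move=> K' d; apply: le_trans (hL _ _ _ _ _ _ _ _) _.
- by rewrite lerDl.
- by apply: bd d (hF K' d).
- by rewrite lerDl.
- by apply: bd d (hZ K' d).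
rewrite -mulrA ler_wpM2l// mulrDl lerD ?hF ?hZ//.
Qed.

(** Uniform observability of the output C along the closed loops. Output
    injection does not affect unobservable directions: if C x(t) vanishes then
    so does the feedback term, and x(t) follows the open loop. *)
Lemma uniform_observability n m p (A : 'M[R]_n) (B : 'M[R]_(n, m))
    (C : 'M[R]_(p, n)) (b : R) : observable A C ->
  exists2 g, 0 < g & forall (K : 'M[R]_(m, p)) (X : 'M[R]_n),
    (forall i j, `|K i j| <= b) ->
    g * fro2 X <=
      \int[mu]_(t in `[0, 1]) fro2 (C *m expmx (t *: closed_loop A B C K) *m X).
Proof.
move=> obs.
pose G K := gramian (closed_loop A B C K) (C^T *m C) 1.
have qE K (X : 'M[R]_n) t : fro2 (C *m expmx (t *: closed_loop A B C K) *m X) =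
    frob_pair (X *m X^T) (flow_form (closed_loop A B C K) (C^T *m C) t).
  by rewrite fro2_mulE trmx_mul /flow_form !mulmxA.
pose f (z : 'M[R]_(m, p) * 'M[R]_n) := frob_pair (z.2 *m z.2^T) (G z.1).
have fE K X : f (K, X) =
    \int[mu]_(t in `[0, 1]) fro2 (C *m expmx (t *: closed_loop A B C K) *m X).
  by rewrite /f frob_pair_gramian; apply: eq_Rintegral => t _; rewrite qE.
have cq (K : 'M[R]_(m, p)) (X : 'M[R]_n) :
    continuous (fun t : R => fro2 (C *m expmx (t *: closed_loop A B C K) *m X)).
  under eq_fun do rewrite qE.
  apply: continuous_sum_fun => i; apply: continuous_sum_fun => j.
  by apply: continuous_mul_fun; [exact: continuous_flow_form|exact: cst_continuous].
have cG i j : continuous (fun K : 'M[R]_(m, p) => G K i j).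
  apply: locally_lipschitz_continuous; apply: locally_lipschitz_gramian => //.
    exact: locally_lipschitz_closed_loop.
  exact: locally_lipschitz_cst.
have cf : continuous f.
  apply: continuous_sum_fun => i; apply: continuous_sum_fun => j.
  apply: continuous_mul_fun.
    move=> z; apply: (@continuous_comp _ _ _ fst (fun K : 'M[R]_(m, p) => G K i j)).
      exact: cvg_fst.
    exact: cG.
  under eq_fun do rewrite mxE.
  have ce a c : continuous (fun z : 'M[R]_(m, p) * 'M[R]_n => z.2 a c).
    move=> z; apply: (@continuous_comp _ _ _ snd (fun M : 'M[R]_n => M a c)).
      exact: cvg_snd.
    exact: continuous_entry.
  apply: continuous_sum_fun => k; apply: continuous_mul_fun; first exact: ce.
  by under eq_fun do rewrite mxE; exact: ce.
have [|||g g0 hg] := @homogeneous_lower_bound 'M[R]_(m, p)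
    [set K | forall i j, `|K i j| <= b] n n f _ cf.
- exact: compact_box_mx.
- move=> K a X; rewrite /f /=.
  have -> : (a *: X) *m (a *: X)^T = a ^+ 2 *: (X *m X^T).
    by rewrite linearZ/= -scalemxAl -scalemxAr scalerA -expr2.
  exact: frob_pairZl.
- move=> K X Kb X0; rewrite ltNge; apply/negP => fle.
  move/eqP: X0; apply.
  have h t : 0 < t < 1 -> C *m expmx (t *: closed_loop A B C K) *m X = 0.
    move=> t01; apply: fro2_eq0; rewrite fE in fle.
    exact: (segment_integral_eq0 (cq K X) (fun t => fro2_ge0 _) fle t01).
  have [Y hY] := output_vanish_powers h; apply.
  apply: (observable_powers obs) => k.
  suff E : A ^+ k *m Y = closed_loop A B C K ^+ k *m Y.
    by rewrite -mulmxA E mulmxA.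
  have AE (Z : 'M[R]_n) : C *m Z = 0 -> A *m Z = closed_loop A B C K *m Z.
    by move=> CZ; rewrite /closed_loop mulmxBl -[_ *m C *m Z]mulmxA CZ mulmx0 subr0.
  elim: k => [|k IH]; first by rewrite !expr0.
  rewrite !exprS -!mulmxA IH; apply: AE.
  by rewrite mulmxA hY.
by exists g => // K X Kb; rewrite -fE; exact: hg.
Qed.

End compactness.

(** * Borel measurability on matrices and second moments *)

Section borel_matrices.
Variable R : realType.

Lemma measurable_continuous_mx m n (f : 'M[R]_(m, n) -> R) : continuous f ->
  measurable_fun [set: borel_mx R m n] (f : borel_mx R m n -> R).
Proof.
move=> cf; apply: (measurability _ (RGenOInfty.measurableE R)).
move=> _ [_ [x ->] <-]; rewrite setTI; apply: sub_sigma_algebra => /=.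
apply: (@open_comp _ _ f `]x, +oo[%classic); first by move=> M _; exact: cf.
exact: interval_open.
Qed.

Lemma measurable_entry m n i j :
  measurable_fun [set: borel_mx R m n] (fun M : borel_mx R m n => (M : 'M[R]_(m, n)) i j : R).
Proof. by apply: measurable_continuous_mx; exact: continuous_entry. Qed.

Lemma measurable_sum_fun d (T : measurableType d) (I : Type) (r : seq I)
    (f : I -> T -> R) :
  (forall i, measurable_fun setT (f i)) ->
  measurable_fun setT (fun t => \sum_(i <- r) f i t).
Proof.
move=> mf; elim: r => [|i r IH].
  by under eq_fun do rewrite big_nil; exact: measurable_cst.
under eq_fun do rewrite big_cons.
exact: measurable_funD.
Qed.

Lemma frobeniusE m n (M : 'M[R]_(m, n)) : frobenius M = Num.sqrt (fro2 M).
Proof. by []. Qed.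

Lemma ler_entry_frobenius m n (M : 'M[R]_(m, n)) i j : `|M i j| <= frobenius M.
Proof. by rewrite -sqrtr_sqr ler_sqrt ?fro2_ge0// ler_entry_fro2. Qed.

Lemma frobenius_le_nrm1 m n (M : 'M[R]_(m, n)) : frobenius M <= nrm1 M.
Proof.
rewrite frobeniusE -(ger0_norm (nrm1_ge0 M)) -sqrtr_sqr ler_sqrt ?sqr_ge0//.
rewrite expr2 /fro2 [X in _ <= X * _]/nrm1 mulr_suml; apply: ler_sum => i _.
rewrite mulr_suml; apply: ler_sum => j _.
have -> : M i j ^+ 2 = `|M i j| * `|M i j| by rewrite -expr2 real_normK ?num_real.
by rewrite ler_wpM2l// ler_entry_nrm1.
Qed.

Variables (n : nat) (D : probability (borel_mx R n 1) R) (Pb : R).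
Hypothesis D_bounded : {ae D, forall x, frobenius (x : 'cV[R]_n) <= Pb}.

Lemma ae_bounded_integrable d (T : measurableType d) (P : probability T R)
    (f : T -> R) (c : R) :
  measurable_fun setT f -> {ae P, forall x, `|f x| <= c} ->
  P.-integrable setT (EFin \o f).
Proof.
move=> mf fc; apply/integrableP; split; first exact/measurable_EFinP.
apply: (@le_lt_trans _ _ (\int[P]_x (`|c|%:E))%E).
  apply: ae_ge0_le_integral => //=.
  - by apply/measurable_EFinP; exact: (measurableT_comp (@normr_measurable R setT)).
  - apply: filterS fc => x fxc _.
    by rewrite lee_fin (le_trans fxc)// ler_norm.
by rewrite integral_cst//= probability_setT mule1 ltry.
Qed.

Lemma integrable_second_moment i j :
  D.-integrable setT (EFin \o (fun x : borel_mx R n 1 =>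
    (x : 'cV[R]_n) i 0 * (x : 'cV[R]_n) j 0)).
Proof.
apply: (@ae_bounded_integrable _ _ _ _ (Pb * Pb)).
  by apply: measurable_funM; exact: measurable_entry.
apply: (@filterS _ _ (ae_filter_ringOfSetsType D) _ _ _ D_bounded) => x xb.
rewrite normrM ler_pM//.
  exact: le_trans (ler_entry_frobenius _ _ _) xb.
exact: le_trans (ler_entry_frobenius _ _ _) xb.
Qed.

Lemma measurable_quad (M : 'M[R]_n) :
  measurable_fun setT (fun x : borel_mx R n 1 =>
    ((x : 'cV[R]_n)^T *m M *m (x : 'cV[R]_n)) 0 0).
Proof.
under eq_fun do rewrite bilinE.
apply: measurable_sum_fun => i; apply: measurable_sum_fun => j.
apply: measurable_funM; first exact: measurable_cst.
by apply: measurable_funM; exact: measurable_entry.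
Qed.

Lemma integral_second_moment i j :
  (\int[D]_x ((x : 'cV[R]_n) i 0 * (x : 'cV[R]_n) j 0)%:E)%E =
  (second_moment D i j)%:E.
Proof.
rewrite /second_moment mxE unlock fineK.
  by apply: eq_integral => x _; rewrite /= mxE big_ord1 mxE.
have -> : (\int[D]_x (((x : 'cV[R]_n) *m (x : 'cV[R]_n)^T) i j)%:E)%E =
  (\int[D]_x ((x : 'cV[R]_n) i 0 * (x : 'cV[R]_n) j 0)%:E)%E.
  by apply: eq_integral => x _; rewrite /= mxE big_ord1 mxE.
exact: integrable_fin_num (integrable_second_moment i j).
Qed.

(** The mean of a quadratic form in the initial state. *)
Lemma integral_quad (M : 'M[R]_n) :
  (\int[D]_x (((x : 'cV[R]_n)^T *m M *m (x : 'cV[R]_n)) 0 0)%:E)%E =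
  (frob_pair (second_moment D) M)%:E.
Proof.
have im i j : D.-integrable setT (EFin \o (fun x : borel_mx R n 1 =>
    M i j * ((x : 'cV[R]_n) i 0 * (x : 'cV[R]_n) j 0))).
  by have := integrableZl measurableT (M i j) (integrable_second_moment i j).
under eq_integral do rewrite bilinE.
rewrite (eq_integral (fun x : borel_mx R n 1 => (\sum_i (\sum_j
    (M i j * ((x : 'cV[R]_n) i 0 * (x : 'cV[R]_n) j 0))%:E))%E)); last first.
  by move=> x _; rewrite -sumEFin; apply: eq_bigr => i _; rewrite sumEFin.
rewrite integral_sum//; last first.
  by move=> i; apply: integrable_sum => // j _; exact: im.
rewrite /frob_pair -sumEFin; apply: eq_bigr => i _.
rewrite integral_sum//; last by move=> j; exact: im.
rewrite -sumEFin; apply: eq_bigr => j _.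
under eq_integral do rewrite EFinM.
rewrite integralZl//; last exact: integrable_second_moment.
by rewrite integral_second_moment EFinM.
Qed.

Lemma frob_pair_second_moment_ge0 (M : 'M[R]_n) :
  (forall x : 'cV[R]_n, 0 <= (x^T *m M *m x) 0 0) ->
  0 <= frob_pair (second_moment D) M.
Proof.
by move=> M0; rewrite -lee_fin -integral_quad; apply: integral_ge0 => x _; rewrite lee_fin.
Qed.

End borel_matrices.

Section improper_integral.
Variable R : realType.
Local Notation mu := (@lebesgue_measure R).

Lemma segment_integral_EFin (f : R -> R) a b : continuous f ->
  (\int[mu]_(t in `[a, b]) (f t)%:E)%E = (\int[mu]_(t in `[a, b]) f t)%:E.
Proof.
move=> cf; rewrite /Rintegral fineK//.
by apply: integrable_fin_num => //; exact: continuous_segment_integrable.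
Qed.

Lemma cvg_improper_integral (f : R -> R) : continuous f -> (forall t, 0 <= f t) ->
  (fun k : nat => (\int[mu]_(t in `[0%R, k%:R]) f t)%:E) @ \oo -->
    (\int[mu]_(t in `[0%R, +oo[) (f t)%:E)%E.
Proof.
move=> cf f0.
have -> : `[0%R, +oo[%classic = \bigcup_k [set` `[0%R, k%:R : R]].
  apply/seteqP; split => [t|t [k _]]; rewrite /= !in_itv/=; last by case/andP=> ->.
  rewrite andbT => t0; exists (Num.truncn t).+1 => //=.
  by rewrite in_itv/= t0 ltW//; exact: truncnS_gt.
under eq_fun do rewrite -segment_integral_EFin//.
apply: ge0_nondecreasing_set_cvg_integral.
- move=> i j ij; rewrite subsetEset => t; rewrite /= !in_itv/= => /andP[-> /=].
  by move=> /le_trans; apply; rewrite ler_nat.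
- by move=> k; exact: measurable_itv.
- move=> k; apply/measurable_EFinP; apply: measurable_funTS.
  exact: continuous_measurable_fun.
- by move=> k x _; rewrite lee_fin.
Qed.

End improper_integral.

(** * Gains of bounded cost are bounded and uniformly exponentially stabilizing *)

Section cost_bounds.
Variables (R : realType) (n m p : nat).
Variables (A : 'M[R]_n) (B : 'M[R]_(n, m)) (C : 'M[R]_(p, n)).
Variables (Q : 'M[R]_p) (W : 'M[R]_m).
Variables (D : probability (borel_mx R n 1) R) (Pb : R).
Local Notation mu := (@lebesgue_measure R).
Local Notation closed_loop := (closed_loop A B C).
Local Notation ecost := (ecost A B C Q W D).
Hypothesis Q_posdef : posdefmx Q.
Hypothesis W_posdef : posdefmx W.
Hypothesis Sigma_posdef : posdefmx (second_moment D).
Hypothesis D_bounded : {ae D, forall x, frobenius (x : 'cV[R]_n) <= Pb}.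
Hypothesis AC_observable : observable A C.

(** The matrix of the running cost as a quadratic form in the state. *)
Definition cost_weight (K : 'M[R]_(m, p)) : 'M[R]_n :=
  C^T *m (Q + K^T *m W *m K) *m C.

Lemma running_costE K x t : running_cost A B C Q W K x t =
  (x^T *m flow_form (closed_loop K) (cost_weight K) t *m x) 0 0.
Proof. by rewrite /running_cost /flow_form /cost_weight expmx_tr !mulmxA. Qed.

Lemma cost_weight_quad K (y : 'cV[R]_n) :
  (y^T *m cost_weight K *m y) 0 0 =
  ((C *m y)^T *m Q *m (C *m y)) 0 0 +
  ((K *m C *m y)^T *m W *m (K *m C *m y)) 0 0.
Proof.
have -> : y^T *m cost_weight K *m y =
    (C *m y)^T *m Q *m (C *m y) + (K *m C *m y)^T *m W *m (K *m C *m y).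
  rewrite /cost_weight mulmxDr mulmxDl mulmxDr mulmxDl !trmx_mul.
  by rewrite !mulmxA.
by rewrite mxE.
Qed.

Lemma cost_weight_lower : exists2 c, 0 < c & forall K (y : 'cV[R]_n),
  c * (fro2 (C *m y) + fro2 (K *m C *m y)) <= (y^T *m cost_weight K *m y) 0 0.
Proof.
have [q q0 hq] := posdef_lower_bound Q_posdef.
have [w w0 hw] := posdef_lower_bound W_posdef.
exists (Num.min q w); first by rewrite lt_min q0 w0.
move=> K y; rewrite cost_weight_quad mulrDr lerD//.
  by apply: le_trans (hq _); rewrite ler_wpM2r ?fro2_ge0// ge_min lexx.
by apply: le_trans (hw _); rewrite ler_wpM2r ?fro2_ge0// ge_min lexx orbT.
Qed.

Lemma flow_form_quad n' (E Z : 'M[R]_n') t (x : 'cV[R]_n') :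
  (x^T *m flow_form E Z t *m x) 0 0 =
  ((expmx (t *: E) *m x)^T *m Z *m (expmx (t *: E) *m x)) 0 0.
Proof. by rewrite /flow_form trmx_mul !mulmxA. Qed.

Lemma cost_weight_ge0 K (y : 'cV[R]_n) : 0 <= (y^T *m cost_weight K *m y) 0 0.
Proof.
have [c c0 hc] := cost_weight_lower; apply: le_trans (hc K y).
by rewrite mulr_ge0 ?addr_ge0 ?fro2_ge0// ltW.
Qed.

Lemma running_cost_ge0 K x t : 0 <= running_cost A B C Q W K x t.
Proof. by rewrite running_costE flow_form_quad cost_weight_ge0. Qed.

Lemma continuous_running_cost K x : continuous (running_cost A B C Q W K x).
Proof.
have -> : running_cost A B C Q W K x = fun t =>
    frob_pair (x *m x^T) (flow_form (closed_loop K) (cost_weight K) t).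
  by apply/funext => t; rewrite running_costE quad_frob_pair.
exact: continuous_frob_pair_flow.
Qed.

Lemma segment_integral_running_cost K x tau :
  \int[mu]_(t in `[0, tau]) running_cost A B C Q W K x t =
  (x^T *m gramian (closed_loop K) (cost_weight K) tau *m x) 0 0.
Proof.
rewrite quad_frob_pair frob_pair_gramian; apply: eq_Rintegral => t _.
by rewrite running_costE quad_frob_pair.
Qed.

Lemma ecost_lower K k :
  ((frob_pair (second_moment D)
     (gramian (closed_loop K) (cost_weight K) k%:R))%:E <= ecost K)%E.
Proof.
rewrite -(integral_quad D_bounded).
have h x := @cvg_improper_integral R _ (@continuous_running_cost K x)
  (@running_cost_ge0 K x).
have le x l : ((\int[mu]_(t in `[0, l%:R]) running_cost A B C Q W K x t)%R%:E <=
    \int[mu]_(t in `[0%R, +oo[) (running_cost A B C Q W K x t)%:E)%E.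
  rewrite -segment_integral_EFin; last exact: continuous_running_cost.
  apply: ge0_subset_integral => //=.
  - apply/measurable_EFinP; apply: measurable_funTS.
    by apply: continuous_measurable_fun; exact: continuous_running_cost.
  - by move=> t _; rewrite lee_fin running_cost_ge0.
  - by move=> t; rewrite /= !in_itv/= => /andP[->].
apply: ge0_le_integral => //=.
- by move=> x _; rewrite lee_fin -segment_integral_running_cost Rintegral_ge0// =>
    t _; exact: running_cost_ge0.
- by apply/measurable_EFinP; exact: measurable_quad.
- apply: (emeasurable_fun_cvg (fun l (x : borel_mx R n 1) =>
    (\int[mu]_(t in `[0, l%:R]) running_cost A B C Q W K x t)%:E)).
    move=> l; under eq_fun do rewrite segment_integral_running_cost.
    by apply/measurable_EFinP; exact: measurable_quad.
  by move=> x _; exact: h.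
- by move=> x _; rewrite -segment_integral_running_cost.
Qed.

Lemma frob_pair_gram_lower s :
  (forall x : 'cV[R]_n, s * fro2 x <= (x^T *m second_moment D *m x) 0 0) ->
  forall q (G : 'M[R]_(q, n)),
    s * fro2 G <= frob_pair (second_moment D) (G^T *m G).
Proof.
move=> hs q G.
have -> : frob_pair (second_moment D) (G^T *m G) =
    \sum_k (((row k G)^T)^T *m second_moment D *m (row k G)^T) 0 0.
  rewrite /frob_pair; under [RHS]eq_bigr do rewrite bilinE.
  rewrite [RHS]exchange_big; apply: eq_bigr => i _ /=.
  rewrite [RHS]exchange_big; apply: eq_bigr => j _ /=.
  rewrite mxE mulr_suml; apply: eq_bigr => k _.
  by rewrite !mxE; ring.
have -> : fro2 G = \sum_k fro2 (row k G)^T.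
  apply: eq_bigr => k _; apply: eq_bigr => j _.
  by rewrite big_ord1 !mxE.
by rewrite mulr_sumr; apply: ler_sum => k _; exact: hs.
Qed.

Lemma fro2_flow q (F : 'M[R]_n) (Y : 'M[R]_(q, n)) t :
  fro2 (Y *m expmx (t *: F)) = frob_pair 1%:M (flow_form F (Y^T *m Y) t).
Proof.
rewrite -{1}[expmx _]mulmx1 mulmxA fro2_mulE trmx1 mul1mx.
by rewrite trmx_mul /flow_form !mulmxA.
Qed.

Lemma continuous_fro2_flow q (F : 'M[R]_n) (Y : 'M[R]_(q, n)) :
  continuous (fun t : R => fro2 (Y *m expmx (t *: F))).
Proof.
under eq_fun do rewrite fro2_flow.
exact: continuous_frob_pair_flow.
Qed.

(** The mean of the cost over the initial states controls the energy of the
    output and of the input along every solution, because Sigma is definite. *)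
Lemma output_energy_bound : exists2 c, 0 < c & forall K a, (ecost K <= a%:E)%E ->
  forall k : nat, c * \int[mu]_(t in `[0, k%:R])
    (fro2 (C *m expmx (t *: closed_loop K)) +
     fro2 (K *m C *m expmx (t *: closed_loop K))) <= a.
Proof.
have [c c0 hc] := cost_weight_lower.
have [s s0 hs] := posdef_lower_bound Sigma_posdef.
exists (c * s); first exact: mulr_gt0.
move=> K a Ka k.
have := le_trans (ecost_lower K k) Ka; rewrite lee_fin frob_pair_gramian.
apply: le_trans.
have cU : continuous (fun t : R => fro2 (C *m expmx (t *: closed_loop K)) +
     fro2 (K *m C *m expmx (t *: closed_loop K))).
  by move=> t; apply: cvgD; exact: continuous_fro2_flow.
rewrite -RintegralZl//; last exact: continuous_segment_integrable.
apply: ler_segment_integral.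
- by apply: continuous_mul_fun => //; exact: cst_continuous.
- exact: continuous_frob_pair_flow.
move=> t _; set E := expmx (t *: closed_loop K).
pose Z0 := (C *m E)^T *m (C *m E) + (K *m C *m E)^T *m (K *m C *m E).
apply: (@le_trans _ _ (c * frob_pair (second_moment D) Z0)).
  rewrite -mulrA ler_pM2l// /Z0 frob_pairDr mulrDr.
  by apply: lerD; exact: frob_pair_gram_lower.
rewrite -subr_ge0 -frob_pairZr -frob_pairBr.
apply: (frob_pair_second_moment_ge0 D_bounded) => x.
have BE (M N : 'M[R]_1) : (M - N) 0 0 = M 0 0 - N 0 0 by rewrite !mxE.
rewrite mulmxBr mulmxBl BE subr_ge0.
rewrite flow_form_quad; apply: le_trans (hc K _).
rewrite -scalemxAr -scalemxAl mxE ler_pM2l//.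
have qE q (F : 'M[R]_(q, n)) : fro2 (F *m (E *m x)) =
    (x^T *m ((F *m E)^T *m (F *m E)) *m x) 0 0.
  by rewrite mulmxA fro2_mulE quad_frob_pair.
by rewrite /Z0 mulmxDr mulmxDl mxE !qE.
Qed.

Lemma ler_gram_entry q r (G : 'M[R]_(q, r)) i j : `|(G^T *m G) i j| <= fro2 G.
Proof.
have le k : \sum_l G l k ^+ 2 <= fro2 G.
  rewrite /fro2 exchange_big /= [leRHS](bigD1 k)//= lerDl.
  by apply: sumr_ge0 => l _; apply: sumr_ge0 => e _; exact: sqr_ge0.
rewrite mxE (le_trans (ler_norm_sum _ _ _))//.
apply: (@le_trans _ _ (\sum_l (G l i ^+ 2 + G l j ^+ 2) / 2)).
  apply: ler_sum => l _; rewrite mxE normrM -[G l i ^+ 2]real_normK ?num_real//.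
  rewrite -[G l j ^+ 2]real_normK ?num_real//.
  have := sqr_ge0 (`|G l i| - `|G l j|); set a := `|G l i|; set b := `|G l j|.
  by move=> h; nra.
rewrite -mulr_suml big_split /= ler_pdivrMr// mulrDr mulr1.
by apply: lerD; exact: le.
Qed.

(** The energy at time 0 is controlled by the energy over [0, 1], since the
    logarithmic derivative of the energy is bounded in terms of F. *)
Lemma initial_energy_bound (F : 'M[R]_n) q (Y : 'M[R]_(q, n)) :
  fro2 Y <= (2 * (n * n)%:R ^+ 2 * nrm1 F + 1) *
    \int[mu]_(t in `[0, 1]) fro2 (Y *m expmx (t *: F)).
Proof.
set H := flow_form F (Y^T *m Y).
have uE t : fro2 (Y *m expmx (t *: F)) = frob_pair 1%:M (H t).
  exact: fro2_flow.
have cp (Z : 'M[R]_n) := @continuous_frob_pair_flow R n 1%:M F Z.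
pose du t := frob_pair 1%:M (flow_form F (lyap_op F (Y^T *m Y)) t).
have dH t : is_derive t (1 : R) (fun t => frob_pair 1%:M (H t)) (du t).
  exact: is_derive_frob_pair (is_mderive_flow_form F (Y^T *m Y) t).
pose phi t := frob_pair 1%:M (H t) * (1 - t).
pose dphi t := du t * (1 - t) - frob_pair 1%:M (H t).
have dphiE t : is_derive t (1 : R) phi (dphi t).
  have h1 : is_derive t (1 : R) (cst (1 : R) - id : R -> R) (- 1).
    by apply: is_derive_eq; rewrite sub0r.
  have h := is_deriveM (dH t) h1.
  suff -> : dphi t = frob_pair 1%:M (H t) *: -1 + (cst (1 : R) - id : R -> R) t *: du t.
    exact: h.
  by rewrite /dphi /GRing.scale/= mulrN1 addrC mulrC.
have c1t : continuous (fun t : R => 1 - t).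
  by move=> t; apply: cvgB; [exact: cvg_cst|exact: cvg_id].
have cdphi : continuous dphi.
  move=> t; apply: cvgB; last exact: cp.
  by apply: (@continuous_mul_fun _ _ du) => //; exact: cp.
have Ephi := segment_integral_derive ler01 cdphi (fun t _ => dphiE t).
have {}Ephi : \int[mu]_(t in `[0, 1]) dphi t = - fro2 Y.
  rewrite Ephi /phi subrr mulr0 subr0 mulr1 sub0r -uE.
  by rewrite expmx0 mulmx1.
set N : R := (n * n)%:R.
have N1 : nrm1 (1%:M : 'M[R]_n) <= N.
  rewrite -[N]mulr1; apply: nrm1_le_const => i j; rewrite mxE.
  by case: (i == j); rewrite ?normr1 ?normr0.
have u0 t : 0 <= frob_pair 1%:M (H t) by rewrite -uE fro2_ge0.
have HE t : H t = (Y *m expmx (t *: F))^T *m (Y *m expmx (t *: F)).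
  by rewrite trmx_mul /H /flow_form !mulmxA.
have dub t : `|du t| <= 2 * N ^+ 2 * nrm1 F * frob_pair 1%:M (H t).
  rewrite /du (le_trans (ler_frob_pair _ _))// lyap_op_flow_form -/H.
  have h1 : nrm1 (H t) <= N * frob_pair 1%:M (H t).
    by apply: nrm1_le_const => i j; rewrite -uE HE ler_gram_entry.
  have h2 := nrm1_lyap_op F (H t).
  have -> : 2 * N ^+ 2 * nrm1 F * frob_pair 1%:M (H t) =
      N * (2 * nrm1 F * (N * frob_pair 1%:M (H t))) by ring.
  apply: ler_pM => //; [exact: nrm1_ge0|exact: nrm1_ge0|].
  apply: (le_trans h2); rewrite ler_wpM2l// mulr_ge0//; exact: nrm1_ge0.
set al := 2 * N ^+ 2 * nrm1 F in dub *.
have <- : \int[mu]_(t in `[0, 1]) ((al + 1) * frob_pair 1%:M (H t)) =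
    (al + 1) * \int[mu]_(t in `[0, 1]) fro2 (Y *m expmx (t *: F)).
  rewrite RintegralZl//; last exact: continuous_segment_integrable (cp _).
  by congr (_ * _); apply: eq_Rintegral => t _; rewrite uE.
have -> : fro2 Y = \int[mu]_(t in `[0, 1]) (- 1 * dphi t).
  rewrite RintegralZl//; last exact: continuous_segment_integrable.
  by rewrite Ephi mulN1r opprK.
apply: ler_segment_integral.
- by apply: continuous_mul_fun => //; exact: cst_continuous.
- by apply: continuous_mul_fun; [exact: cst_continuous|exact: cp].
move=> t /andP[t0 t1]; rewrite /dphi mulN1r opprB mulrDl mul1r addrC lerD2r.
rewrite -mulrN; apply: le_trans (ler_norm _) _; rewrite normrM normrN.
apply: le_trans (dub t); rewrite -[leRHS]mulr1 ler_wpM2l//.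
by rewrite ger0_norm ?subr_ge0// lerBlDr lerDl.
Qed.

Lemma output_energies : exists2 c, 0 < c & forall K a, (ecost K <= a%:E)%E ->
  forall k : nat,
    c * \int[mu]_(t in `[0, k%:R]) fro2 (C *m expmx (t *: closed_loop K)) <= a /\
    c * \int[mu]_(t in `[0, k%:R]) fro2 (K *m C *m expmx (t *: closed_loop K)) <= a.
Proof.
have [c c0 hc] := output_energy_bound; exists c => // K a Ka k.
have h := hc K a Ka k.
have cD : continuous (fun t : R => fro2 (C *m expmx (t *: closed_loop K)) +
     fro2 (K *m C *m expmx (t *: closed_loop K))).
  by move=> t; apply: cvgD; exact: continuous_fro2_flow.
by split; apply: le_trans h; rewrite ler_pM2l//; apply: ler_segment_integral => //;
  rewrite ?lerDl ?lerDr ?fro2_ge0//; try exact: continuous_fro2_flow;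
  move=> t _; rewrite ?lerDl ?lerDr fro2_ge0.
Qed.

(** The energy of K C at time 0 is quadratic in K C, but at most linear in it,
    since the constant of initial_energy_bound is linear in the closed loop. *)
Lemma gain_bound a : exists2 b, 0 <= b & forall K, (ecost K <= a%:E)%E ->
  nrm1 (K *m C) <= b.
Proof.
have [c c0 hc] := output_energies.
pose N : R := (n * n)%:R; pose s := (m * n)%:R ^+ 2 * (`|a| / c).
have s0 : 0 <= s by rewrite mulr_ge0 ?exprn_ge0// divr_ge0// ltW.
pose c1 := s * (2 * N ^+ 2 * nrm1 A + 1); pose c2 := s * (2 * N ^+ 2 * nrm1 B).
have N0 : 0 <= 2 * N ^+ 2 by rewrite mulr_ge0// exprn_ge0.
have c10 : 0 <= c1 by rewrite mulr_ge0// addr_ge0// mulr_ge0// nrm1_ge0.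
have c20 : 0 <= c2 by rewrite mulr_ge0// mulr_ge0// nrm1_ge0.
exists (c1 + c2 + 1); first by rewrite !addr_ge0.
move=> K Ka; set x := nrm1 _.
have x0 : 0 <= x by exact: nrm1_ge0.
have hF : nrm1 (closed_loop K) <= nrm1 A + nrm1 B * x.
  rewrite /closed_loop (le_trans (nrm1B _ _))// lerD2l -mulmxA; exact: nrm1M.
have hx : x ^+ 2 <= c1 + c2 * x.
  apply: le_trans (nrm1_sqr_le _) _.
  have -> : c1 + c2 * x = (m * n)%:R ^+ 2 *
      ((2 * N ^+ 2 * (nrm1 A + nrm1 B * x) + 1) * (`|a| / c)).
    by rewrite /c1 /c2 /s; ring.
  rewrite ler_wpM2l ?exprn_ge0//.
  apply: le_trans (initial_energy_bound (closed_loop K) (K *m C)) _.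
  apply: ler_pM.
  - by rewrite addr_ge0// mulr_ge0// nrm1_ge0.
  - by apply: Rintegral_ge0 => t _; exact: fro2_ge0.
  - by rewrite lerD2r ler_wpM2l.
  - rewrite ler_pdivlMr// mulrC (le_trans (hc K a Ka 1%N).2)//.
    exact: ler_norm.
have [x1|/ltW x1] := leP x 1; first by rewrite (le_trans x1)// lerDr addr_ge0.
have {}hx : x * x <= (c1 + c2) * x.
  rewrite -expr2 (le_trans hx)// mulrDl lerD2r.
  by rewrite -[leLHS]mulr1 ler_wpM2l.
have xp : 0 < x by rewrite (lt_le_trans _ x1).
by move: hx; rewrite ler_pM2r// => /le_trans; apply; rewrite lerDl.
Qed.

Lemma sum_energy_bound (K : 'M[R]_(m, p)) g k :
  (forall X : 'M[R]_n, g * fro2 X <=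
    \int[mu]_(t in `[0, 1]) fro2 (C *m expmx (t *: closed_loop K) *m X)) ->
  g * (\sum_(l < k) fro2 (expmx (l%:R *: closed_loop K))) <=
    \int[mu]_(t in `[0, k%:R]) fro2 (C *m expmx (t *: closed_loop K)).
Proof.
move=> hg; elim: k => [|k IH].
  by rewrite big_ord0 mulr0; apply: Rintegral_ge0 => t _; exact: fro2_ge0.
rewrite big_ord_recr/= mulrDr (@segment_integral_split R _ _ k%:R k.+1%:R).
- apply: lerD IH _; apply: le_trans (hg _) _.
  have -> : k.+1%:R = 1 + k%:R :> R by rewrite -natr1 addrC.
  rewrite -[X in `[X, _]]add0r -(segment_integral_shift _ ler01); last first.
    exact: continuous_fro2_flow.
  rewrite le_eqVlt; apply/orP; left; apply/eqP; apply: eq_Rintegral => t _.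
  by rewrite expmxD mulmxA.
- by rewrite ler0n ler_nat /=.
- exact: continuous_fro2_flow.
Qed.

(** Gains of bounded cost give closed loops that contract uniformly. If the
    states visited at integer times are square summable with a uniform bound,
    then they decrease, because each of them bounds all the later ones. *)
Theorem uniform_decay a : exists2 b, 0 <= b & exists2 N, (0 < N)%N &
  forall K, (ecost K <= a%:E)%E ->
    nrm1 (K *m C) <= b /\ nrm1 (expmx (N%:R *: closed_loop K)) <= 4^-1.
Proof.
have [b b0 hb] := gain_bound a.
have [c c0 hc] := output_energies.
have [g g0 hg] := @uniform_observability R n m p A B C (b * nrm1 (pinvmx C)) AC_observable.
pose s := (n * n)%:R ^+ 2 * (`|a| / c / g).
have s0 : 0 <= s by rewrite mulr_ge0 ?exprn_ge0// !divr_ge0// ltW.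
pose N := (Num.truncn (16 * s ^+ 2)).+1.
exists b => //; exists N => // K Ka; split; first exact: hb.
have hsum k : g * (\sum_(l < k) fro2 (expmx (l%:R *: closed_loop K))) <= `|a| / c.
  (* the closed loop only depends on K C, so K may be replaced by a gain that
     vanishes outside the range of C *)
  pose K' := K *m C *m pinvmx C.
  have KC : K' *m C = K *m C by rewrite mulmxKpV// submxMl.
  have FE : closed_loop K' = closed_loop K.
    by rewrite /Defs.closed_loop -(mulmxA B K' C) KC mulmxA.
  have K'b i j : `|K' i j| <= b * nrm1 (pinvmx C).
    rewrite (le_trans (ler_entry_nrm1 _ _ _))// (le_trans (nrm1M _ _))//.
    by rewrite ler_wpM2r ?nrm1_ge0// hb.
  apply: le_trans (sum_energy_bound k _) _.
    by move=> X; rewrite -FE; exact: hg.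
  by rewrite ler_pdivlMr// mulrC (le_trans (hc K a Ka k).1)// ler_norm.
set E := fun k : nat => nrm1 (expmx (k%:R *: closed_loop K)).
have E0 k : 0 <= E k by exact: nrm1_ge0.
have hE k : \sum_(l < k) E l ^+ 2 <= s.
  apply: (@le_trans _ _ (\sum_(l < k) (n * n)%:R ^+ 2 *
      fro2 (expmx (l%:R *: closed_loop K)))).
    by apply: ler_sum => l _; exact: nrm1_sqr_le.
  by rewrite -mulr_sumr ler_wpM2l ?exprn_ge0// ler_pdivlMr// mulrC.
have hEk k : E k ^+ 2 <= s.
  apply: le_trans (hE k.+1); rewrite big_ord_recr/= lerDr.
  by apply: sumr_ge0 => l _; exact: sqr_ge0.
have hN : N%:R * E N ^+ 2 <= s * s.
  have -> : N%:R * E N ^+ 2 = \sum_(l < N) E N ^+ 2.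
    by rewrite sumr_const card_ord mulr_natl.
  apply: (@le_trans _ _ (\sum_(l < N) s * E l ^+ 2)).
    apply: ler_sum => l _; apply: (@le_trans _ _ ((E (N - l)%N * E l) ^+ 2)).
      rewrite lerXn2r ?nnegrE ?mulr_ge0 ?E0//.
      rewrite /E -{1}(subnK (ltnW (ltn_ord l))) natrD expmxD; exact: nrm1M.
    by rewrite exprMn ler_wpM2r ?sqr_ge0.
  by rewrite -mulr_sumr ler_wpM2l.
have N1 : 16 * s ^+ 2 <= N%:R by rewrite ltW//; exact: truncnS_gt.
have Np : 0 < N%:R :> R by rewrite ltr0n.
have : E N ^+ 2 <= 16^-1.
  have : N%:R * E N ^+ 2 <= N%:R * 16^-1.
    by apply: le_trans hN _; rewrite ler_pdivlMr// mulrC -expr2.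
  by rewrite ler_pM2l.
have -> : 16^-1 = 4^-1 ^+ 2 :> R by rewrite exprVn -natrX.
by rewrite ler_pXn2r// ?nnegrE.
Qed.

End cost_bounds.

(** * The Lyapunov equation of a contracting flow *)

Section lyapunov.
Variables (R : realType) (n : nat).
Implicit Types (F X Y : 'M[R]_n).

Lemma lyap_opDl F G X : lyap_op (F + G) X = lyap_op F X + lyap_op G X.
Proof. by rewrite /lyap_op linearD/= mulmxDl mulmxDr addrACA. Qed.

Lemma lyap_opZl a F X : lyap_op (a *: F) X = a *: lyap_op F X.
Proof. by rewrite /lyap_op linearZ/= -scalemxAl -scalemxAr scalerDr. Qed.

Lemma lyap_opBr F X Y : lyap_op F (X - Y) = lyap_op F X - lyap_op F Y.
Proof. by rewrite /lyap_op mulmxBr mulmxBl addrACA opprD. Qed.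

(** The matrix of X |-> lyap_op F X acting on row encodings. *)
Definition lyap_mx F : 'M[R]_(n * n) := lin_mx (mulmx F^T) + lin_mx (mulmxr F).

Lemma mxvec_lyap_op F X : mxvec X *m lyap_mx F = mxvec (lyap_op F X).
Proof. by rewrite /lyap_mx mulmxDr !mul_vec_lin/= /lyap_op linearD. Qed.

(** The solution X of F^T X + X F = - Y, when it exists and is unique. *)
Definition lyap F Y : 'M[R]_n := vec_mx (mxvec (- Y) *m invmx (lyap_mx F)).

Lemma lyapD F X Y : lyap F (X + Y) = lyap F X + lyap F Y.
Proof. by rewrite /lyap opprD linearD/= mulmxDl linearD. Qed.

Lemma lyapZ F a Y : lyap F (a *: Y) = a *: lyap F Y.
Proof. by rewrite /lyap -scalerN linearZ/= -scalemxAl linearZ. Qed.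

Lemma lyapB F X Y : lyap F (X - Y) = lyap F X - lyap F Y.
Proof. by rewrite lyapD -scaleN1r lyapZ scaleN1r. Qed.

Variables (T0 al : R).
Hypothesis T0_gt0 : 0 < T0.

(** The flow of F contracts over the time T0. *)
Definition contracting F := nrm1 F <= al /\ nrm1 (expmx (T0 *: F)) <= 2^-1.

(** A bound of the flow over [0, T0]. *)
Definition flow_bound : R := (n * n)%:R * expR (T0 * al).

Lemma flow_bound_ge0 : 0 <= flow_bound.
Proof. by rewrite mulr_ge0// expR_ge0. Qed.

Lemma nrm1_flow_bound F t : contracting F -> 0 <= t <= T0 ->
  nrm1 (expmx (t *: F)) <= flow_bound.
Proof.
move=> [Fa _] /andP[t0 tT]; apply: nrm1_expmx.
by rewrite ger0_norm// ler_pM// nrm1_ge0.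
Qed.

(** The constant of the a priori estimate for the Lyapunov equation. *)
Definition lyap_bound : R := 2 * ((n * n)%:R * (flow_bound ^+ 2 * T0)).

Lemma lyap_bound_ge0 : 0 <= lyap_bound.
Proof.
by rewrite !mulr_ge0// ?exprn_ge0// ?flow_bound_ge0// ltW.
Qed.

Lemma lyap_estimate F X : contracting F -> nrm1 X <= lyap_bound * nrm1 (lyap_op F X).
Proof.
move=> cF; have [Fa Fh] := cF.
have h1 : nrm1 (flow_form F X T0) <= 4^-1 * nrm1 X.
  rewrite (le_trans (nrm1_conj Fh Fh (lexx _)))// mulrAC.
  by have -> : 2^-1 * 2^-1 = 4^-1 :> R by rewrite -invfM -natrM.
have h2 : nrm1 (flow_form F X T0 - flow_form F X 0) <=
    (n * n)%:R * (flow_bound ^+ 2 * nrm1 (lyap_op F X) * (T0 - 0)).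
  apply: matrix_mean_value_le; first exact: ltW.
    by move=> t _; exact: is_mderive_flow_form.
  move=> t t0T; have ht := nrm1_flow_bound cF t0T.
  by rewrite (le_trans (nrm1_conj ht ht (lexx _)))// expr2 mulrAC.
have h3 : nrm1 X <= nrm1 (flow_form F X T0) + nrm1 (flow_form F X T0 - flow_form F X 0).
  rewrite -{1}(flow_form0 F X) -{1}[flow_form F X 0](subKr (flow_form F X T0)).
  exact: nrm1B.
have := nrm1_ge0 X; rewrite /lyap_bound; rewrite subr0 in h2.
have -> : 2 * ((n * n)%:R * (flow_bound ^+ 2 * T0)) * nrm1 (lyap_op F X) =
  2 * ((n * n)%:R * (flow_bound ^+ 2 * nrm1 (lyap_op F X) * T0)) by ring.
by move=> *; lra.
Qed.

Lemma lyap_op_inj F X : contracting F -> lyap_op F X = 0 -> X = 0.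
Proof.
move=> cF X0; apply: nrm1_eq0; have := lyap_estimate X cF.
by rewrite X0 nrm1_0 mulr0.
Qed.

Lemma lyapP F Y : contracting F -> lyap_op F (lyap F Y) = - Y.
Proof.
move=> cF; apply: (can_inj mxvecK); rewrite -mxvec_lyap_op /lyap vec_mxK.
rewrite mulmxKV// -row_free_unit; apply/inj_row_free => v v0.
apply: (can_inj (@vec_mxK R n n)); rewrite linear0.
apply: (lyap_op_inj cF); apply: (can_inj (@mxvecK R n n)).
by rewrite -mxvec_lyap_op vec_mxK v0 linear0.
Qed.

Lemma lyap_uniq F X Y : contracting F -> lyap_op F X = - Y -> X = lyap F Y.
Proof.
move=> cF XY; apply/eqP; rewrite -subr_eq0; apply/eqP/(lyap_op_inj cF).
by rewrite lyap_opBr XY lyapP// opprK addNr.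
Qed.

Lemma nrm1_lyap F Y : contracting F -> nrm1 (lyap F Y) <= lyap_bound * nrm1 Y.
Proof.
by move=> cF; have := lyap_estimate (lyap F Y) cF; rewrite lyapP// nrm1N.
Qed.

Lemma gramian_lyap F Y tau : contracting F -> 0 <= tau ->
  gramian F Y tau = lyap F Y - flow_form F (lyap F Y) tau.
Proof.
move=> cF tau0; apply/matrixP => i j; rewrite [LHS]mxE.
pose G t := - flow_form F (lyap F Y) t i j.
have dG t : 0 <= t <= tau -> is_derive t (1 : R) G (flow_form F Y t i j).
  move=> _; have h := is_mderive_flow_form F (lyap F Y) t i j.
  have -> : flow_form F Y t i j = - flow_form F (lyap_op F (lyap F Y)) t i j.
    by rewrite lyapP// /flow_form mulmxN mulNmx [in RHS]mxE opprK.
  exact: (is_deriveN h).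
rewrite (segment_integral_derive tau0 _ dG); last exact: continuous_flow_form.
by rewrite /G flow_form0 opprK addrC !mxE.
Qed.

(** Second-order remainder for the solution X' of a perturbed Lyapunov equation:
    G is the perturbation of F, and Z1 + Z2 that of the right-hand side. *)
Lemma lyap_remainder F G X X' (Z1 Z2 : 'M[R]_n) h g v z1 z2 :
  contracting F -> 0 <= h <= 1 -> 0 <= z2 ->
  nrm1 G <= g * h -> nrm1 Z1 <= z1 * h -> nrm1 Z2 <= z2 * h ^+ 2 -> nrm1 X' <= v ->
  X' - X = lyap F (Z1 + Z2 + lyap_op G X') ->
  nrm1 (X' - X - lyap F (Z1 + lyap_op G X)) <=
    lyap_bound * (z2 + 2 * g * (lyap_bound * (z1 + z2 + 2 * g * v))) * h ^+ 2.
Proof.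
move=> cF /andP[h0 h1] z20 Gg hZ1 hZ2 X'v dX.
have l0 := lyap_bound_ge0.
have hG (Y : 'M[R]_n) y : nrm1 Y <= y -> nrm1 (lyap_op G Y) <= 2 * (g * h) * y.
  move=> Yy; apply: le_trans (nrm1_lyap_op _ _) _.
  apply: ler_pM => //; first by rewrite mulr_ge0// nrm1_ge0.
    exact: nrm1_ge0.
  by rewrite ler_wpM2l.
have hh : z2 * h ^+ 2 <= z2 * h.
  by rewrite ler_wpM2l// expr2 -[leRHS]mulr1 ler_wpM2l.
have hdX : nrm1 (X' - X) <= lyap_bound * (z1 + z2 + 2 * g * v) * h.
  rewrite dX; apply: le_trans (nrm1_lyap _ cF) _; rewrite -mulrA ler_wpM2l//.
  apply: le_trans (nrm1D _ _) _; rewrite !mulrDl; apply: lerD.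
    by apply: le_trans (nrm1D _ _) _; apply: lerD => //; exact: le_trans hh.
  by apply: le_trans (hG _ _ X'v) _; rewrite le_eqVlt; apply/orP; left; apply/eqP; ring.
have -> : X' - X - lyap F (Z1 + lyap_op G X) = lyap F (Z2 + lyap_op G (X' - X)).
  rewrite {1}dX -lyapB lyap_opBr; congr (lyap _ _).
  by rewrite opprD addrACA [Z1 + Z2]addrC addrK.
apply: le_trans (nrm1_lyap _ cF) _; rewrite -[leRHS]mulrA ler_wpM2l//.
apply: le_trans (nrm1D _ _) _; rewrite mulrDl; apply: lerD => //.
by apply: le_trans (hG _ _ hdX) _; rewrite le_eqVlt; apply/orP; left; apply/eqP; ring.
Qed.

(** The rate of exponential decay of a contracting flow. *)
Definition decay_rate : R := ln 2 / T0.

Lemma decay_rate_gt0 : 0 < decay_rate.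
Proof. by rewrite divr_gt0// ln_gt0// ltr1n. Qed.

Lemma exponential_decay F t : contracting F -> 0 <= t ->
  nrm1 (expmx (t *: F)) <= 2 * flow_bound * expR (- (decay_rate * t)).
Proof.
move=> cF t0; have [Fa Fh] := cF.
pose k := Num.truncn (t / T0); pose s := t - k%:R * T0.
have tT : 0 <= t / T0 by rewrite divr_ge0// ltW.
have kt : k%:R * T0 <= t by rewrite -ler_pdivlMr//; rewrite truncn_le.
have tk : t <= k.+1%:R * T0 by rewrite -ler_pdivrMr// ltW//; exact: truncnS_gt.
have s0 : 0 <= s <= T0.
  rewrite subr_ge0 kt/= lerBlDr; apply: le_trans tk _.
  by rewrite -natr1 mulrDl mul1r addrC.
have -> : t = k%:R * T0 + s by rewrite addrC subrK.
rewrite expmxD expmx_mulrn.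
have hk l (M : 'M[R]_n) : nrm1 (expmx (T0 *: F) ^+ l *m M) <= 2^-1 ^+ l * nrm1 M.
  elim: l => [|l IH]; first by rewrite !expr0 mul1r mul1mx.
  rewrite !exprS -!mulmxA -!mulrA (le_trans (nrm1M _ _))//.
  by rewrite ler_pM// nrm1_ge0.
have h1 := nrm1_flow_bound cF s0.
have h2 : 2^-1 ^+ k <= 2 * expR (- (decay_rate * t)).
  have -> : 2^-1 ^+ k = 2 * expR (- (k.+1%:R * ln 2)) :> R.
    by rewrite expRN expRM_natl lnK ?posrE// exprS invfM mulVKf// exprVn.
  rewrite ler_pM2l// ler_expR lerN2 /decay_rate mulrAC ler_pdivrMr// mulrC.
  by rewrite mulrAC ler_wpM2r// ln_ge0// ler1n.
apply: le_trans (hk _ _) _; rewrite addrC subrK mulrAC.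
by apply: ler_pM => //; exact: nrm1_ge0.
Qed.

End lyapunov.

(** * The cost near a stabilizing gain *)

Section cost_expansion.
Variables (R : realType) (n m p : nat).
Variables (A : 'M[R]_n) (B : 'M[R]_(n, m)) (C : 'M[R]_(p, n)).
Variables (Q : 'M[R]_p) (W : 'M[R]_m).
Variables (D : probability (borel_mx R n 1) R) (Pb : R).
Local Notation mu := (@lebesgue_measure R).
Local Notation closed_loop := (closed_loop A B C).
Local Notation weight := (cost_weight C Q W).
Local Notation ecost := (ecost A B C Q W D).
Local Notation cost := (cost A B C Q W D).
Hypothesis Q_posdef : posdefmx Q.
Hypothesis W_posdef : posdefmx W.
Hypothesis D_bounded : {ae D, forall x, frobenius (x : 'cV[R]_n) <= Pb}.
Variables (T0 b : R).
Hypothesis T0_gt0 : 0 < T0.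
Hypothesis b_ge0 : 0 <= b.

Definition loop_bound : R := nrm1 A + nrm1 B * b.
Definition weight_bound : R := nrm1 C * nrm1 Q * nrm1 C + b * nrm1 W * b.

(** The gains over which all the estimates are uniform. *)
Definition admissible (K : 'M[R]_(m, p)) :=
  nrm1 (K *m C) <= b /\ nrm1 (expmx (T0 *: closed_loop K)) <= 2^-1.

Local Notation fb := (flow_bound n T0 loop_bound).
Local Notation lb := (lyap_bound n T0 loop_bound).

Lemma admissible_contracting K : admissible K ->
  contracting T0 loop_bound (closed_loop K).
Proof.
move=> [Kb Kh]; split => //.
rewrite /Defs.closed_loop (le_trans (nrm1B _ _))// lerD2l -mulmxA.
by rewrite (le_trans (nrm1M _ _))// ler_wpM2l// nrm1_ge0.
Qed.

Lemma cost_weightE K :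
  weight K = C^T *m Q *m C + (K *m C)^T *m W *m (K *m C).
Proof. by rewrite /cost_weight mulmxDr mulmxDl trmx_mul !mulmxA. Qed.

Lemma nrm1_cost_weight K : nrm1 (K *m C) <= b -> nrm1 (weight K) <= weight_bound.
Proof.
move=> Kb; rewrite cost_weightE (le_trans (nrm1D _ _))// lerD//.
  exact: (nrm1_conj (lexx _) (lexx _) (lexx _)).
exact: (nrm1_conj Kb Kb (lexx _)).
Qed.

Lemma weight_bound_ge0 : 0 <= weight_bound.
Proof. by rewrite addr_ge0// !mulr_ge0// nrm1_ge0. Qed.

(** The matrix of the cost-to-go. *)
Definition value (K : 'M[R]_(m, p)) : 'M[R]_n := lyap (closed_loop K) (weight K).

Definition value_bound : R := lb * weight_bound.

Lemma value_bound_ge0 : 0 <= value_bound.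
Proof. by rewrite mulr_ge0 ?weight_bound_ge0// lyap_bound_ge0. Qed.

Lemma nrm1_value K : admissible K -> nrm1 (value K) <= value_bound.
Proof.
move=> aK; have cK := admissible_contracting aK.
rewrite (le_trans (nrm1_lyap T0_gt0 _ cK))// ler_wpM2l ?lyap_bound_ge0//.
by apply: nrm1_cost_weight; case: aK.
Qed.

Lemma nrm1_flow_value K t : admissible K -> 0 <= t ->
  nrm1 (flow_form (closed_loop K) (value K) t) <=
  (2 * fb) ^+ 2 * value_bound * expR (- (decay_rate T0 * t)) ^+ 2.
Proof.
move=> aK t0; have cK := admissible_contracting aK.
have h := exponential_decay T0_gt0 cK t0.
rewrite (le_trans (nrm1_conj h h (nrm1_value aK)))//.
by rewrite le_eqVlt; apply/orP; left; apply/eqP; ring.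
Qed.

Lemma truncated_costE tau K x : truncated_cost A B C Q W tau K x =
  (x^T *m gramian (closed_loop K) (weight K) tau *m x) 0 0.
Proof.
rewrite -segment_integral_running_cost; apply: eq_Rintegral => t _.
rewrite running_costE flow_form_quad cost_weight_quad.
rewrite /input /output /state; congr (_ + _).
have -> (v : 'cV[R]_m) : (- v)^T *m W *m (- v) = v^T *m W *m v.
  by rewrite mulmxN -[(- v)^T]/((- v)^T) raddfN !mulNmx opprK.
by rewrite !mulmxA.
Qed.

Lemma truncated_cost_value tau K x : admissible K -> 0 <= tau ->
  truncated_cost A B C Q W tau K x =
  (x^T *m (value K - flow_form (closed_loop K) (value K) tau) *m x) 0 0.
Proof.
move=> aK tau0; rewrite truncated_costE.
by rewrite (gramian_lyap T0_gt0 _ (admissible_contracting aK) tau0).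
Qed.

(** A bound of the truncated costs per unit of squared initial state. *)
Definition truncated_bound : R := value_bound + (2 * fb) ^+ 2 * value_bound.

Lemma truncated_bound_ge0 : 0 <= truncated_bound.
Proof.
by rewrite addr_ge0 ?value_bound_ge0// mulr_ge0 ?value_bound_ge0// sqr_ge0.
Qed.

Lemma ler_truncated_cost tau K x : admissible K -> 0 <= tau ->
  `|truncated_cost A B C Q W tau K x| <= truncated_bound * nrm1 x ^+ 2.
Proof.
move=> aK tau0; rewrite truncated_cost_value// (le_trans (ler_bilin _ _ _))//.
rewrite mulrAC -expr2 mulrC ler_wpM2r ?exprn_ge0 ?nrm1_ge0//.
rewrite (le_trans (nrm1B _ _))// lerD ?nrm1_value//.
rewrite (le_trans (nrm1_flow_value aK tau0))//.
rewrite -[leRHS]mulr1 ler_wpM2l//.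
  by rewrite mulr_ge0 ?value_bound_ge0// sqr_ge0.
rewrite exprn_ile1 ?expR_ge0// -expR0 ler_expR oppr_le0 mulr_ge0//.
by rewrite ltW// decay_rate_gt0.
Qed.

Lemma integral_running_cost K x : admissible K ->
  (\int[mu]_(t in `[0%R, +oo[) (running_cost A B C Q W K x t)%:E)%E =
  ((x^T *m value K *m x) 0 0)%:E.
Proof.
move=> aK.
have h1 := @cvg_improper_integral R _ (@continuous_running_cost _ _ _ _ A B C Q W K x)
  (fun t => running_cost_ge0 A B C Q_posdef W_posdef K x t).
have h2 : (fun k : nat => (\int[mu]_(t in `[0, k%:R]) running_cost A B C Q W K x t)%:E)
    @ \oo --> ((x^T *m value K *m x) 0 0)%:E.
  apply: cvg_EFin; first by near=> k.
  rewrite /comp /=.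
  under eq_fun do rewrite segment_integral_running_cost.
  have [q q0 hq] : exists2 q, `|q| < 1 & forall k : nat,
      `|(x^T *m value K *m x) 0 0 -
        (x^T *m gramian (closed_loop K) (weight K) k%:R *m x) 0 0| <=
      nrm1 x * ((2 * fb) ^+ 2 * value_bound) * nrm1 x * q ^+ k.
    exists (expR (- decay_rate T0) ^+ 2).
      rewrite ger0_norm ?exprn_ge0 ?expR_ge0// exprn_ilt1// ?expR_ge0//.
      by rewrite -expR0 ltr_expR oppr_lt0 decay_rate_gt0.
    move=> k; have k0 : 0 <= k%:R :> R by [].
    have cK := admissible_contracting aK.
    have BE (M N : 'M[R]_1) : M 0 0 - N 0 0 = (M - N) 0 0 by rewrite !mxE.
    rewrite BE -mulmxBl -mulmxBr (gramian_lyap T0_gt0 _ cK k0) -/(value K) subKr.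
    rewrite (le_trans (ler_bilin _ _ _))//.
    have -> : expR (- decay_rate T0) ^+ 2 ^+ k = expR (- (decay_rate T0 * k%:R)) ^+ 2.
      by rewrite -exprM mulnC exprM -expRM_natr mulNr.
    set e := expR _ ^+ 2; set c := _ * value_bound.
    have -> : nrm1 x * c * nrm1 x * e = nrm1 x * (c * e) * nrm1 x by ring.
    rewrite ler_wpM2r ?nrm1_ge0// ler_wpM2l ?nrm1_ge0//.
    exact: nrm1_flow_value.
  set c := nrm1 x * _ * nrm1 x in hq.
  have hc : (fun k : nat => c * q ^+ k) @ \oo --> c * 0.
    by apply: cvgM; [exact: cvg_cst|exact: (@cvg_expr R q q0)].
  apply/cvgrPdist_le => e e0; rewrite mulr0 in hc.
  have he := (cvgrPdist_le _ _).1 hc e e0.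
  near=> k; rewrite (le_trans (hq k))// (le_trans (ler_norm _))//.
  by rewrite -normrN -sub0r; near: k; exact: he.
exact: (cvg_unique _ h1 h2).
Unshelve. all: by end_near. Qed.

Lemma ecost_value K : admissible K ->
  ecost K = (frob_pair (second_moment D) (value K))%:E.
Proof.
move=> aK; rewrite -(integral_quad D_bounded); apply: eq_integral => x _.
exact: integral_running_cost.
Qed.

Lemma cost_value K : admissible K ->
  cost K = frob_pair (second_moment D) (value K).
Proof. by move=> aK; rewrite /Defs.cost ecost_value. Qed.

(** The derivative of the weight along H. *)
Definition dweight (K H : 'M[R]_(m, p)) : 'M[R]_n :=
  (H *m C)^T *m W *m (K *m C) + (K *m C)^T *m W *m (H *m C).

(** The derivative of the closed loop along H. *)
Definition dloop (H : 'M[R]_(m, p)) : 'M[R]_n := - (B *m H *m C).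

(** The differential of the cost at K, evaluated at H. *)
Definition dcost (K H : 'M[R]_(m, p)) : R :=
  frob_pair (second_moment D)
    (lyap (closed_loop K) (dweight K H + lyap_op (dloop H) (value K))).

Lemma closed_loopD K H : closed_loop (K + H) = closed_loop K + dloop H.
Proof. by rewrite /Defs.closed_loop mulmxDr mulmxDl opprD addrA. Qed.

Lemma weightD K H :
  weight (K + H) = weight K + dweight K H + (H *m C)^T *m W *m (H *m C).
Proof.
rewrite !cost_weightE /dweight mulmxDl; set X := K *m C; set Y := H *m C.
have -> : (X + Y)^T = X^T + Y^T by rewrite raddfD.
by rewrite !(mulmxDl, mulmxDr) -!addrA; congr (_ + (_ + _)); rewrite addrCA.
Qed.

Lemma dcostD K H H' : dcost K (H + H') = dcost K H + dcost K H'.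
Proof.
rewrite /dcost -frob_pairDr -lyapD; congr (frob_pair _ (lyap _ _)).
rewrite /dloop mulmxDr mulmxDl opprD lyap_opDl [RHS]addrACA; congr (_ + _).
rewrite /dweight mulmxDl; set X := K *m C; set Y := H *m C; set Y' := H' *m C.
have -> : (Y + Y')^T = Y^T + Y'^T by rewrite raddfD.
by rewrite !mulmxDl mulmxDr addrACA.
Qed.

Lemma dcostZ K a H : dcost K (a *: H) = a * dcost K H.
Proof.
have e1 : dloop (a *: H) = a *: dloop H.
  by rewrite /dloop -scalemxAr -scalemxAl scalerN.
have e2 : dweight K (a *: H) = a *: dweight K H.
  rewrite /dweight -scalemxAl; set X := K *m C; set Y := H *m C.
  have -> : (a *: Y)^T = a *: Y^T by rewrite linearZ.
  by rewrite -!scalemxAl -scalemxAr scalerDr.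
by rewrite /dcost e1 e2 lyap_opZl -scalerDr lyapZ frob_pairZr.
Qed.

Lemma dcost_sum K H : dcost K H = \sum_i \sum_j H i j * dcost K (delta_mx i j).
Proof.
have d0 : dcost K 0 = 0 by have := dcostZ K 0 0; rewrite scale0r mul0r.
have dS I (r : seq I) (F : I -> 'M[R]_(m, p)) :
    dcost K (\sum_(i <- r) F i) = \sum_(i <- r) dcost K (F i).
  by elim: r => [|i r IH]; rewrite ?big_nil// !big_cons dcostD IH.
rewrite {1}[H]matrix_sum_delta dS; apply: eq_bigr => i _.
by rewrite dS; apply: eq_bigr => j _; rewrite dcostZ.
Qed.

Lemma nrm1_dloop H : nrm1 (dloop H) <= nrm1 B * nrm1 C * nrm1 H.
Proof.
rewrite /dloop nrm1N (le_trans (nrm1M _ _))// mulrAC ler_wpM2r ?nrm1_ge0//.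
exact: nrm1M.
Qed.

(** Gains close to a gain with a smaller contraction constant stay admissible. *)
Lemma admissible_perturb (b' : R) : b' < b -> exists2 h, 0 < h &
  forall K H, nrm1 (K *m C) <= b' ->
    nrm1 (expmx (T0 *: closed_loop K)) <= 4^-1 -> nrm1 H <= h ->
    admissible (K + H).
Proof.
move=> b'b.
pose q := (n * n)%:R ^+ 3 * expR (T0 * loop_bound) ^+ 2 * T0 * (nrm1 B * nrm1 C).
have q0 : 0 <= q.
  by rewrite !mulr_ge0 ?nrm1_ge0 ?exprn_ge0 ?expR_ge0// ltW.
pose h := Num.min ((b - b') / (nrm1 C + 1)) (4^-1 / (q + 1)).
have C1 : 0 < nrm1 C + 1 by rewrite ltr_wpDl ?nrm1_ge0.
have q1 : 0 < q + 1 by rewrite ltr_wpDl.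
exists h; first by rewrite lt_min !divr_gt0 ?subr_gt0.
move=> K H Kb Kh; rewrite le_min => /andP[]; rewrite !ler_pdivlMr// => h1 h2.
have H0 := nrm1_ge0 H.
have HCb : nrm1 (H *m C) <= b - b'.
  by rewrite (le_trans (nrm1M _ _))// (le_trans _ h1)// ler_wpM2l// lerDl.
have KHb : nrm1 ((K + H) *m C) <= b.
  rewrite mulmxDl (le_trans (nrm1D _ _))// (le_trans (lerD Kb HCb))//.
  by rewrite addrC subrK.
have lK K' : nrm1 (K' *m C) <= b -> nrm1 (closed_loop K') <= loop_bound.
  move=> K'b; rewrite /Defs.closed_loop (le_trans (nrm1B _ _))// lerD2l -mulmxA.
  by rewrite (le_trans (nrm1M _ _))// ler_wpM2l// nrm1_ge0.
split => //.
have hK := lK K (le_trans Kb (ltW b'b)).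
have hE : nrm1 (expmx (T0 *: closed_loop (K + H)) - expmx (T0 *: closed_loop K)) <= 4^-1.
  apply: le_trans (nrm1_expmxB (ltW T0_gt0) hK (lK _ KHb)) _.
  rewrite closed_loopD [closed_loop K + _]addrC addrK.
  apply: (@le_trans _ _ (q * nrm1 H)).
    rewrite /q -[leRHS]mulrA ler_wpM2l ?nrm1_dloop// !mulr_ge0 ?exprn_ge0 ?expR_ge0//.
    exact: ltW.
  by rewrite (le_trans _ h2)// mulrC ler_wpM2l// lerDl.
rewrite -[expmx _](subrK (expmx (T0 *: closed_loop K))) (le_trans (nrm1D _ _))//.
apply: le_trans (lerD hE Kh) _.
by lra.
Qed.

(** The remainder of the first-order expansion of the cost is quadratic. By
    linearity of the Lyapunov equation the value matrix at K + H solves an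
    equation for the closed loop at K whose right-hand side differs from that
    of its linearization by terms of second order. *)
Lemma cost_first_order : exists2 L, 0 <= L & forall K H, nrm1 H <= 1 ->
  admissible K -> admissible (K + H) ->
  `|cost (K + H) - cost K - dcost K H| <= L * nrm1 H ^+ 2.
Proof.
set c := nrm1 C; set w := nrm1 W; set be := nrm1 B * nrm1 C.
have c0 : 0 <= c by exact: nrm1_ge0.
have w0 : 0 <= w by exact: nrm1_ge0.
have be0 : 0 <= be by rewrite mulr_ge0 ?nrm1_ge0.
have l0 : 0 <= lb by exact: lyap_bound_ge0.
have v0 := value_bound_ge0.
pose e := lb * (c * w * c + 2 * be *
  (lb * (2 * (c * w * b) + c * w * c + 2 * be * value_bound))).
have e0 : 0 <= e.
  by rewrite /e; repeat first [assumption|exact: ler0n|apply: addr_ge0|apply: mulr_ge0].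
exists (nrm1 (second_moment D) * e); first by rewrite mulr_ge0// nrm1_ge0.
move=> K H H1 aK aKH; set h := nrm1 H.
have h01 : 0 <= h <= 1 by rewrite nrm1_ge0 H1.
have cK := admissible_contracting aK; have cKH := admissible_contracting aKH.
have Kb : nrm1 (K *m C) <= b by case: aK.
have Hc : nrm1 (H *m C) <= h * c by exact: nrm1M.
have hZ1 : nrm1 (dweight K H) <= 2 * (c * w * b) * h.
  rewrite (le_trans (nrm1D _ _))//.
  apply: le_trans (lerD (nrm1_conj Hc Kb (lexx _)) (nrm1_conj Kb Hc (lexx _))) _.
  by rewrite le_eqVlt; apply/orP; left; apply/eqP; rewrite -/w; ring.
have hZ2 : nrm1 ((H *m C)^T *m W *m (H *m C)) <= c * w * c * h ^+ 2.
  apply: le_trans (nrm1_conj Hc Hc (lexx _)) _.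
  by rewrite le_eqVlt; apply/orP; left; apply/eqP; rewrite -/w; ring.
have X'E : value (K + H) = lyap (closed_loop K)
    (weight (K + H) + lyap_op (dloop H) (value (K + H))).
  apply: (lyap_uniq T0_gt0 cK); apply/eqP; rewrite opprD -subr_eq opprK.
  by rewrite -lyap_opDl -closed_loopD (lyapP T0_gt0 _ cKH).
have dXE : value (K + H) - value K = lyap (closed_loop K)
    (dweight K H + (H *m C)^T *m W *m (H *m C) + lyap_op (dloop H) (value (K + H))).
  rewrite {1}X'E {2}/value -lyapB weightD; congr (lyap _ _).
  by rewrite -!addrA [LHS]addrC !addrA subrK.
have z20 : 0 <= c * w * c by repeat first [assumption|apply: mulr_ge0].
have := lyap_remainder T0_gt0 cK h01 z20 (nrm1_dloop H) hZ1 hZ2 (nrm1_value aKH) dXE.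
rewrite !cost_value// /dcost -!frob_pairBr => hR.
apply: le_trans (ler_frob_pair _ _) _.
by rewrite -mulrA ler_wpM2l ?nrm1_ge0.
Qed.

Lemma grad_cost_dcost K h0 i j : 0 < h0 ->
  (forall H, nrm1 H <= h0 -> admissible (K + H)) ->
  grad_cost A B C Q W D K i j = dcost K (delta_mx i j).
Proof.
move=> h00 aH; rewrite mxE; set v := delta_mx i j.
have [L L0 hL] := cost_first_order.
apply/cvg_lim => //; apply/cvgrPdist_le => e e0.
pose nv := nrm1 v + 1.
have nv0 : 0 < nv by rewrite ltr_wpDl ?nrm1_ge0.
have L1 : 0 < L + 1 by rewrite ltr_wpDl.
have d0 : 0 < Num.min (Num.min 1 h0 / nv) (e / ((L + 1) * nv ^+ 2)).
  by rewrite lt_min !divr_gt0 ?lt_min ?ltr01 ?h00 ?mulr_gt0 ?exprn_gt0.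
near=> t.
have t0 : t != 0 by near: t; exact: nbhs_dnbhs_neq.
have : `|t| <= Num.min (Num.min 1 h0 / nv) (e / ((L + 1) * nv ^+ 2)).
  by near: t; exact: dnbhs0_le.
have tp : 0 < `|t| by rewrite normr_gt0.
rewrite le_min !ler_pdivlMr ?mulr_gt0 ?exprn_gt0// le_min => /andP[/andP[h1 h2] h3].
have tv : nrm1 (t *: v) <= `|t| * nv.
  by rewrite nrm1Z ler_wpM2l// lerDl.
have aK : admissible K by rewrite -[K]addr0; apply: aH; rewrite nrm1_0 ltW.
have := hL K (t *: v) (le_trans tv h1) aK (aH _ (le_trans tv h2)).
rewrite dcostZ /= [t *: v + K]addrC => hd.
rewrite distrC; set df := cost _ - cost K in hd *.
have -> : t^-1 *: df - dcost K v = t^-1 * (df - t * dcost K v).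
  by rewrite mulrBr mulKf.
rewrite normrM normfV mulrC ler_pdivrMr//.
apply: le_trans hd _; apply: (@le_trans _ _ (L * (`|t| * nv) ^+ 2)).
  by rewrite ler_wpM2l// lerXn2r ?nnegrE ?nrm1_ge0// mulr_ge0// ltW.
have -> : L * (`|t| * nv) ^+ 2 = `|t| * (L * nv ^+ 2) * `|t| by ring.
rewrite ler_wpM2r// (le_trans _ h3)// ler_wpM2l// ler_wpM2r ?sqr_ge0//.
by rewrite lerDl.
Unshelve. all: by end_near. Qed.

End cost_expansion.

(** Everything the estimator needs to know about the cost, with constants that
    are uniform over a sublevel set. *)
Theorem cost_regularity (R : realType) (n m p : nat)
    (A : 'M[R]_n) (B : 'M[R]_(n, m)) (C : 'M[R]_(p, n))
    (Q : 'M[R]_p) (W : 'M[R]_m)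
    (D : probability (borel_mx R n 1) R) (Pb : R) (a : R) :
  posdefmx Q -> posdefmx W -> posdefmx (second_moment D) ->
  {ae D, forall x, frobenius (x : 'cV[R]_n) <= Pb} -> observable A C ->
  exists h L M k : R, [/\ 0 < h, 0 <= L, 0 <= M & 0 < k] /\
  forall K, sublevel A B C Q W D a K -> forall H, nrm1 H <= h ->
  [/\ `|cost A B C Q W D (K + H) - cost A B C Q W D K
        - frob_pair H (grad_cost A B C Q W D K)| <= L * nrm1 H ^+ 2,
      forall tau x, 0 <= tau ->
        `|truncated_cost A B C Q W tau (K + H) x| <= M * nrm1 x ^+ 2 &
      forall tau, 0 <= tau ->
        `|frob_pair (second_moment D) (gramian (closed_loop A B C (K + H))
            (cost_weight C Q W (K + H)) tau) - cost A B C Q W D (K + H)|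
        <= M * expR (- (k * tau))].
Proof.
move=> Qp Wp Sp Db obs.
have [b0 b00 [N N0 hN]] := @uniform_decay R n m p A B C Q W D Pb Qp Wp Sp Db obs a.
have T0 : 0 < N%:R :> R by rewrite ltr0n.
pose b := b0 + 1; have b_0 : 0 <= b by rewrite addr_ge0.
have b0b : b0 < b by rewrite ltrDl.
have [h h0 hh] := admissible_perturb A B C T0 b0b.
have [L L0 hL] := @cost_first_order R n m p A B C Q W D Pb Qp Wp Db N%:R b T0 b_0.
pose M1 := truncated_bound A B C Q W N%:R b.
pose M2 := nrm1 (second_moment D) *
  ((2 * flow_bound n N%:R (loop_bound A B b)) ^+ 2 * value_bound A B C Q W N%:R b).
exists (Num.min h 1), L, (M1 + M2), (decay_rate N%:R).
have v0 : 0 <= value_bound A B C Q W N%:R b by exact: value_bound_ge0.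
have M10 : 0 <= M1 by exact: truncated_bound_ge0.
have M20 : 0 <= M2 by rewrite mulr_ge0 ?nrm1_ge0// mulr_ge0// sqr_ge0.
split.
  by split => //; [rewrite lt_min h0 ltr01|exact: addr_ge0|exact: decay_rate_gt0].
move=> K [_ Ka] H; rewrite le_min => /andP[Hh H1].
have [Kb Kc] := hN K Ka.
have aH H' : nrm1 H' <= h -> admissible A B C N%:R b (K + H') by exact: hh.
have aK : admissible A B C N%:R b K by rewrite -[K]addr0; apply: aH; rewrite nrm1_0 ltW.
have aKH := aH H Hh.
split.
- have -> : frob_pair H (grad_cost A B C Q W D K) = dcost A B C Q W D K H.
    rewrite dcost_sum; apply: eq_bigr => i _; apply: eq_bigr => j _.
    by rewrite (grad_cost_dcost Qp Wp Db T0 b_0 i j h0 aH) mulrC.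
  exact: hL.
- move=> tau x tau0; apply: le_trans (ler_truncated_cost Q W T0 b_0 x aKH tau0) _.
  by rewrite ler_wpM2r ?exprn_ge0 ?nrm1_ge0// lerDl.
- move=> tau tau0; rewrite (cost_value Qp Wp Db T0 aKH).
  rewrite (gramian_lyap T0 _ (admissible_contracting aKH) tau0) -/(value _ _ _ _ _ _).
  rewrite frob_pairBr addrAC subrr sub0r normrN.
  rewrite (le_trans (ler_frob_pair _ _))//.
  apply: (@le_trans _ _ (M2 * expR (- (decay_rate N%:R * tau)))).
    rewrite /M2 -mulrA ler_wpM2l ?nrm1_ge0//.
    apply: le_trans (nrm1_flow_value Q W T0 aKH tau0) _.
    apply: ler_wpM2l; first by apply: mulr_ge0 => //; exact: sqr_ge0.
    rewrite expr2 -[leRHS]mul1r; apply: ler_wpM2r; first exact: expR_ge0.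
    rewrite -[leRHS]expR0 ler_expR oppr_le0; apply: mulr_ge0 => //.
    by apply: ltW; exact: decay_rate_gt0.
  by rewrite ler_wpM2r ?expR_ge0// lerDr.
Qed.


(** * Integrals determined by measurable rectangles *)

Section integral_comp_sets.
Context d (T : measurableType d) (R : realType) (P : probability T R).
Context d' (Y : measurableType d').
Variable Z : T -> Y.
Hypothesis mZ : measurable_fun setT Z.

Import HBNNSimple.

Let mpre (S : set Y) : measurable S -> measurable (Z @^-1` S).
Proof. by move=> mS; rewrite -[Z @^-1` S]setTI; exact: mZ. Qed.

(** The integrals of h on the sets Z @^-1` S determine the integrals of the
    products of h with the functions of Z. *)
Lemma eq_integral_comp (h1 h2 : T -> R) :
  (forall w, 0 <= h1 w) -> (forall w, 0 <= h2 w) ->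
  measurable_fun setT h1 -> measurable_fun setT h2 ->
  (forall S, measurable S -> (\int[P]_(w in Z @^-1` S) (h1 w)%:E =
     \int[P]_(w in Z @^-1` S) (h2 w)%:E)%E) ->
  forall f : Y -> R, (forall y, 0 <= f y) -> measurable_fun setT f ->
  (\int[P]_w (h1 w * f (Z w))%:E = \int[P]_w (h2 w * f (Z w))%:E)%E.
Proof.
move=> h10 h20 mh1 mh2 h12 f f0 mf.
have mf' : measurable_fun setT (EFin \o f) by exact/measurable_EFinP.
pose f_ := nnsfun_approx measurableT mf'.
have lim (h : T -> R) : (forall w, 0 <= h w) -> measurable_fun setT h ->
    (\int[P]_w (h w * f (Z w))%:E =
     limn (fun n => \int[P]_w (h w * f_ n (Z w))%:E))%E.
  move=> h0 mh; rewrite -monotone_convergence//.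
  - apply: eq_integral => w _; apply/esym/cvg_lim => //.
    under eq_fun do rewrite EFinM; rewrite EFinM.
    apply: cvgeZl => //.
    by apply: (cvg_nnsfun_approx measurableT mf') => // y _; rewrite lee_fin.
  - move=> n; apply/measurable_EFinP; apply: measurable_funM => //.
    exact: measurableT_comp.
  - by move=> n w _; rewrite lee_fin mulr_ge0.
  - move=> w _ k n kn; rewrite lee_fin ler_wpM2l//.
    exact/lefP/nd_nnsfun_approx.
rewrite !lim//; congr (limn _); apply/funext => n.
have sums (h : T -> R) : (forall w, 0 <= h w) -> measurable_fun setT h ->
    (\int[P]_w (h w * f_ n (Z w))%:E =
     \sum_(k \in range (f_ n)) `|k|%:E *
       \int[P]_(w in Z @^-1` (f_ n @^-1` [set k])) (h w)%:E)%E.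
  move=> h0 mh.
  transitivity (\int[P]_w (\sum_(k \in range (f_ n))
      `|k|%:E * ((EFin \o h) \_ (Z @^-1` (f_ n @^-1` [set k]))) w)%E)%E.
    apply: eq_integral => w _; rewrite [in LHS]fimfunE EFinM -fsumEFin//.
    rewrite ge0_mule_fsumr//; last by move=> k; rewrite nnfun_muleindic_ge0.
    apply: eq_fsbigr => k /set_mem[y _ yk].
    rewrite patchE indicE; have -> : (w \in Z @^-1` (f_ n @^-1` [set k])) =
        (Z w \in f_ n @^-1` [set k]) by [].
    case: (_ \in _); rewrite /= ?mulr1 ?mulr0 ?mule0//.
    by rewrite muleC ger0_norm// -yk.
  rewrite ge0_integral_fsum//.
  - apply: eq_fsbigr => k _; rewrite ge0_integralZl//.
    + by rewrite -integral_mkcond.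
    + apply/(measurable_restrictT _ _).1; first exact: mpre.
      by apply: measurable_funTS; exact/measurable_EFinP.
    + by move=> w _; apply: erestrict_ge0 => ? _; rewrite lee_fin.
  - move=> k; apply: measurable_funeM.
    apply/(measurable_restrictT _ _).1; first exact: mpre.
    by apply: measurable_funTS; exact/measurable_EFinP.
  - move=> k w _; rewrite mule_ge0//.
    by apply: erestrict_ge0 => ? _; rewrite lee_fin.
by rewrite !sums//; apply: eq_fsbigr => k _; rewrite h12.
Qed.

End integral_comp_sets.

Section rectangles.
Context d (T : measurableType d) (R : realType) (P : probability T R).
Context d1 d2 (T1 : measurableType d1) (T2 : measurableType d2).
Variables (U : T -> T1) (X : T -> T2).
Hypothesis (mU : measurable_fun setT U) (mX : measurable_fun setT X).
Local Notation Z := (fun w => (U w, X w)).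

(** It is enough to compare the integrals of h1 and h2 over the preimages of
    measurable rectangles. *)
Lemma eq_integral_rectangles (h1 h2 : T -> R) :
  (forall w, 0 <= h1 w) -> (forall w, 0 <= h2 w) ->
  P.-integrable setT (EFin \o h1) -> P.-integrable setT (EFin \o h2) ->
  (forall A B, measurable A -> measurable B ->
    (\int[P]_(w in U @^-1` A `&` X @^-1` B) (h1 w)%:E =
     \int[P]_(w in U @^-1` A `&` X @^-1` B) (h2 w)%:E)%E) ->
  forall f : T1 * T2 -> R, (forall y, 0 <= f y) -> measurable_fun setT f ->
  (\int[P]_w (h1 w * f (U w, X w))%:E = \int[P]_w (h2 w * f (U w, X w))%:E)%E.
Proof.
move=> h10 h20 ih1 ih2 h12 f f0 mf.
have mh1 : measurable_fun setT h1 by apply/measurable_EFinP; exact: measurable_int ih1.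
have mh2 : measurable_fun setT h2 by apply/measurable_EFinP; exact: measurable_int ih2.
have mZ : measurable_fun setT Z by exact: measurable_fun_pair.
have mpre (S : set (T1 * T2)) : measurable S -> measurable (Z @^-1` S).
  by move=> mS; rewrite -[Z @^-1` S]setTI; exact: mZ.
apply: (eq_integral_comp mZ) => //.
pose C : set (set (T1 * T2)) :=
  [set C | exists A, measurable A /\ exists B, measurable B /\ C = A `*` B].
have CI : setI_closed C.
  move=> /= _ _ [X1 [mX1 [X2 [mX2 ->]]]] [Y1 [mY1 [Y2 [mY2 ->]]]].
  rewrite -setXI; exists (X1 `&` Y1); split; first exact: measurableI.
  by exists (X2 `&` Y2); split => //; exact: measurableI.
have CE : @measurable _ (T1 * T2)%type = <<s C >>.
  rewrite measurable_prod_measurableType //; congr (<<s _ >>).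
  rewrite predeqE; split => [[A mA [B mB <-]]|[A [mA [B [mB ->]]]]].
    by exists A; split => //; exists B.
  by exists A => //; exists B.
have pE A B : Z @^-1` (A `*` B) = U @^-1` A `&` X @^-1` B by [].
have hT : (\int[P]_(w in Z @^-1` setT) (h1 w)%:E =
    \int[P]_(w in Z @^-1` setT) (h2 w)%:E)%E.
  by rewrite -setXTT pE; exact: h12.
move=> S; rewrite CE; move: S; apply: (dynkin_induction CE CI) => //.
- by move=> _ [A [mA [B [mB ->]]]]; rewrite pE; exact: h12.
- move=> S mS hS; have mZS := mpre _ mS.
  have mZC := mpre _ (measurableC mS).
  have split_int (h : T -> R) : (forall w, 0 <= h w) -> measurable_fun setT h ->
      (\int[P]_(w in Z @^-1` setT) (h w)%:E =
       \int[P]_(w in Z @^-1` S) (h w)%:E + \int[P]_(w in Z @^-1` (~` S)) (h w)%:E)%E.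
    move=> h0 mh; rewrite -ge0_integral_setU//.
    + by congr (integral _ _ _); rewrite -preimage_setU setUv.
    + by apply: measurable_funTS; exact/measurable_EFinP.
    + by move=> w _; rewrite lee_fin.
    + by apply/disj_setPS => w [] /=.
  have := hT; rewrite (split_int h1)// (split_int h2)// hS.
  have fin : (\int[P]_(w in Z @^-1` S) (h2 w)%:E)%E \is a fin_num.
    apply: integrable_fin_num => //; exact: (integrableS measurableT mZS (@subsetT _ _) ih2).
  have canc (a y z : \bar R) : a \is a fin_num -> (a + y = a + z -> y = z)%E.
    by move=> fa /(congr1 (fun x => x - a)%E); rewrite ![(a + _)%E]addeC !addeK.
  exact: canc.
- move=> F mF tF hF; rewrite preimage_bigcup.
  have tZ : trivIset setT (fun k => Z @^-1` F k).
    move=> i j _ _ [w [/= wi wj]]; apply: tF => //; by exists (Z w).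
  have un (h : T -> R) : (forall w, 0 <= h w) -> measurable_fun setT h ->
      (\int[P]_(w in \bigcup_k Z @^-1` F k) (h w)%:E =
       \sum_(k <oo) \int[P]_(w in Z @^-1` F k) (h w)%:E)%E.
    move=> h0 mh; apply: ge0_integral_bigcup => //.
    + by move=> k; exact: mpre.
    + by apply: measurable_funTS; exact/measurable_EFinP.
    + by move=> w _; rewrite lee_fin.
  by rewrite !un//; apply: eq_eseriesr => k _; exact: hF.
Qed.

End rectangles.

(** * Independent pairs *)

Section independent_pairs.
Context d (T : measurableType d) (R : realType) (P : probability T R).
Context d1 d2 (T1 : measurableType d1) (T2 : measurableType d2).
Variables (N : nat) (U : 'I_N -> {mfun T >-> T1}) (X : 'I_N -> {mfun T >-> T2}).
Hypothesis indep : mutually_independent P (fun k : 'I_N + 'I_N =>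
  match k with
  | inl i => g_sigma_algebra_preimage (U i)
  | inr i => g_sigma_algebra_preimage (X i)
  end).

(** The probability of an event, as a real number. *)
Let pr (A : set T) : R := fine (P A).

Let prE A : measurable A -> P A = (pr A)%:E.
Proof. by move=> mA; rewrite /pr fineK// fin_num_measure. Qed.

Let mU i (A : set T1) : measurable A -> measurable (U i @^-1` A).
Proof. by move=> mA; rewrite -[_ @^-1` _]setTI; exact: measurable_funP. Qed.

Let mX i (B : set T2) : measurable B -> measurable (X i @^-1` B).
Proof. by move=> mB; rewrite -[_ @^-1` _]setTI; exact: measurable_funP. Qed.

Lemma rectangles_independent (A : 'I_N -> set T1) (B : 'I_N -> set T2) :
  (forall i, measurable (A i)) -> (forall i, measurable (B i)) ->
  P (\bigcap_(i in [set: 'I_N]) (U i @^-1` A i `&` X i @^-1` B i)) =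
  (\prod_i (pr (U i @^-1` A i) * pr (X i @^-1` B i)))%:E.
Proof.
move=> mA mB.
pose E (k : 'I_N + 'I_N) :=
  match k with inl i => U i @^-1` A i | inr i => X i @^-1` B i end.
have mE k : measurable (E k) by case: k => i; [exact: mU|exact: mX].
have -> : \bigcap_(i in [set: 'I_N]) (U i @^-1` A i `&` X i @^-1` B i) =
    \bigcap_(k in [set` [set: 'I_N + 'I_N]%SET]) E k.
  apply/seteqP; split => w h.
    by move=> [i|i] _ /=; have [] := h i I.
  by move=> i _; split; [apply: (h (inl i))|apply: (h (inr i))]; rewrite /= inE.
rewrite indep; last first.
  by move=> [i|i] _ /=; [exists (A i)|exists (B i)]; rewrite ?setTI.
rewrite (eq_bigr (fun k => (pr (E k))%:E)); last by move=> k _; exact: prE.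
rewrite prodEFin; congr (_%:E).
rewrite (eq_bigl xpredT); last by move=> k; rewrite inE.
by rewrite big_sumType/= -big_split.
Qed.

Lemma pair_independent i (A : set T1) (B : set T2) :
  measurable A -> measurable B ->
  pr (U i @^-1` A `&` X i @^-1` B) = pr (U i @^-1` A) * pr (X i @^-1` B).
Proof.
move=> mA mB.
have := @rectangles_independent (fun j => if j == i then A else setT)
  (fun j => if j == i then B else setT).
have -> : \bigcap_(j in [set: 'I_N]) (U j @^-1` (if j == i then A else setT) `&`
    X j @^-1` (if j == i then B else setT)) = U i @^-1` A `&` X i @^-1` B.
  apply/seteqP; split => w h; first by have := h i I; rewrite eqxx.
  by move=> j _; case: eqP => [->|].
move=> h; rewrite {1}/pr h.
- rewrite /= (bigD1 i)//= eqxx big1 ?mulr1// => j /negPf ->.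
  by rewrite !preimage_setT /pr probability_setT mulr1.
- by move=> j; case: ifP.
- by move=> j; case: ifP.
Qed.

Local Notation Z i := (fun w => (U i w, X i w)).

Let mZ i : measurable_fun setT (Z i).
Proof. by apply: measurable_fun_pair; exact: measurable_funP. Qed.

Lemma bounded_integrable (h : T -> R) c : measurable_fun setT h ->
  (forall w, `|h w| <= c) -> P.-integrable setT (EFin \o h).
Proof. by move=> mh hc; apply: (ae_bounded_integrable (c := c)) => //; exact: aeW. Qed.

Lemma measurable_prod_fun (I : Type) (r : seq I) (Q : pred I) (f : I -> T -> R) :
  (forall i, measurable_fun setT (f i)) ->
  measurable_fun setT (fun t => \prod_(i <- r | Q i) f i t).
Proof.
move=> mf; elim: r => [|i r IH].
  by under eq_fun do rewrite big_nil; exact: measurable_cst.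
under eq_fun do rewrite big_cons.
by case: (Q i) => //; exact: measurable_funM.
Qed.

Lemma Rintegral_indic_setT S : measurable S -> \int[P]_w (\1_S w : R) = pr S.
Proof. by move=> mS; rewrite /Rintegral integral_indic// setIT. Qed.

(** Functions of the independent pairs (U i, X i) factor under the mean. The
    functions are replaced by indicators of rectangles one after the other. *)
Lemma expectation_prod (f : 'I_N -> T1 * T2 -> R) (c : R) :
  (forall i, measurable_fun setT (f i)) ->
  (forall i z, 0 <= f i z <= c) ->
  \int[P]_w (\prod_i f i (U i w, X i w)) = \prod_i \int[P]_w f i (U i w, X i w).
Proof.
move=> mf fc.
(* k counts the functions that need not be indicators of rectangles *)
suff St k : (k <= N)%N -> forall g : 'I_N -> T1 * T2 -> R,
    (forall i, measurable_fun setT (g i)) ->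
    (exists c, forall i z, 0 <= g i z <= c) ->
    (forall i : 'I_N, (k <= i)%N -> exists A B, [/\ measurable A, measurable B &
       g i = fun z => \1_A z.1 * \1_B z.2]) ->
    \int[P]_w (\prod_i g i (U i w, X i w)) = \prod_i \int[P]_w g i (U i w, X i w).
  apply: (St N) => //; first by exists c.
  by move=> i; rewrite leqNgt ltn_ord.
elim: k => [_|k IH kN] g mg [e ge] hg.
  have {hg} hg i : exists AB : set T1 * set T2, [/\ measurable AB.1, measurable AB.2 &
       g i = fun z => \1_(AB.1) z.1 * \1_(AB.2) z.2].
    by have [//|A [B [mA mB gE]]] := hg i; exists (A, B).
  have [AB hAB] := choice hg.
  have gE i w : g i (U i w, X i w) = \1_(U i @^-1` (AB i).1 `&` X i @^-1` (AB i).2) w.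
    have [_ _ ->] := hAB i; rewrite /= !indicE in_setI.
    have -> : (w \in U i @^-1` (AB i).1) = (U i w \in (AB i).1) by [].
    have -> : (w \in X i @^-1` (AB i).2) = (X i w \in (AB i).2) by [].
    by case: (_ \in _); case: (_ \in _); rewrite /= ?mulr1 ?mulr0.
  have mI i : measurable (U i @^-1` (AB i).1 `&` X i @^-1` (AB i).2).
    by have [? ? _] := hAB i; apply: measurableI; [exact: mU|exact: mX].
  transitivity (pr (\bigcap_(i in [set: 'I_N])
      (U i @^-1` (AB i).1 `&` X i @^-1` (AB i).2))).
    rewrite -Rintegral_indic_setT; last first.
      by apply: fin_bigcap_measurable => [|i _]; [exact: finite_finset|exact: mI].
    apply: eq_Rintegral => w _; rewrite (eq_bigr _ (fun i _ => gE i w)).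
    rewrite indicE; case: (boolP (_ \in _)) => [/set_mem h|/negP h].
      by rewrite big1// => i _; rewrite indicE mem_set//; exact: h.
    have [i wi] : exists i, w \notin (U i @^-1` (AB i).1 `&` X i @^-1` (AB i).2).
      apply: contrapT => /forallNP hn; apply: h; apply/mem_set => i _.
      by apply/set_mem; apply: contrapT => /negP; exact: hn.
    by rewrite (bigD1 i)//= indicE (negPf wi) mul0r.
  rewrite {1}/pr rectangles_independent/=; last 2 first.
    by move=> i; have [] := hAB i.
    by move=> i; have [] := hAB i.
  apply: eq_bigr => i _; have [mA mB _] := hAB i.
  rewrite -pair_independent//; under eq_Rintegral do rewrite gE.
  by rewrite Rintegral_indic_setT.
pose i0 := Ordinal kN.
pose h1 w := \prod_(i | i != i0) g i (U i w, X i w).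
pose c0 := \prod_(i | i != i0) \int[P]_w g i (U i w, X i w).
have g0 i z : 0 <= g i z by case/andP: (ge i z).
have gZ i : measurable_fun setT (fun w => g i (U i w, X i w)).
  exact: (measurableT_comp (mg i) (mZ i)).
have c00 : 0 <= c0 by apply: prodr_ge0 => i _; exact: Rintegral_ge0.
have mh1 : measurable_fun setT h1 by exact: measurable_prod_fun.
have h10 w : 0 <= h1 w by apply: prodr_ge0 => i _.
have ih1 : P.-integrable setT (EFin \o h1).
  apply: (bounded_integrable (c := \prod_(i | i != i0) e)) => // w.
  by rewrite ger0_norm//; apply: ler_prod => i _; exact: ge.
have ih2 : P.-integrable setT (EFin \o cst c0).
  by apply: (bounded_integrable (c := c0)) => // w; rewrite ger0_norm.
have hrect A B : measurable A -> measurable B ->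
    (\int[P]_(w in U i0 @^-1` A `&` X i0 @^-1` B) (h1 w)%:E =
     \int[P]_(w in U i0 @^-1` A `&` X i0 @^-1` B) (cst c0 w)%:E)%E.
  move=> mA mB; set S := _ `&` _.
  have mS : measurable S by apply: measurableI; [exact: mU|exact: mX].
  pose g' i := if i == i0 then (fun z : T1 * T2 => \1_A z.1 * \1_B z.2 : R) else g i.
  have indE w : \1_A (U i0 w) * \1_B (X i0 w) = \1_S w :> R.
    rewrite !indicE in_setI.
    have -> : (w \in U i0 @^-1` A) = (U i0 w \in A) by [].
    have -> : (w \in X i0 @^-1` B) = (X i0 w \in B) by [].
    by case: (_ \in _); case: (_ \in _); rewrite /= ?mulr1 ?mulr0.
  have mAB : measurable_fun setT (fun z : T1 * T2 => \1_A z.1 * \1_B z.2 : R).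
    apply: measurable_funM; apply: (measurableT_comp (measurable_indic _)) => //.
  have := IH (ltnW kN) g' _ _ _.
  have -> : \int[P]_w (\prod_i g' i (U i w, X i w)) = \int[P]_(w in S) h1 w.
    rewrite [RHS]Rintegral_mkcond; apply: eq_Rintegral => w _.
    rewrite (bigD1 i0)//= /g' eqxx /= indE patchE indicE.
    rewrite (eq_bigr (fun i => g i (U i w, X i w))); last by move=> i /negPf ->.
    by case: (_ \in _); rewrite ?mul1r ?mul0r.
  have -> : \prod_i \int[P]_w g' i (U i w, X i w) = \int[P]_(w in S) c0.
    rewrite (bigD1 i0)//= /g' eqxx Rintegral_cst// mulrC.
    rewrite (eq_bigr (fun i => \int[P]_w g i (U i w, X i w))); last by move=> i /negPf ->.
    congr (_ * _); under eq_Rintegral do rewrite indE.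
    by rewrite /Rintegral integral_indic// setIT.
  move=> h.
  have iS (q : T -> R) : P.-integrable setT (EFin \o q) ->
      (\int[P]_(w in S) (q w)%:E)%E = (\int[P]_(w in S) q w)%:E.
    move=> iq; rewrite /Rintegral fineK//; apply: integrable_fin_num => //.
    exact: (integrableS measurableT mS (@subsetT _ _) iq).
  rewrite (iS h1)// (iS (cst c0))//; congr (_%:E); apply: h.
  - by move=> i; rewrite /g'; case: ifP.
  - exists (Num.max e 1) => i z; rewrite /g'; case: ifP => _.
      rewrite !indicE mulr_ge0//= le_max; apply/orP; right.
      by case: (_ \in _); case: (_ \in _); rewrite /= ?mulr1 ?mulr0.
    by rewrite g0/= le_max; have /andP[_ ->] := ge i z.
  - move=> i ki; rewrite /g'; case: eqP => [_|/eqP ii0]; first by exists A, B.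
    by apply: hg; rewrite ltn_neqAle ki andbT; apply: contra ii0 => /eqP ki';
      apply/eqP/val_inj.
(* the integrals agree when g i0 is the indicator of a rectangle, hence always *)
have := @eq_integral_rectangles _ T R P _ _ T1 T2 (U i0) (X i0)
  (measurable_funP _) (measurable_funP _) h1 (cst c0) h10 (fun=> c00) ih1 ih2 hrect
  (g i0) (g0 i0) (mg i0).
move=> h; rewrite [RHS](bigD1 i0)//= -/c0.
transitivity (\int[P]_w (h1 w * g i0 (U i0 w, X i0 w))).
  by apply: eq_Rintegral => w _; rewrite (bigD1 i0)//= mulrC.
have -> : \int[P]_w (h1 w * g i0 (U i0 w, X i0 w)) =
    \int[P]_w (c0 * g i0 (U i0 w, X i0 w)) by exact: (congr1 fine h).
rewrite RintegralZl//; first by rewrite mulrC.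
apply: (bounded_integrable (c := e)) => // w.
by rewrite ger0_norm//; case/andP: (ge i0 (U i0 w, X i0 w)).
Qed.

Lemma Rintegral_const (c : R) : \int[P]_w c = c.
Proof. by rewrite Rintegral_cst//= probability_setT/= mulr1. Qed.

Lemma ler_expR_quad (x : R) : `|x| <= 2^-1 -> expR x <= 1 + x + 2 * x ^+ 2.
Proof.
rewrite ler_norml => /andP[x1 x2].
have h := expR_ge1Dx (- x).
have xp : 0 < 1 + - x by lra.
have : expR x <= (1 - x)^-1.
  by rewrite -[expR x]invrK -expRN lef_pV2// posrE expR_gt0.
move=> /le_trans; apply.
have xp' : 0 <= (1 - x)^-1 by rewrite invr_ge0 ltW.
rewrite -[leRHS](mulfK (lt0r_neq0 xp)) -[leLHS]mul1r ler_wpM2r//.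
have -> : (1 + x + 2 * x ^+ 2) * (1 - x) = 1 + x ^+ 2 * (1 - 2 * x) by ring.
by rewrite lerDl mulr_ge0 ?sqr_ge0//; lra.
Qed.

(** The means may depend on i, since the laws of the pairs may. *)
Lemma chernoff_bound (F : T1 * T2 -> R) (mean : 'I_N -> R) (b t : R) : (0 < N)%N -> 0 < b ->
  measurable_fun setT F -> (forall z, `|F z| <= b) ->
  (forall i, \int[P]_w F (U i w, X i w) = mean i) ->
  0 < t <= 4 * b ->
  (P [set w | N%:R * t <= \sum_i (F (U i w, X i w) - mean i)]%R <=
    (expR (- (N%:R * (t ^+ 2 / (32 * b ^+ 2)))))%:E)%E.
Proof.
move=> N0 b0 mF Fb Fm /andP[t0 tb].
(* s minimizes 8 * s ^+ 2 * b ^+ 2 - s * t *)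
pose s := t / (16 * b ^+ 2).
have b2 : 0 < 16 * b ^+ 2 by rewrite mulr_gt0// exprn_gt0.
have s0 : 0 < s by rewrite divr_gt0.
have mFZ i : measurable_fun setT (fun w => F (U i w, X i w)).
  exact: (measurableT_comp mF (mZ i)).
have iF i : P.-integrable setT (EFin \o (fun w => F (U i w, X i w))).
  exact: (bounded_integrable (c := b)).
have mb i : `|mean i| <= b.
  rewrite -(Fm i) (le_trans (le_normr_Rintegral _ (iF i)))//.
  rewrite -[leRHS]Rintegral_const; apply: le_Rintegral => //.
  - apply: (bounded_integrable (c := b)); first exact: measurableT_comp.
    by move=> w; rewrite normr_id.
  - by apply: (bounded_integrable (c := `|b|)).
pose G i z := F z - mean i.
have Gb i z : `|G i z| <= 2 * b.
  by rewrite (le_trans (ler_normB _ _))// mulr_natl mulr2n lerD.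
have mG i : measurable_fun setT (G i) by exact: measurable_funB.
have iG i : P.-integrable setT (EFin \o (fun w => G i (U i w, X i w))).
  apply: (bounded_integrable (c := 2 * b)) => //.
  exact: (measurableT_comp (mG i) (mZ i)).
have sG i z : `|s * G i z| <= 2^-1.
  rewrite normrM gtr0_norm//; apply: (@le_trans _ _ (s * (2 * b))).
    by rewrite ler_wpM2l// ltW.
  rewrite /s mulrAC ler_pdivrMr//; nra.
pose g (i : 'I_N) z := expR (s * G i z).
have gc i z : 0 <= g i z <= expR 1.
  rewrite expR_ge0/= ler_expR (le_trans (ler_norm _))// (le_trans (sG i z))//.
  by rewrite invf_le1// ler1n.
have mg i : measurable_fun setT (g i).
  have -> : g i = expR \o (fun z => s * G i z) by [].
  apply: measurableT_comp; first exact: measurable_expR.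
  by apply: measurable_funM => //; exact: measurable_cst.
have mgf i : \int[P]_w g i (U i w, X i w) <= expR (8 * s ^+ 2 * b ^+ 2).
  apply: le_trans (expR_ge1Dx _).
  have -> : 1 + 8 * s ^+ 2 * b ^+ 2 =
      \int[P]_w (s * G i (U i w, X i w) + (1 + 8 * s ^+ 2 * b ^+ 2)).
    rewrite RintegralD//.
    - rewrite RintegralZl// RintegralB//; last exact: (bounded_integrable (c := `|mean i|)).
      by rewrite Fm !Rintegral_const subrr mulr0 add0r.
    - by have := integrableZl measurableT s (iG i).
    - by apply: (bounded_integrable (c := `|1 + 8 * s ^+ 2 * b ^+ 2|)).
  apply: le_Rintegral => //.
  - apply: (bounded_integrable (c := expR 1)).
      exact: (measurableT_comp (mg i) (mZ i)).
    by move=> w; rewrite ger0_norm; case/andP: (gc i (U i w, X i w)).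
  - apply: (bounded_integrable (c := 2^-1 + `|1 + 8 * s ^+ 2 * b ^+ 2|)).
      apply: measurable_funD => //; apply: measurable_funM => //.
      exact: (measurableT_comp (mG i) (mZ i)).
    by move=> w; rewrite (le_trans (ler_normD _ _))// lerD.
  - move=> w _; apply: le_trans (ler_expR_quad (sG i _)) _.
    set y := G i _.
    have yb : y ^+ 2 <= (2 * b) ^+ 2.
      have b20 : 0 <= 2 * b by rewrite mulr_ge0// ltW.
      by rewrite -real_normK ?num_real//; apply: lerXn2r; rewrite ?nnegrE//; exact: Gb.
    have -> : 1 + s * y + 2 * (s * y) ^+ 2 = s * y + (1 + 2 * s ^+ 2 * y ^+ 2) by ring.
    rewrite lerD2l lerD2l.
    have -> : 8 * s ^+ 2 * b ^+ 2 = 2 * s ^+ 2 * (2 * b) ^+ 2 by ring.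
    by rewrite ler_wpM2l// mulr_ge0// sqr_ge0.
pose sumG w := \sum_i G i (U i w, X i w).
have mS : measurable_fun setT sumG.
  by apply: measurable_sum_fun => i; exact: (measurableT_comp (mG i) (mZ i)).
set S := [set w | _].
have SE : S = sumG @^-1` `[N%:R * t, +oo[%classic.
  by apply/seteqP; split => w; rewrite /S /= in_itv/= andbT.
have mSS : measurable S.
  by rewrite SE -[_ @^-1` _]setTI; exact: mS.
rewrite prE// lee_fin -Rintegral_indic_setT//.
have prodE w : \prod_i g i (U i w, X i w) = expR (s * sumG w).
  by rewrite /sumG mulr_sumr expR_sum.
have iprod : P.-integrable setT (EFin \o (fun w => \prod_i g i (U i w, X i w))).
  apply: (bounded_integrable (c := \prod_(i < N) expR 1)).
    by apply: measurable_prod_fun => i; exact: (measurableT_comp (mg i) (mZ i)).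
  move=> w; rewrite ger0_norm; last first.
    by apply: prodr_ge0 => i _; case/andP: (gc i (U i w, X i w)).
  by apply: ler_prod => i _; exact: gc.
apply: (@le_trans _ _ (\int[P]_w (expR (- (s * (N%:R * t))) *
    \prod_i g i (U i w, X i w)))).
  apply: le_Rintegral => //.
  - apply: (bounded_integrable (c := 1)); first exact: measurable_indic.
    by move=> w; rewrite indicE; case: (_ \in _); rewrite /= ?normr1 ?normr0.
  - by have := integrableZl measurableT (expR (- (s * (N%:R * t)))) iprod.
  - move=> w _; rewrite prodE -expRD indicE; case: (boolP (_ \in _)) => [/set_mem h|_].
      have {}h : N%:R * t <= sumG w by exact: h.
      rewrite /= -[leLHS]expR0 ler_expR addrC subr_ge0 ler_wpM2l//.
      exact: ltW.
    exact: expR_ge0.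
rewrite RintegralZl// (@expectation_prod g (expR 1))//.
apply: (@le_trans _ _ (expR (- (s * (N%:R * t))) *
    \prod_(i < N) expR (8 * s ^+ 2 * b ^+ 2))).
  rewrite ler_wpM2l ?expR_ge0//; apply: ler_prod => i _; rewrite mgf andbT.
  by apply: Rintegral_ge0 => w _; rewrite expR_ge0.
rewrite prodr_const card_ord -expRM_natl -expRD ler_expR le_eqVlt.
apply/orP; left; apply/eqP; rewrite /s; field.
by rewrite gt_eqF.
Qed.

(** The two-sided bound, when F is only almost surely bounded on the sample. *)
Lemma hoeffding_ae (F : T1 * T2 -> R) (mean : 'I_N -> R) (b t : R) : (0 < N)%N -> 0 < b ->
  measurable_fun setT F ->
  (forall i, {ae P, forall w, `|F (U i w, X i w)| <= b}) ->
  (forall i, \int[P]_w F (U i w, X i w) = mean i) ->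
  0 < t <= 4 * b ->
  (P [set w | N%:R * t <= `|\sum_i (F (U i w, X i w) - mean i)|]%R <=
    (2 * expR (- (N%:R * (t ^+ 2 / (32 * b ^+ 2)))))%:E)%E.
Proof.
move=> N0 b0 mF Fb Fm tb.
pose F1 z := Num.max (- b) (Num.min b (F z)).
have mF1 : measurable_fun setT F1.
  apply: measurable_maxr; first exact: measurable_cst.
  by apply: measurable_minr => //; exact: measurable_cst.
have F1b z : `|F1 z| <= b.
  rewrite ler_norml le_max lexx /= ge_max ge_min lexx /= andbT.
  by rewrite (@le_trans _ _ 0)// ?oppr_le0 ltW.
have F1E z : `|F z| <= b -> F1 z = F z.
  by rewrite ler_norml => /andP[h1 h2]; rewrite /F1 (min_r h2) (max_r h1).
have mZF (G : T1 * T2 -> R) i : measurable_fun setT G ->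
    measurable_fun setT (fun w => G (U i w, X i w)).
  by move=> mG; exact: (measurableT_comp mG (mZ i)).
have F1m i : \int[P]_w F1 (U i w, X i w) = mean i.
  rewrite -(Fm i); congr fine; apply: ae_eq_integral => //.
  - by apply/measurable_EFinP; exact: mZF.
  - by apply/measurable_EFinP; exact: mZF.
  - apply: (@filterS _ _ (ae_filter_ringOfSetsType P) _ _ _ (Fb i)) => w h _.
    by rewrite /= F1E.
have [Z0 [mZ0 PZ0 Z0E]] : {ae P, forall w, forall i, `|F (U i w, X i w)| <= b}.
  by apply: (@filter_forall _ _ _ _ (ae_filter_ringOfSetsType P)) => i; exact: Fb.
pose S1 := [set w | N%:R * t <= \sum_i (F1 (U i w, X i w) - mean i)].
pose S2 := [set w | N%:R * t <= \sum_i (- F1 (U i w, X i w) - (- mean i))].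
have mge (h : T -> R) c : measurable_fun setT h -> measurable [set w | c <= h w].
  move=> mh; have -> : [set w | c <= h w] = h @^-1` `[c, +oo[%classic.
    by apply/seteqP; split => w; rewrite /= in_itv/= andbT.
  by rewrite -[_ @^-1` _]setTI; exact: mh.
have mS1 : measurable S1.
  apply: mge; apply: measurable_sum_fun => i.
  by apply: measurable_funB => //; exact: mZF.
have mS2 : measurable S2.
  apply: mge; apply: measurable_sum_fun => i.
  by apply: measurable_funB => //; apply: measurableT_comp => //; exact: mZF.
have mS : measurable [set w | N%:R * t <= `|\sum_i (F (U i w, X i w) - mean i)|].
  apply: mge; apply: measurableT_comp => //; apply: measurable_sum_fun => i.
  by apply: measurable_funB => //; exact: mZF.
apply: (@le_trans _ _ (P (Z0 `|` (S1 `|` S2)))).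
  apply: le_measure; rewrite ?inE//; first by do 2?apply: measurableU.
  move=> w /= h; have [hb|hb] := pselect (forall i, `|F (U i w, X i w)| <= b); last first.
    by left; exact: Z0E.
  right.
  have sE : \sum_i (F (U i w, X i w) - mean i) = \sum_i (F1 (U i w, X i w) - mean i).
    by apply: eq_bigr => i _; rewrite F1E.
  have := h; rewrite sE ler_normr => /orP[h1|h2]; [by left|right].
  rewrite /S2/= (le_trans h2)// le_eqVlt; apply/orP; left; apply/eqP.
  by rewrite -sumrN; apply: eq_bigr => i _; rewrite opprB opprK addrC.
apply: (le_trans (measureU2 _ mZ0 (measurableU _ _ mS1 mS2))); rewrite [X in (X + _)%E]PZ0 add0e.
apply: (le_trans (measureU2 _ mS1 mS2)); rewrite mulr_natl mulr2n EFinD.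
apply: leeD; first exact: (chernoff_bound N0 b0 mF1 F1b F1m tb).
apply: (@chernoff_bound (fun z => - F1 z) (fun i => - mean i) b t) => //.
- exact: measurableT_comp.
- by move=> z; rewrite normrN.
- move=> i; rewrite -(F1m i) -[RHS]mulN1r -RintegralZl//.
    by apply: eq_Rintegral => w _; rewrite mulN1r.
  by apply: (bounded_integrable (c := b)) => //; exact: mZF.
Qed.

(** The law of (U i, X i) is a product, so means are iterated integrals. *)
Lemma expectation_pair i (F : T1 * T2 -> R) : measurable_fun setT F ->
  P.-integrable setT (EFin \o (fun w => F (U i w, X i w))) ->
  (\int[P]_w (F (U i w, X i w))%:E =
   \int[distribution P (U i)]_u \int[distribution P (X i)]_x (F (u, x))%:E)%E.
Proof.
move=> mF iF.
pose Zi : {mfun T >-> (T1 * T2)%type} :=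
  HB.pack (Z i) (isMeasurableFun.Build _ _ _ _ _ (mZ i)).
have mF' : measurable_fun setT (EFin \o F) by exact/measurable_EFinP.
have lawE S : measurable S ->
    (distribution P (U i) \x distribution P (X i))%E S = distribution P Zi S.
  apply: product_measure_unique => A B mA mB.
  change (P (U i @^-1` A `&` X i @^-1` B) = (P (U i @^-1` A) * P (X i @^-1` B))%E).
  rewrite !prE ?pair_independent//; [exact: mX|exact: mU|].
  by apply: measurableI; [exact: mU|exact: mX].
have iD : (distribution P Zi).-integrable setT (EFin \o F).
  by apply: integrable_pushforward => //; exact: mZ.
have iP : (distribution P (U i) \x distribution P (X i))%E.-integrable setT (EFin \o F).
  apply/integrableP; split => //.
  have /integrableP[_] := iD.
  rewrite (@eq_measure_integral _ _ _ setT
    (distribution P (U i) \x distribution P (X i))%E)//.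
  by move=> S mS _; exact/esym/lawE.
transitivity (\int[distribution P Zi]_z (F z)%:E)%E.
  by rewrite integral_pushforward//; exact: mZ.
rewrite (@eq_measure_integral _ _ _ setT
    (distribution P (U i) \x distribution P (X i))%E); last first.
  by move=> S mS _; exact/esym/lawE.
by rewrite -(integral12_prod_meas1 iP).
Qed.

End independent_pairs.

(** * Moments of the uniform distribution on the sphere *)

Section reflections.
Variables (R : realType) (m p : nat).
Implicit Types (V M : 'M[R]_(m, p)).

(** The orthogonal reflection in the hyperplane of R^(m x p) orthogonal to V. *)
Definition reflection V M : 'M[R]_(m, p) :=
  M - (2 * frob_pair V M / fro2 V) *: V.

Fact reflection_is_linear V : linear (reflection V).
Proof.
move=> a M M'; rewrite /reflection frob_pairDr frob_pairZr.
by apply/matrixP => i j; rewrite !mxE; ring.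
Qed.

HB.instance Definition _ V := GRing.isLinear.Build R _ _ _ (reflection V)
  (reflection_is_linear V).

Lemma frobenius_reflection V M : frobenius (reflection V M) = frobenius M.
Proof.
have [->|V0] := eqVneq V 0; first by rewrite /reflection scaler0 subr0.
have f0 : fro2 V != 0 by apply: contra V0 => /eqP/fro2_eq0 ->.
rewrite !frobeniusE; congr Num.sqrt.
have E (c : R) : fro2 (M - c *: V) = fro2 M - 2 * c * frob_pair V M + c ^+ 2 * fro2 V.
  rewrite /fro2 /frob_pair !mulr_sumr -sumrB -big_split; apply: eq_bigr => i _ /=.
  rewrite !mulr_sumr -sumrB -big_split; apply: eq_bigr => j _ /=.
  by rewrite !mxE; ring.
by rewrite /reflection E; field.
Qed.

Lemma measurable_reflection V :
  measurable_fun setT (reflection V : borel_mx R m p -> borel_mx R m p).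
Proof.
apply: (@measurability _ _ _ (borel_mx R m p) setT _ (@open 'M[R]_(m, p))) => //.
move=> _ [S oS <-]; rewrite setTI.
apply: sub_sigma_algebra => /=.
apply: (@open_comp _ _ (reflection V : 'M[R]_(m, p) -> 'M[R]_(m, p)) S) => // M _.
apply: (@cvg_entrywise R m p _ (nbhs M) (nbhs_filter M)) => i j.
have -> : (fun M => reflection V M i j) =
    (fun M => M i j + frob_pair V M * (- (2 / fro2 V * V i j))).
  by apply/funext => M'; rewrite !mxE; ring.
have -> : reflection V M i j = M i j + frob_pair V M * (- (2 / fro2 V * V i j)).
  by rewrite !mxE; ring.
apply: (@cvgD _ _ _ (nbhs M) (nbhs_filter M)); first exact: continuous_entry.
suff h : continuous (fun M : 'M[R]_(m, p) =>
    frob_pair V M * (- (2 / fro2 V * V i j)) : R) by exact: h.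
apply: continuous_mul_fun; last exact: cst_continuous.
apply: continuous_sum_fun => k; apply: continuous_sum_fun => l.
by apply: continuous_mul_fun; [exact: continuous_entry|exact: cst_continuous].
Qed.

Lemma reflection_entry V M i j :
  reflection V M i j = M i j - 2 * frob_pair V M / fro2 V * V i j.
Proof. by rewrite !mxE. Qed.

Lemma frob_pair_delta i j M : frob_pair (delta_mx i j) M = M i j.
Proof.
rewrite /frob_pair (bigD1 i)//= (bigD1 j)//= mxE !eqxx mulr1 big1 ?addr0; last first.
  by move=> k /negPf kj; rewrite mxE kj andbF mulr0.
rewrite big1 ?addr0// => k /negPf ki; apply: big1 => l _.
by rewrite mxE ki mulr0.
Qed.

Lemma fro2_delta i j : fro2 (delta_mx i j : 'M[R]_(m, p)) = 1.
Proof.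
transitivity (frob_pair (delta_mx i j : 'M[R]_(m, p)) (delta_mx i j)).
  by apply: eq_bigr => k _; apply: eq_bigr => l _; rewrite expr2.
by rewrite frob_pair_delta mxE !eqxx.
Qed.

(** Reflection in a coordinate vector changes the sign of one entry. *)
Lemma reflection_flip i j M k l :
  reflection (delta_mx i j) M k l =
  if (k == i) && (l == j) then - M i j else M k l.
Proof.
rewrite reflection_entry frob_pair_delta fro2_delta mxE divr1.
by case: andP => [[/eqP -> /eqP ->]|_] /=; [ring|rewrite mulr0 subr0].
Qed.

(** Reflection in a difference of coordinate vectors exchanges two entries. *)
Lemma reflection_swap i j i' j' M : ((i, j) != (i', j'))%B ->
  reflection (delta_mx i j - delta_mx i' j') M i j = M i' j'.
Proof.
move=> ij; set V := _ - _.
have /negPf ij1 : ~~ ((i == i') && (j == j')) by rewrite -xpair_eqE.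
have /negPf ij2 : ~~ ((i' == i) && (j' == j)) by rewrite (eq_sym i') (eq_sym j') ij1.
have Vp N : frob_pair V N = N i j - N i' j'.
  rewrite -!frob_pair_delta /frob_pair -sumrB; apply: eq_bigr => k _.
  rewrite -sumrB; apply: eq_bigr => l _.
  by rewrite /V !mxE -mulrBr.
have Vf : fro2 V = 2.
  transitivity (frob_pair V V).
    by apply: eq_bigr => k _; apply: eq_bigr => l _; rewrite expr2.
  by rewrite Vp /V !mxE !eqxx ij1 ij2 /=; ring.
by rewrite reflection_entry Vf Vp /V !mxE !eqxx ij1/=; field.
Qed.

End reflections.

Section Rintegral_sum.
Context d (T : measurableType d) (R : realType) (P : probability T R).
Variables (I : Type) (f : I -> T -> R).
Hypothesis intf : forall i, P.-integrable setT (EFin \o f i).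

Lemma integrable_sum_fun (r : seq I) :
  P.-integrable setT (EFin \o (fun w => \sum_(i <- r) f i w)).
Proof.
have -> : EFin \o (fun w => \sum_(i <- r) f i w) =
    (fun w => \sum_(i <- r) (EFin \o f i) w)%E.
  by apply/funext => w; rewrite /= sumEFin.
by apply: integrable_sum => // i _; exact: intf.
Qed.

Lemma Rintegral_sum (r : seq I) :
  \int[P]_w (\sum_(i <- r) f i w) = \sum_(i <- r) \int[P]_w f i w.
Proof.
elim: r => [|i r IH].
  rewrite big_nil; under eq_Rintegral do rewrite big_nil.
  by rewrite Rintegral_cst// mul0r.
under eq_Rintegral do rewrite big_cons.
by rewrite RintegralD ?IH ?big_cons//; exact: integrable_sum_fun.
Qed.

End Rintegral_sum.

Section sphere.
Variables (R : realType) (m p : nat) (nu : probability (borel_mx R m p) R).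
Variable rho : R.
Hypotheses (rho0 : 0 <= rho) (nu_sphere : uniform_on_sphere rho nu).

Lemma sphere_ae : {ae nu, forall u, frobenius (u : 'M[R]_(m, p)) = rho}.
Proof.
have [nu1 _] := nu_sphere; set S := [set M | _] in nu1.
have mS : measurable (S : set (borel_mx R m p)).
  have -> : S = (@fro2 R m p) @^-1` [set rho ^+ 2].
    apply/seteqP; split => M; rewrite /S/= frobeniusE.
      by move=> <-; rewrite sqr_sqrtr ?fro2_ge0.
    by move=> ->; rewrite sqrtr_sqr ger0_norm.
  rewrite -[_ @^-1` _]setTI.
  by apply: (measurable_continuous_mx (@continuous_fro2 R m p)).
exists (~` S); split => //; first exact: measurableC.
by rewrite probability_setC// nu1 subee.
Qed.

Lemma sphere_entry_ae : {ae nu, forall u, forall i j, `|(u : 'M[R]_(m, p)) i j| <= rho}.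
Proof.
apply: (@filterS _ _ (ae_filter_ringOfSetsType nu) _ _ _ sphere_ae) => u ur i j.
by rewrite -[leRHS]ur ler_entry_frobenius.
Qed.

Lemma sphere_integrable_entry i j :
  nu.-integrable setT (EFin \o (fun u : borel_mx R m p => (u : 'M[R]_(m, p)) i j)).
Proof.
apply: (ae_bounded_integrable (c := rho)); first exact: measurable_entry.
by apply: (@filterS _ _ (ae_filter_ringOfSetsType nu) _ _ _ sphere_entry_ae) => u; apply.
Qed.

Lemma sphere_integrable_entry2 i j k l :
  nu.-integrable setT (EFin \o (fun u : borel_mx R m p =>
    (u : 'M[R]_(m, p)) i j * (u : 'M[R]_(m, p)) k l)).
Proof.
apply: (ae_bounded_integrable (c := rho * rho)).
  by apply: measurable_funM; exact: measurable_entry.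
apply: (@filterS _ _ (ae_filter_ringOfSetsType nu) _ _ _ sphere_entry_ae) => u ub.
by rewrite normrM ler_pM.
Qed.

Lemma sphere_invariant V (f : 'M[R]_(m, p) -> R) :
  nu.-integrable setT (EFin \o (f : borel_mx R m p -> R)) ->
  \int[nu]_u f (reflection V u) = \int[nu]_u f u.
Proof.
move=> intf; have [_ inv] := nu_sphere.
pose Phi : {mfun borel_mx R m p >-> borel_mx R m p} :=
  HB.pack (reflection V : borel_mx R m p -> borel_mx R m p)
    (isMeasurableFun.Build _ _ _ _ _ (@measurable_reflection R m p V)).
have lawE S : measurable S -> distribution nu Phi S = nu S.
  move=> mS; apply: (inv (reflection V)) => //.
  by move=> M; exact: frobenius_reflection.
have mf : measurable_fun setT (EFin \o (f : borel_mx R m p -> R)).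
  exact: measurable_int intf.
have iD : (distribution nu Phi).-integrable setT (EFin \o (f : borel_mx R m p -> R)).
  apply/integrableP; split => //.
  rewrite (@eq_measure_integral _ _ _ setT nu); last first.
    by move=> S mS _; exact: lawE.
  by case/integrableP: intf.
have mfV := measurableT_comp mf (@measurable_reflection R m p V).
have ifV : nu.-integrable (reflection V @^-1` setT)
    ((EFin \o f) \o (reflection V : borel_mx R m p -> borel_mx R m p)).
  rewrite preimage_setT; apply/integrableP; split => //.
  case/integrableP: iD => _; apply: le_lt_trans; rewrite le_eqVlt; apply/orP; left.
  apply/eqP/esym.
  apply: (ge0_integral_pushforward (@measurable_reflection R m p V) nu measurableT) => //.
  exact: measurableT_comp.
have h := @integral_pushforward _ _ _ _ R _ (@measurable_reflection R m p V) nu setT _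
  mf ifV measurableT.
have e : (\int[distribution nu Phi]_u (f u)%:E = \int[nu]_u (f u)%:E)%E.
  by apply: eq_measure_integral => S mS _; exact: lawE.
congr fine; rewrite -e; apply: etrans (esym h).
by rewrite preimage_setT.
Qed.

Lemma sphere_mean i j : \int[nu]_u (u : 'M[R]_(m, p)) i j = 0.
Proof.
have := sphere_invariant (delta_mx i j) (sphere_integrable_entry i j).
under eq_Rintegral do rewrite reflection_flip !eqxx/= -mulN1r.
rewrite RintegralZl//; last exact: sphere_integrable_entry.
by move=> h; lra.
Qed.

Lemma sphere_covariance i j k l : ((k, l) != (i, j))%B ->
  \int[nu]_u ((u : 'M[R]_(m, p)) i j * (u : 'M[R]_(m, p)) k l) = 0.
Proof.
move=> kl; have /negPf kl1 : ~~ ((k == i) && (l == j)) by rewrite -xpair_eqE.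
have := sphere_invariant (delta_mx i j) (sphere_integrable_entry2 i j k l).
under eq_Rintegral do rewrite !reflection_flip !eqxx kl1/= mulNr -mulN1r.
rewrite RintegralZl//; last exact: sphere_integrable_entry2.
by move=> h; lra.
Qed.

Lemma sphere_variance i j : \int[nu]_u ((u : 'M[R]_(m, p)) i j * (u : 'M[R]_(m, p)) i j) *
  (m * p)%:R = rho ^+ 2.
Proof.
have E k l : \int[nu]_u ((u : 'M[R]_(m, p)) k l * (u : 'M[R]_(m, p)) k l) =
    \int[nu]_u ((u : 'M[R]_(m, p)) i j * (u : 'M[R]_(m, p)) i j).
  have [[-> ->]//|kl] := eqVneq (k, l) (i, j).
  rewrite -(sphere_invariant (delta_mx k l - delta_mx i j)
    (sphere_integrable_entry2 k l k l)).
  by apply: eq_Rintegral => u _; rewrite reflection_swap.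
have h : \int[nu]_u fro2 (u : 'M[R]_(m, p)) = rho ^+ 2.
  transitivity (\int[nu]_u (rho ^+ 2)).
    congr fine; apply: ae_eq_integral => //.
    - apply/measurable_EFinP.
      exact: (measurable_continuous_mx (@continuous_fro2 R m p)).
    - apply: (@filterS _ _ (ae_filter_ringOfSetsType nu) _ _ _ sphere_ae) => u ur _.
      by rewrite /= -ur frobeniusE sqr_sqrtr ?fro2_ge0.
  exact: Rintegral_const.
rewrite -h /fro2.
rewrite Rintegral_sum; last first.
  move=> k; apply: integrable_sum_fun => l.
  under eq_fun do rewrite /= expr2; exact: sphere_integrable_entry2.
rewrite (eq_bigr (fun k => \sum_l \int[nu]_u ((u : 'M[R]_(m, p)) k l ^+ 2))); last first.
  move=> k _; rewrite Rintegral_sum// => l.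
  under eq_fun do rewrite /= expr2; exact: sphere_integrable_entry2.
under eq_bigr do under eq_bigr do (under eq_Rintegral do rewrite expr2; rewrite E).
by rewrite !sumr_const !card_ord mulr_natr -mulrnA mulnC.
Qed.

(** The identity behind the gradient estimate: the correlation of an affine
    function with the entries of u recovers its linear part. *)
Lemma sphere_gradient alpha (G : 'M[R]_(m, p)) i j :
  rho ^+ 2 = (m * p)%:R -> (0 < m * p)%N ->
  \int[nu]_u ((alpha + frob_pair (u : 'M[R]_(m, p)) G) * (u : 'M[R]_(m, p)) i j) = G i j.
Proof.
move=> rhoE mp0.
have intG k l : nu.-integrable setT (EFin \o (fun u : borel_mx R m p =>
    G k l * ((u : 'M[R]_(m, p)) i j * (u : 'M[R]_(m, p)) k l))).
  by have := integrableZl measurableT (G k l) (sphere_integrable_entry2 i j k l).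
have intGk k : nu.-integrable setT (EFin \o (fun u : borel_mx R m p => \sum_l
    G k l * ((u : 'M[R]_(m, p)) i j * (u : 'M[R]_(m, p)) k l))).
  by apply: integrable_sum_fun => l.
have var1 : \int[nu]_u ((u : 'M[R]_(m, p)) i j * (u : 'M[R]_(m, p)) i j) = 1.
  have d0 : (m * p)%:R != 0 :> R by rewrite pnatr_eq0 -lt0n.
  by apply: (mulIf d0); rewrite sphere_variance mul1r.
transitivity (\int[nu]_u (alpha * (u : 'M[R]_(m, p)) i j +
    \sum_k \sum_l G k l * ((u : 'M[R]_(m, p)) i j * (u : 'M[R]_(m, p)) k l))).
  apply: eq_Rintegral => u _; rewrite mulrDl /frob_pair mulr_suml; congr (_ + _).
  by apply: eq_bigr => k _; rewrite mulr_suml; apply: eq_bigr => l _; ring.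
rewrite RintegralD//; last 2 first.
- by have := integrableZl measurableT alpha (sphere_integrable_entry i j).
- by apply: integrable_sum_fun => k.
rewrite RintegralZl//; last exact: sphere_integrable_entry.
rewrite sphere_mean mulr0 add0r Rintegral_sum//.
under eq_bigr do rewrite Rintegral_sum//.
have termE k l : \int[nu]_u (G k l * ((u : 'M[R]_(m, p)) i j * (u : 'M[R]_(m, p)) k l)) =
    G k l * ((k, l) == (i, j))%:R.
  rewrite RintegralZl//; last exact: sphere_integrable_entry2.
  by have [[-> ->]|kl] := eqVneq; rewrite ?var1// sphere_covariance.
rewrite (bigD1 i)//= (bigD1 j)//= termE eqxx mulr1 big1 ?addr0; last first.
  by move=> l lj; rewrite termE xpair_eqE (negPf lj) andbF mulr0.
rewrite big1 ?addr0// => k ki; apply: big1 => l _.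
by rewrite termE xpair_eqE (negPf ki) mulr0.
Qed.

End sphere.

(** * Parameters of the estimator *)

Section parameters.
Variable R : realType.

(** The conditions on the sampling radius r and the horizon tau for the accuracy
    eps. The directions have d entries, bounded by rho, and l1 norm at most c; the
    cost is regular up to the distance h from the gain, with quadratic remainder
    L; the truncation error is M * expR (- (k * tau)), and b bounds the terms of
    the estimator. The last condition bounds the bias. *)
Definition parameters_fit (d h c rho L M k b r tau eps : R) :=
  [/\ 0 < r, 0 < tau, r * c <= h, r * eps / (2 * d) <= 4 * b &
   (M * expR (- (k * tau)) + L * (r * c) ^+ 2) * rho <= r * eps / (2 * d)].

(** A bound of the failure probability, for the deviation r * eps / (2 * d) in
    each of the d entries, is less than delta. *)
Definition sample_size_fits (d b r eps delta : R) (N : nat) :=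
  (0 < N)%N /\
  2 * d * expR (- (N%:R * ((r * eps / (2 * d)) ^+ 2 / (32 * b ^+ 2)))) < delta.

Lemma near_right0 (P : R -> Prop) (c : R) : 0 < c ->
  (forall x, 0 < x -> x < c -> P x) -> \forall x \near 0^'+, P x.
Proof.
move=> c0 h; near=> x; apply: h; near: x; first exact: nbhs_right_gt.
exact: nbhs_right_lt.
Unshelve. all: by end_near. Qed.

Lemma ln_inv_ge1 (x : R) : 0 < x -> x < expR (- 1) -> 1 <= ln x^-1.
Proof.
move=> x0 xe; rewrite lnV ?posrE// lerNr -[leRHS]expRK ler_ln ?posrE ?expR_gt0//.
exact: ltW.
Qed.

Lemma parameters_exist (d h c rho L M k b : R) :
  1 <= d -> 0 < h -> 0 < c -> 0 < rho -> 0 <= L -> 0 <= M -> 0 < k -> 1 <= b ->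
  exists (r tau : R -> R) (N : R -> R -> nat),
  [/\ forall eps, 0 < eps ->
        parameters_fit d h c rho L M k b (r eps) (tau eps) (Num.min eps 1),
      forall eps delta, 0 < eps -> 0 < delta ->
        sample_size_fits d b (r eps) (Num.min eps 1) (Num.min delta 2^-1) (N eps delta),
      r =O_ (0^'+) (fun eps => eps),
      tau =O_ (0^'+) (fun eps => ln eps^-1) &
      (fun z : R * R => (N z.1 z.2)%:R : R)
          =O_ (filter_prod 0^'+ 0^'+) (fun z => ln z.2^-1 / z.1 ^+ 4)].
Proof.
move=> d1 h0 c0 rho0 L0 M0 k0 b1.
have d0 : 0 < d by rewrite (lt_le_trans ltr01).
have b0 : 0 < b by rewrite (lt_le_trans ltr01).
pose x1 := 4 * d * rho * c ^+ 2 * (L + 1).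
have x10 : 0 < x1.
  by rewrite !mulr_gt0 ?ltr0n ?exprn_gt0// ltr_wpDl.
(* c1 keeps r * c below h and the quadratic remainder below half of the
   admissible bias; c3, below, does the same for the truncation error. *)
pose c1 := Num.min 1 (Num.min (h / c) x1^-1).
have c10 : 0 < c1 by rewrite !lt_min ltr01 divr_gt0// invr_gt0.
have c11 : c1 <= 1 by rewrite ge_min lexx.
have c1h : c1 * c <= h by rewrite -ler_pdivlMr// !ge_min lexx orbT.
have c1x : c1 * x1 <= 1.
  by rewrite -ler_pdivlMr// div1r !ge_min lexx !orbT.
pose x2 := 4 * d * (M + 1) * rho + 1.
have x21 : 1 < x2 by rewrite ltrDr !mulr_gt0// ltr_wpDl.
have x20 : 0 < x2 by rewrite (lt_trans ltr01).
pose c3 := c1 / x2.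
have c30 : 0 < c3 by rewrite divr_gt0.
have c31 : c3 < 1.
  by rewrite ltr_pdivrMr// mul1r (le_lt_trans c11).
pose e (eps : R) := Num.min eps 1.
have e0 eps : 0 < eps -> 0 < e eps by move=> ep; rewrite lt_min ep ltr01.
have e1 eps : e eps <= 1 by rewrite ge_min lexx orbT.
pose r eps := c1 * e eps.
pose tau eps := - ln (c3 * e eps ^+ 2) / k.
pose t eps := r eps * e eps / (2 * d).
have tE eps : t eps = c1 * e eps ^+ 2 / (2 * d) by rewrite /t /r; ring.
pose dl (delta : R) := Num.min delta 2^-1.
have dl0 delta : 0 < delta -> 0 < dl delta by move=> dp; rewrite lt_min dp invr_gt0 ltr0n.
pose X eps delta := 32 * b ^+ 2 / t eps ^+ 2 * ln (4 * d / dl delta).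
pose N eps delta := (Num.truncn (X eps delta)).+1.
have t0 eps : 0 < eps -> 0 < t eps.
  by move=> ep; rewrite tE divr_gt0 ?mulr_gt0 ?exprn_gt0// e0.
have q1 eps : 0 < eps -> c3 * e eps ^+ 2 < 1.
  move=> ep; rewrite (le_lt_trans _ c31)// ler_piMr ?(ltW c30)//.
  by rewrite expr_le1// ltW// e0.
exists r, tau, N; split.
- move=> eps ep; have ep' := e0 _ ep; have er := e1 eps; split.
  + by rewrite mulr_gt0.
  + by rewrite divr_gt0// oppr_gt0 ln_lt0// q1// andbT mulr_gt0 ?exprn_gt0.
  + by rewrite (le_trans _ c1h)// ler_wpM2r ?(ltW c0)// ler_piMr ?(ltW c10)//.
  + change (t eps <= 4 * b); rewrite tE ler_pdivrMr ?mulr_gt0//.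
    have : c1 * e eps ^+ 2 <= 1 by rewrite mulr_ile1// ?(ltW c10)// ?sqr_ge0// expr_le1// ltW.
    by move=> h1; apply: le_trans h1 _; nra.
  + rewrite -/(e eps).
    have -> : expR (- (k * tau eps)) = c3 * e eps ^+ 2.
      rewrite /tau mulrCA divff ?gt_eqF// mulr1 opprK lnK// posrE.
      by rewrite mulr_gt0 ?exprn_gt0.
    have hM : M * (c3 * e eps ^+ 2) * rho <= r eps * e eps / (4 * d).
      rewrite ler_pdivlMr ?mulr_gt0// /c3 /r.
      have -> : M * (c1 / x2 * e eps ^+ 2) * rho * (4 * d) =
          c1 * e eps ^+ 2 * ((4 * d * M * rho) / x2) by ring.
      have -> : c1 * e eps * e eps = c1 * e eps ^+ 2 * 1 by ring.
      rewrite ler_wpM2l//; first by rewrite mulr_ge0 ?sqr_ge0// ltW.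
      rewrite ler_pdivrMr// mul1r /x2 mulrDr mulr1 [in leRHS]mulrDl -addrA lerDl.
      by rewrite addr_ge0// !mulr_ge0// ltW.
    have hL : L * (r eps * c) ^+ 2 * rho <= r eps * e eps / (4 * d).
      rewrite ler_pdivlMr ?mulr_gt0// /r.
      have -> : L * (c1 * e eps * c) ^+ 2 * rho * (4 * d) =
          c1 * e eps ^+ 2 * (c1 * (4 * d * rho * c ^+ 2 * L)) by ring.
      have -> : c1 * e eps * e eps = c1 * e eps ^+ 2 * 1 by ring.
      rewrite ler_wpM2l//; first by rewrite mulr_ge0 ?sqr_ge0// ltW.
      rewrite (le_trans _ c1x)// ler_wpM2l ?(ltW c10)// /x1 ler_wpM2l//.
        by rewrite !mulr_ge0// ?sqr_ge0// ltW.
      by rewrite lerDl.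
    rewrite mulrDl (le_trans (lerD hM hL))// le_eqVlt; apply/orP; left; apply/eqP.
    by field; rewrite gt_eqF.
- move=> eps delta ep dp; split => //.
  change (2 * d * expR (- ((N eps delta)%:R * (t eps ^+ 2 / (32 * b ^+ 2)))) < dl delta).
  have tp := t0 _ ep; have dlp := dl0 _ dp.
  have XN : X eps delta < (N eps delta)%:R by exact: truncnS_gt.
  have tb : 0 < t eps ^+ 2 / (32 * b ^+ 2) 
    by apply: divr_gt0; [exact: exprn_gt0|rewrite mulr_gt0// exprn_gt0].
  have h1 : ln (4 * d / dl delta) < (N eps delta)%:R * (t eps ^+ 2 / (32 * b ^+ 2)).
    rewrite -ltr_pdivrMr//; apply: le_lt_trans XN; rewrite le_eqVlt; apply/orP; left.
    by apply/eqP; rewrite /X; field; rewrite !gt_eqF.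
  have h2 : expR (- ((N eps delta)%:R * (t eps ^+ 2 / (32 * b ^+ 2)))) <
      dl delta / (4 * d).
    have p0 : 0 < 4 * d / dl delta by rewrite divr_gt0 ?mulr_gt0.
    have -> : dl delta / (4 * d) = expR (- ln (4 * d / dl delta)).
      by rewrite expRN lnK ?posrE// invf_div.
    by rewrite ltr_expR ltrN2.
  rewrite (lt_le_trans (_ : _ < 2 * d * (dl delta / (4 * d))))//.
    by rewrite ltr_pM2l// mulr_gt0.
  have -> : 2 * d * (dl delta / (4 * d)) = dl delta / 2 by field; rewrite gt_eqF.
  by rewrite ler_pdivrMr// ler_peMr ?ler1n// ltW.
- apply/eqO_exP; exists c1 => //; apply: (near_right0 ltr01) => x x0 x1'.
  by rewrite normrM (gtr0_norm c10) ler_wpM2l ?(ltW c10)// /e (min_l (ltW x1')).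
- apply/eqO_exP; exists ((2 - ln c3) / k).
    by rewrite divr_gt0// subr_gt0 (lt_trans (ln_lt0 _))// ?c30.
  apply: (near_right0 (expR_gt0 (- 1))) => x x0 xe.
  have x1' : x < 1 by rewrite (lt_trans xe)// expR_lt1 ltrN10.
  have lx := ln_inv_ge1 x0 xe.
  have lx0 : 0 < ln x^-1 by rewrite (lt_le_trans ltr01).
  have lc3 : ln c3 < 0 by rewrite ln_lt0// c30.
  rewrite (gtr0_norm lx0) /tau /e (min_l (ltW x1')) lnM ?posrE ?exprn_gt0//.
  rewrite lnXn// -[in X in `|X|](invrK x) lnV ?posrE ?invr_gt0// mulr2n.
  rewrite ger0_norm; last by rewrite divr_ge0 ?(ltW k0)//; lra.
  by rewrite mulrAC ler_wpM2r ?invr_ge0 ?(ltW k0)//; nra.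
- pose C1 := 128 * b ^+ 2 * d ^+ 2 / c1 ^+ 2.
  have C10 : 0 < C1 by rewrite divr_gt0 ?mulr_gt0 ?exprn_gt0.
  have l4 : 0 <= ln (4 * d) by rewrite ln_ge0//; lra.
  apply/eqO_exP; exists (C1 * (ln (4 * d) + 1) + 1).
    by apply: addr_gt0 => //; apply: mulr_gt0 => //; exact: ltr_wpDl.
  exists ((fun x : R => 0 < x /\ x < 1), (fun x : R => 0 < x /\ x < expR (- 1))).
    split => /=; first by apply: (near_right0 ltr01) => x x0 xc.
    by apply: (near_right0 (expR_gt0 (- 1))) => x x0 xc.
  move=> [x y] /= [[x0 x1'] [y0 ye]].
  have ly := ln_inv_ge1 y0 ye.
  have y2 : y <= 2^-1.
    rewrite (le_trans (ltW ye))// expRN lef_pV2 ?posrE ?expR_gt0//.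
    by rewrite (le_trans _ (expR_ge1Dx _)).
  rewrite ger0_norm ?ler0n// ger0_norm; last first.
    by rewrite divr_ge0 ?exprn_ge0 ?(ltW x0)// (le_trans ler01).
  have XE : X x y = C1 / x ^+ 4 * (ln (4 * d) + ln y^-1).
    rewrite /X tE /e /dl (min_l (ltW x1')) (min_l y2) lnM ?posrE ?invr_gt0 ?mulr_gt0//.
    by rewrite /C1; field; rewrite !gt_eqF.
  have x4 : 0 < x ^+ 4 by rewrite exprn_gt0.
  have X0 : 0 <= X x y.
    rewrite XE; apply: mulr_ge0; first by apply: divr_ge0; exact: ltW.
    by apply: addr_ge0 => //; exact: le_trans ler01 ly.
  rewrite /N -natr1; apply: (@le_trans _ _ (X x y + 1)).
    by rewrite lerD2r truncn_le.
  rewrite XE mulrA ler_pdivlMr// mulrDl.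
  have -> : C1 / x ^+ 4 * (ln (4 * d) + ln y^-1) * x ^+ 4 = C1 * (ln (4 * d) + ln y^-1).
    by field; rewrite gt_eqF.
  have x41 : x ^+ 4 <= 1 by rewrite expr_le1// ltW.
  have -> : (C1 * (ln (4 * d) + 1) + 1) * ln y^-1 =
     C1 * (ln (4 * d) * ln y^-1 + ln y^-1) + ln y^-1 by ring.
  rewrite mul1r lerD ?(le_trans x41)// ler_wpM2l ?(ltW C10)// lerD2r.
  by rewrite ler_peMr.
Qed.

End parameters.

(** * Concentration of the gradient estimate *)

Section measurable_truncated_cost.
Variables (R : realType) (n m p : nat).
Variables (A : 'M[R]_n) (B : 'M[R]_(n, m)) (C : 'M[R]_(p, n)).
Variables (Q : 'M[R]_p) (W : 'M[R]_m).

Lemma locally_lipschitz_cost_weight : locally_lipschitz (cost_weight C Q W).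
Proof.
move=> K; exists (nrm1 C * (2 * nrm1 K + 1) * nrm1 W * nrm1 C).
  by rewrite !mulr_ge0 ?addr_ge0 ?mulr_ge0 ?nrm1_ge0.
move=> K' KK'; set H := K' - K in KK' *.
have K'E : K' = K + H by rewrite /H addrC subrK.
have -> : cost_weight C Q W K' - cost_weight C Q W K =
    C^T *m (H^T *m W *m K' + K^T *m W *m H) *m C.
  rewrite /cost_weight -mulmxBl -mulmxBr; congr (_ *m _ *m _).
  have -> : K'^T = K^T + H^T by rewrite K'E [(K + H)^T]linearD.
  have -> : K^T *m W *m H = K^T *m W *m K' - K^T *m W *m K by rewrite mulmxBr.
  by rewrite !mulmxDl opprD addrACA subrr add0r addrA [K^T *m W *m K' + _]addrC.
have K'n : nrm1 K' <= nrm1 K + 1.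
  by rewrite K'E (le_trans (nrm1D _ _))// lerD2l.
have h : nrm1 (H^T *m W *m K' + K^T *m W *m H) <=
    (2 * nrm1 K + 1) * nrm1 W * nrm1 H.
  rewrite (le_trans (nrm1D _ _))//.
  have h1 := nrm1_conj (lexx (nrm1 H)) K'n (lexx (nrm1 W)).
  have h2 := nrm1_conj (lexx (nrm1 K)) (lexx (nrm1 H)) (lexx (nrm1 W)).
  rewrite (le_trans (lerD h1 h2))// le_eqVlt; apply/orP; left; apply/eqP; ring.
rewrite (le_trans (nrm1_conj (lexx (nrm1 C)) (lexx (nrm1 C)) h))//.
by rewrite le_eqVlt; apply/orP; left; apply/eqP; ring.
Qed.

Lemma continuous_gramian_shift (tau r : R) (K : 'M[R]_(m, p)) i j : 0 <= tau ->
  continuous (fun u : 'M[R]_(m, p) =>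
    gramian (closed_loop A B C (K + r *: u)) (cost_weight C Q W (K + r *: u)) tau i j).
Proof.
move=> tau0 u.
apply: (@continuous_comp _ _ _ (fun u : 'M[R]_(m, p) => K + r *: u)
  (fun K => gramian (closed_loop A B C K) (cost_weight C Q W K) tau i j)).
  apply: (@cvgD _ _ _ (nbhs u) (nbhs_filter u)); first exact: cvg_cst.
  by apply: (@cvgZr _ _ _ (nbhs u) (nbhs_filter u)); exact: cvg_id.
apply: (locally_lipschitz_continuous (F := fun K =>
  gramian (closed_loop A B C K) (cost_weight C Q W K) tau)).
apply: locally_lipschitz_gramian => //.
- exact: locally_lipschitz_closed_loop.
- exact: locally_lipschitz_cost_weight.
Qed.

Lemma measurable_truncated_cost (tau r : R) (K : 'M[R]_(m, p)) : 0 <= tau ->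
  measurable_fun [set: borel_mx R m p * borel_mx R n 1]
    (fun z : borel_mx R m p * borel_mx R n 1 =>
      truncated_cost A B C Q W tau (K + r *: (z.1 : 'M[R]_(m, p))) z.2).
Proof.
move=> tau0.
under eq_fun do rewrite truncated_costE bilinE.
apply: measurable_sum_fun => i; apply: measurable_sum_fun => j.
apply: measurable_funM; last first.
  by apply: measurable_funM; apply: (measurableT_comp (measurable_entry _ _)).
apply: (measurableT_comp (f := fun u : borel_mx R m p =>
  gramian (closed_loop A B C (K + r *: (u : 'M[R]_(m, p))))
    (cost_weight C Q W (K + r *: (u : 'M[R]_(m, p)))) tau i j)) => //.
by apply: measurable_continuous_mx; exact: continuous_gramian_shift.
Qed.

End measurable_truncated_cost.

Lemma ae_normr_Rintegral_le d (T : measurableType d) (R : realType)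
    (P : probability T R) (f : T -> R) (c : R) : measurable_fun setT f ->
  {ae P, forall w, `|f w| <= c} -> `|\int[P]_w f w| <= c.
Proof.
move=> mf fc; have intf := ae_bounded_integrable mf fc.
have mn : measurable_fun setT (fun w => `|f w|) by exact: measurableT_comp.
have intn : P.-integrable setT (EFin \o (fun w => `|f w|)).
  by apply: (ae_bounded_integrable (c := c)) => //; apply: (@filterS _ _
    (ae_filter_ringOfSetsType P) _ _ _ fc) => w; rewrite normr_id.
apply: (le_trans (le_normr_Rintegral measurableT intf)).
have c0 : 0 <= c.
  rewrite leNgt; apply/negP => c0.
  have [S [mS S0 Sb]] := fc.
  have : P setT = 0.
    rewrite -[RHS]S0; congr (P _); apply/seteqP; split => // w _; apply: Sb => /=.
    by apply/negP; rewrite -ltNge (lt_le_trans c0).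
  by rewrite probability_setT => /eqP; rewrite onee_eq0.
rewrite -[leRHS](Rintegral_const P).
apply: fine_le; try exact: integrable_fin_num.
  apply: (@integrable_fin_num _ _ _ P) => //.
  by apply: (ae_bounded_integrable (c := `|c|)) => //; exact: aeW.
apply: ae_ge0_le_integral => //=.
- exact/measurable_EFinP.
- apply: (@filterS _ _ (ae_filter_ringOfSetsType P) _ _ _ fc) => w h _.
  by rewrite lee_fin.
Qed.

Lemma union_bound d (T : measurableType d) (R : realType) (P : probability T R)
    (I : finType) (F : I -> set T) (c : R) :
  (forall i, measurable (F i)) -> (forall i, (P (F i) <= c%:E)%E) ->
  (P (\bigcup_i F i) <= (#|I|%:R * c)%:E)%E.
Proof.
move=> mF Fc.
have h (s : seq I) : measurable (\big[setU/set0]_(i <- s) F i) /\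
    (P (\big[setU/set0]_(i <- s) F i) <= ((size s)%:R * c)%:E)%E.
  elim: s => [|i s [ms IH]]; first by rewrite big_nil measure0 mul0r.
  rewrite big_cons; split; first exact: measurableU.
  apply: (le_trans (measureU2 _ (mF i) ms)).
  by rewrite /= -natr1 mulrDl mul1r addrC EFinD leeD.
have [ms hs] := h (enum I).
rewrite cardE; apply: le_trans hs; apply: le_measure; rewrite ?inE//.
  by apply: fin_bigcup_measurable => // i _; exact: mF.
by move=> w [i _ Fi]; rewrite -bigcup_seq; exists i => //=; rewrite mem_enum.
Qed.

Section concentration.
Variables (R : realType) (n m p : nat).
Variables (A : 'M[R]_n) (B : 'M[R]_(n, m)) (C : 'M[R]_(p, n)).
Variables (Q : 'M[R]_p) (W : 'M[R]_m).
Variables (D : probability (borel_mx R n 1) R) (Pb : R).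
Hypothesis D_bounded : {ae D, forall x, frobenius (x : 'cV[R]_n) <= Pb}.
Hypothesis mp0 : (0 < m * p)%N.

Let dim : R := (m * p)%:R.
Let rho : R := Num.sqrt dim.

Variables (h L M k b r tau eps : R) (K : 'M[R]_(m, p)).
Hypotheses (L0 : 0 <= L) (M0 : 0 <= M) (eps0 : 0 < eps).
Hypothesis fit : parameters_fit dim h (dim * rho) rho L M k b r tau eps.
Hypothesis b_large : M * (n%:R * Pb) ^+ 2 * rho <= b.
Hypothesis b0 : 0 < b.
Hypothesis regular : forall H, nrm1 H <= h ->
  [/\ `|cost A B C Q W D (K + H) - cost A B C Q W D K
        - frob_pair H (grad_cost A B C Q W D K)| <= L * nrm1 H ^+ 2,
      forall tau x, 0 <= tau ->
        `|truncated_cost A B C Q W tau (K + H) x| <= M * nrm1 x ^+ 2 &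
      forall tau, 0 <= tau ->
        `|frob_pair (second_moment D) (gramian (closed_loop A B C (K + H))
            (cost_weight C Q W (K + H)) tau) - cost A B C Q W D (K + H)|
        <= M * expR (- (k * tau))].

Context d (T : measurableType d) (P : probability T R) (N : nat).
Variables (U : 'I_N -> {RV P >-> borel_mx R m p})
  (X : 'I_N -> {RV P >-> borel_mx R n 1}).
Hypothesis sample : is_sample D U X.

Let rho0 : 0 <= rho. Proof. exact: sqrtr_ge0. Qed.

Let rhoE : rho ^+ 2 = (m * p)%:R. Proof. by rewrite sqr_sqrtr. Qed.

Let sphere l : uniform_on_sphere rho (distribution P (U l)).
Proof. by case: sample. Qed.

Let lawX l S : measurable S -> distribution P (X l) S = D S.
Proof. by case: sample => _ h' _; exact: h'. Qed.

Lemma ae_distribution d' (Y : measurableType d') (Z : {mfun T >-> Y}) (q : Y -> Prop) :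
  {ae distribution P Z, forall y, q y} -> {ae P, forall w, q (Z w)}.
Proof.
move=> [S [mS S0 qS]]; exists (Z @^-1` S); split.
- by rewrite -[_ @^-1` _]setTI; exact: measurable_funP.
- exact: S0.
- by move=> w qw; apply: qS.
Qed.

Lemma sample_gain_ae l : {ae P, forall w, frobenius (U l w : 'M[R]_(m, p)) = rho}.
Proof.
apply: (@ae_distribution _ _ (U l) (fun u => frobenius (u : 'M[R]_(m, p)) = rho)).
exact: (sphere_ae rho0 (sphere l)).
Qed.

Lemma sample_state_ae l : {ae P, forall w, frobenius (X l w : 'cV[R]_n) <= Pb}.
Proof.
apply: (@ae_distribution _ _ (X l) (fun x => frobenius (x : 'cV[R]_n) <= Pb)).
have [S [mS S0 qS]] := D_bounded.
by exists S; split => //; rewrite -[RHS]S0; exact: lawX.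
Qed.

Lemma ler_nrm1_sphere (u : 'M[R]_(m, p)) : frobenius u = rho -> nrm1 u <= dim * rho.
Proof.
by move=> ur; apply: nrm1_le_const => i j; rewrite -ur ler_entry_frobenius.
Qed.

(** One term of the estimator, in the coordinate (i, j), without the factor
    1 / r. *)
Definition sample_term i j (z : borel_mx R m p * borel_mx R n 1) : R :=
  truncated_cost A B C Q W tau (K + r *: (z.1 : 'M[R]_(m, p))) z.2 *
  (z.1 : 'M[R]_(m, p)) i j.

Let r0 : 0 < r. Proof. by case: fit. Qed.
Let tau0 : 0 <= tau. Proof. by case: fit => _ /ltW. Qed.

Let small (u : 'M[R]_(m, p)) : frobenius u = rho -> nrm1 (r *: u) <= h.
Proof.
move=> /ler_nrm1_sphere ur; have [_ _ rh _ _] := fit.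
by rewrite nrm1Z gtr0_norm// (le_trans _ rh)// ler_wpM2l// ltW.
Qed.

Lemma measurable_sample_term i j : measurable_fun setT (sample_term i j).
Proof.
apply: measurable_funM; first exact: measurable_truncated_cost.
by apply: (measurableT_comp (measurable_entry _ _)).
Qed.

Lemma sample_term_ae i j l :
  {ae P, forall w, `|sample_term i j (U l w, X l w)| <= b}.
Proof.
apply: (@filterS2 _ _ (ae_filter_ringOfSetsType P) _ _ _ _
  (sample_gain_ae l) (sample_state_ae l)) => w ur xr.
apply: le_trans b_large; rewrite normrM ler_pM//; last first.
  by rewrite -[leRHS]ur ler_entry_frobenius.
have [_ hx _] := regular (small ur).
apply: (le_trans (hx _ _ tau0)); rewrite ler_wpM2l//.
have Pb0 : 0 <= Pb by apply: le_trans xr; exact: sqrtr_ge0.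
rewrite lerXn2r ?nnegrE ?nrm1_ge0// ?mulr_ge0//.
have := @nrm1_le_const R n 1 (X l w) Pb; rewrite muln1; apply => i' j'.
exact: le_trans (ler_entry_frobenius _ _ _) xr.
Qed.

Lemma sample_term_integrable i j l :
  P.-integrable setT (EFin \o (fun w => sample_term i j (U l w, X l w))).
Proof.
apply: (ae_bounded_integrable (c := b)); last exact: sample_term_ae.
apply: (measurableT_comp (measurable_sample_term i j)).
by apply: measurable_fun_pair; exact: measurable_funP.
Qed.

(** The mean over the initial states, for a fixed perturbation of the gain. *)
Lemma mean_sample_term_state i j l (u : 'M[R]_(m, p)) :
  (\int[distribution P (X l)]_x (sample_term i j (u, x))%:E =
   (frob_pair (second_moment D) (gramian (closed_loop A B C (K + r *: u))
      (cost_weight C Q W (K + r *: u)) tau) * u i j)%:E)%E.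
Proof.
rewrite (@eq_measure_integral _ _ _ setT D); last first.
  by move=> S mS _; exact: lawX.
have e x : sample_term i j (u, x) = ((x : 'cV[R]_n)^T *m
    (u i j *: gramian (closed_loop A B C (K + r *: u))
      (cost_weight C Q W (K + r *: u)) tau) *m (x : 'cV[R]_n)) 0 0.
  by rewrite /sample_term truncated_costE -scalemxAr -scalemxAl [RHS]mxE mulrC.
under eq_integral do rewrite e.
by rewrite (integral_quad D_bounded) frob_pairZr mulrC.
Qed.

(** The bias of one term of the estimator. The second moments of the sphere
    extract the gradient from the first-order expansion of the cost; what is left
    is the quadratic remainder and the truncation error. *)
Lemma mean_sample_term i j l :
  `|\int[P]_w sample_term i j (U l w, X l w) - r * grad_cost A B C Q W D K i j|
    <= r * eps / (2 * dim).
Proof.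
set G := grad_cost A B C Q W D K; set nu := distribution P (U l).
pose phi (u : 'M[R]_(m, p)) := frob_pair (second_moment D)
  (gramian (closed_loop A B C (K + r *: u)) (cost_weight C Q W (K + r *: u)) tau).
pose c0 := cost A B C Q W D K.
have meanE : (\int[P]_w (sample_term i j (U l w, X l w))%:E =
    \int[nu]_u (phi u * (u : 'M[R]_(m, p)) i j)%:E)%E.
  have [_ _ ind] := sample.
  rewrite (expectation_pair ind (measurable_sample_term i j) (sample_term_integrable i j l)).
  by apply: eq_integral => u _; exact: mean_sample_term_state.
have [_ _ _ _ hb] := fit.
have bound : {ae nu, forall u : borel_mx R m p,
    `|(phi u - (c0 + frob_pair (u : 'M[R]_(m, p)) (r *: G))) * (u : 'M[R]_(m, p)) i j|
    <= r * eps / (2 * dim)}.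
  apply: (@filterS _ _ (ae_filter_ringOfSetsType nu) _ _ _ (sphere_ae rho0 (sphere l))) => u ur.
  apply: le_trans hb; rewrite normrM ler_pM//; last by rewrite -ur ler_entry_frobenius.
  have [h1 _ h3] := regular (small ur).
  have -> : phi u - (c0 + frob_pair u (r *: G)) =
      (phi u - cost A B C Q W D (K + r *: u)) +
      (cost A B C Q W D (K + r *: u) - c0 - frob_pair (r *: u) G).
    by rewrite frob_pairZr frob_pairZl; ring.
  apply: (le_trans (ler_normD _ _)); apply: lerD; first exact: h3.
  apply: (le_trans h1); rewrite ler_wpM2l// lerXn2r ?nnegrE ?nrm1_ge0//.
    by rewrite !mulr_ge0// ltW.
  by rewrite nrm1Z gtr0_norm// ler_wpM2l ?(ltW r0)// ler_nrm1_sphere.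
have mphi : measurable_fun setT (phi : borel_mx R m p -> R).
  apply: measurable_continuous_mx; apply: continuous_sum_fun => k'.
  apply: continuous_sum_fun => l'.
  by apply: continuous_mul_fun; [exact: continuous_gramian_shift|exact: cst_continuous].
pose aff (u : 'M[R]_(m, p)) := c0 + frob_pair u (r *: G).
have maff : measurable_fun setT (aff : borel_mx R m p -> R).
  apply: measurable_funD; first exact: measurable_cst.
  apply: measurable_continuous_mx; apply: continuous_sum_fun => k'.
  apply: continuous_sum_fun => l'.
  by apply: continuous_mul_fun; [exact: cst_continuous|exact: continuous_entry].
have me := @measurable_entry R m p i j.
have mdiff : measurable_fun setT (fun u : borel_mx R m p =>
    (phi u - aff u) * (u : 'M[R]_(m, p)) i j).
  by apply: measurable_funM => //; exact: measurable_funB.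
have -> : \int[P]_w sample_term i j (U l w, X l w) =
    \int[nu]_u ((phi u - aff u) * (u : 'M[R]_(m, p)) i j) + r * G i j.
  have -> : r * G i j = \int[nu]_u (aff u * (u : 'M[R]_(m, p)) i j).
    by rewrite /aff (sphere_gradient rho0 (sphere l)) ?mxE.
  rewrite -RintegralD//.
  - rewrite {1}/Rintegral meanE; apply: eq_Rintegral => u _.
    by rewrite -mulrDl subrK.
  - exact: (ae_bounded_integrable mdiff bound).
  - apply: (ae_bounded_integrable (c := (`|c0| + dim * rho * nrm1 (r *: G)) * rho)).
      exact: measurable_funM.
    apply: (@filterS _ _ (ae_filter_ringOfSetsType nu) _ _ _
      (sphere_ae rho0 (sphere l))) => u ur.
    rewrite normrM ler_pM//; last by rewrite -[leRHS]ur ler_entry_frobenius.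
    rewrite (le_trans (ler_normD _ _))// lerD2l (le_trans (ler_frob_pair _ _))//.
    by rewrite ler_wpM2r ?nrm1_ge0// ler_nrm1_sphere.
by rewrite addrK; exact: ae_normr_Rintegral_le.
Qed.

(** Union bound over the entries, each of which concentrates around its mean. *)
Theorem grad_estimate_concentration eps' delta : eps <= eps' -> (0 < N)%N ->
  2 * dim * expR (- (N%:R * ((r * eps / (2 * dim)) ^+ 2 / (32 * b ^+ 2)))) < delta ->
  ((1 - delta)%:E <
   P [set w | frobenius (grad_estimate A B C Q W r tau K
       (fun l => U l w) (fun l => X l w) - grad_cost A B C Q W D K) <= eps']%R)%E.
Proof.
move=> eps_le N0 hdelta; set G := grad_cost A B C Q W D K; set S := [set w | _].
have eps'0 : 0 < eps' by rewrite (lt_le_trans eps0).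
have dim0 : 0 < dim by rewrite ltr0n.
have N0' : 0 < N%:R :> R by rewrite ltr0n.
pose t := r * eps / (2 * dim).
have t0 : 0 < t by rewrite divr_gt0// mulr_gt0.
have tb : 0 < t <= 4 * b by rewrite t0/=; case: fit.
pose term (ij : 'I_m * 'I_p) l w := sample_term ij.1 ij.2 (U l w, X l w).
have mterm ij l : measurable_fun setT (term ij l).
  apply: (measurableT_comp (measurable_sample_term ij.1 ij.2)).
  by apply: measurable_fun_pair; exact: measurable_funP.
pose mean ij l := \int[P]_w term ij l w.
pose bad ij := [set w | N%:R * t <= `|\sum_l (term ij l w - mean ij l)|].
have mbad ij : measurable (bad ij).
  have -> : bad ij = (fun w => `|\sum_l (term ij l w - mean ij l)|) @^-1` `[N%:R * t, +oo[.
    by apply/seteqP; split => w; rewrite /bad/= in_itv/= andbT.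
  rewrite -[_ @^-1` _]setTI.
  suff mf : measurable_fun setT (fun w => `|\sum_l (term ij l w - mean ij l)|) by exact: mf.
  apply: measurableT_comp => //; apply: measurable_sum_fun => l.
  exact: measurable_funB.
have badP ij : (P (bad ij) <= (2 * expR (- (N%:R * (t ^+ 2 / (32 * b ^+ 2)))))%:E)%E.
  have [_ _ ind] := sample.
  apply: (hoeffding_ae (F := sample_term ij.1 ij.2) ind) => //.
  - exact: measurable_sample_term.
  - by move=> l; exact: sample_term_ae.
have entryE w i j : (grad_estimate A B C Q W r tau K (fun l => U l w) (fun l => X l w) - G) i j
    = (r * N%:R)^-1 * (\sum_l term (i, j) l w) - G i j.
  rewrite /grad_estimate !mxE summxE; congr (_ * _ - _).
  by apply: eq_bigr => l _; rewrite mxE.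
have mS : measurable S.
  have -> : S = (fun w => \sum_i \sum_j ((r * N%:R)^-1 * (\sum_l term (i, j) l w) - G i j) ^+ 2)
      @^-1` `]-oo, eps' ^+ 2].
    have fro2E w : fro2 (grad_estimate A B C Q W r tau K (fun l => U l w)
        (fun l => X l w) - G) =
        \sum_i \sum_j ((r * N%:R)^-1 * (\sum_l term (i, j) l w) - G i j) ^+ 2.
      by apply: eq_bigr => i _; apply: eq_bigr => j _; rewrite entryE.
    apply/seteqP; split => w; rewrite /S/= in_itv/= frobeniusE -fro2E => hw.
      rewrite -[leLHS]sqr_sqrtr ?fro2_ge0//.
      by rewrite lerXn2r ?nnegrE ?sqrtr_ge0// ltW.
    by rewrite -(gtr0_norm eps'0) -sqrtr_sqr ler_wsqrtr.
  rewrite -[_ @^-1` _]setTI.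
  suff mf : measurable_fun setT (fun w =>
    \sum_i \sum_j ((r * N%:R)^-1 * (\sum_l term (i, j) l w) - G i j) ^+ 2) by exact: mf.
  apply: measurable_sum_fun => i; apply: measurable_sum_fun => j.
  apply: measurable_funX; apply: measurable_funB; last exact: measurable_cst.
  by apply: measurable_funM; [exact: measurable_cst|exact: measurable_sum_fun].
have SC : ~` S `<=` \bigcup_ij bad ij.
  move=> w nS; apply: contrapT => nb; apply: nS.
  have ok i j : `|\sum_l (term (i, j) l w - mean (i, j) l)| <= N%:R * t.
    rewrite leNgt; apply/negP => /ltW hb; apply: nb; by exists (i, j).
  apply: le_trans eps_le; apply: (le_trans (frobenius_le_nrm1 _)).
  have -> : eps = (m * p)%:R * (eps / dim) by rewrite mulrC divfK// gt_eqF.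
  apply: nrm1_le_const => i j; rewrite entryE.
  have -> : (r * N%:R)^-1 * (\sum_l term (i, j) l w) - G i j =
      (r * N%:R)^-1 * (\sum_l (term (i, j) l w - mean (i, j) l) +
        \sum_l (mean (i, j) l - r * G i j)).
    rewrite -big_split/=; under [in RHS]eq_bigr do rewrite addrA subrK.
    rewrite sumrB sumr_const card_ord mulrBr -[_ *+ N]mulr_natr; congr (_ - _).
    by field; rewrite !gt_eqF.
  rewrite normrM gtr0_norm ?invr_gt0 ?mulr_gt0// mulrC ler_pdivrMr ?mulr_gt0//.
  apply: (le_trans (ler_normD _ _)); apply: (le_trans (lerD (ok i j) (ler_norm_sum _ _ _))).
  apply: (@le_trans _ _ (N%:R * t + \sum_(l < N) t)).
    by rewrite lerD2l; apply: ler_sum => l _; exact: mean_sample_term.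
  rewrite sumr_const card_ord -[t *+ N]mulr_natl /t le_eqVlt; apply/orP; left.
  have /andP[m0 p0] : (0 < m)%N && (0 < p)%N by rewrite -muln_gt0.
  by apply/eqP; field; rewrite !pnatr_eq0 -!lt0n m0 p0.
have PC : (P (~` S) < delta%:E)%E.
  apply: (@le_lt_trans _ _ (P (\bigcup_ij bad ij))).
    apply: le_measure; rewrite ?inE//; first exact: measurableC.
    by apply: fin_bigcup_measurable => [|ij _]; [exact: finite_finset|exact: mbad].
  apply: le_lt_trans; first exact: (union_bound mbad badP).
  by rewrite lte_fin card_prod !card_ord mulrA [_ * 2]mulrC.
have fS : P S = (fine (P S))%:E by rewrite fineK// fin_num_measure.
move: PC; rewrite probability_setC// fS -EFinB !lte_fin => ?; lra.
Qed.

End concentration.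


Lemma mx_neq0_dims (R : realType) m n (M : 'M[R]_(m, n)) : M != 0 -> (0 < m)%N && (0 < n)%N.
Proof.
move=> M0; rewrite -muln_gt0 lt0n muln_eq0; apply: contra M0 => /orP[] /eqP e.
  by apply/eqP/matrixP => i; have := ltn_ord i; rewrite {2}e.
by apply/eqP/matrixP => i j; have := ltn_ord j; rewrite {2}e.
Qed.

Theorem theorem2 (R : realType) (n m p : nat)
    (A : 'M[R]_n) (B : 'M[R]_(n, m)) (C : 'M[R]_(p, n))
    (Q : 'M[R]_p) (W : 'M[R]_m)
    (D : probability (borel_mx R n 1) R) (Pbound : R)
    (Omega : set 'M[R]_(m, p)) (K0 : 'M[R]_(m, p)) (a : R)
    (B_neq0 : B != 0) (C_neq0 : C != 0)
    (Q_posdef : posdefmx Q) (W_posdef : posdefmx W)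
    (Sigma_posdef : posdefmx (second_moment D))
    (Pbound_gt0 : 0 < Pbound)
    (D_bounded : {ae D, forall x, frobenius (x : 'cV[R]_n) <= Pbound})
    (AC_observable : observable A C)
    (Omega_closed : closed Omega)
    (Omega_convex : convex_set Omega)
    (K0_in : Omega K0) (K0_stab : stabilizing A B C K0) :
  exists (r tau : R -> R) (N : R -> R -> nat),
    [/\ forall eps : R, 0 < eps -> 0 < r eps,
        forall eps : R, 0 < eps -> 0 < tau eps &
        forall eps delta : R, 0 < eps -> 0 < delta -> (0 < N eps delta)%N] /\
    [/\ r =O_ (0^'+) (fun eps => eps),
        tau =O_ (0^'+) (fun eps => ln eps^-1) &
        (fun z : R * R => (N z.1 z.2)%:R : R)
          =O_ (filter_prod 0^'+ 0^'+) (fun z => ln z.2^-1 / z.1 ^+ 4)] /\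
    forall eps delta : R, 0 < eps -> 0 < delta ->
    forall K : 'M[R]_(m, p), sublevel A B C Q W D a K ->
    forall (d : measure_display) (T : measurableType d) (P : probability T R)
      (U : 'I_(N eps delta) -> {RV P >-> borel_mx R m p})
      (X : 'I_(N eps delta) -> {RV P >-> borel_mx R n 1}),
      is_sample D U X ->
      ((1 - delta)%:E <
        P [set w | frobenius
             (grad_estimate A B C Q W (r eps) (tau eps) K
                (fun i => U i w) (fun i => X i w)
              - grad_cost A B C Q W D K) <= eps]%R)%E.
Proof.
have [h [L [M [k [[h0 L0 M0 k0] reg]]]]] := @cost_regularity R n m p A B C Q W D
  Pbound a Q_posdef W_posdef Sigma_posdef D_bounded AC_observable.
have /andP[_ m0] := mx_neq0_dims B_neq0.
have /andP[p0 _] := mx_neq0_dims C_neq0.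
have mp0 : (0 < m * p)%N by rewrite muln_gt0 m0.
pose dim : R := (m * p)%:R; pose rho := Num.sqrt dim.
have dim1 : 1 <= dim by rewrite ler1n.
have dim0 : 0 < dim by rewrite ltr0n.
have rho0 : 0 < rho by rewrite sqrtr_gt0.
(* an almost sure bound on the terms of the estimator; at least 1, to be positive *)
pose b := M * (n%:R * Pbound) ^+ 2 * rho + 1.
have b1 : 1 <= b by rewrite lerDr !mulr_ge0 ?sqr_ge0// ltW.
have [r [tau [N [fit sizes rO tauO NO]]]] :=
  parameters_exist dim1 h0 (mulr_gt0 dim0 rho0) rho0 L0 M0 k0 b1.
exists r, tau, N; split; [split|split].
- by move=> eps /fit[].
- by move=> eps /fit[].
- by move=> eps delta e0 d0; case: (sizes _ _ e0 d0).
- by split.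
move=> eps delta e0 d0 K Ka d T P U X sample.
have [N0 hN] := sizes _ _ e0 d0.
have e10 : 0 < Num.min eps 1 by rewrite lt_min e0 ltr01.
have b_large : M * (n%:R * Pbound) ^+ 2 * rho <= b by rewrite lerDl.
have b0 : 0 < b by rewrite (lt_le_trans ltr01).
have eps_le : Num.min eps 1 <= eps by rewrite ge_min lexx.
apply: le_lt_trans (grad_estimate_concentration D_bounded mp0 L0 M0 e10 (fit _ e0)
  b_large b0 (reg K Ka) sample eps_le N0 hN).
by rewrite lee_fin lerB// ge_min lexx.
Qed.
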